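(* There exist absolute constants $c_1\in(0,1)$, $c_0,c_\lambda,C,C_1,C_4>0$ and $0<C_2<C_3$ such that the following holds in the setup of the context. Assume $\|A_l^*\|_2\le\rho_{\max}<1$ for all $l\in[m]$, put $\Delta=(1-\rho_{\max})^2$, let $\delta\in(0,c_1)$, $v=C_1\log^2(1/\delta)$, and let $T$ satisfy $C_2v/\Delta^2\le T\le C_3v/\Delta^2$ (so $T\asymp\log^2(1/\delta)/\Delta^2$). Suppose $$m\ge C_4\Big(\frac{d^2}{\log^2(1/\delta)}+\log^2(1/\delta)\Big).$$ Let $L_1=\log\frac{dT}{\delta\Delta}$, $L_2=\log\frac{d|\mathcal E|}{\delta}$, $\mathfrak M=\Delta^{-1/2}\max\{d^{3/2}L_1,\mu L_2\}$ and $\lambda=\frac{c_\lambda}{m}\sqrt{\frac T\Delta}\max\{d^{3/2}L_1,\mu L_2\}$. (Smooth regime) If $$\mu'\Big(1+\frac{\log(1/\delta)}{\Delta}\|\widetilde Da^*\|_1\Big)\le\frac{c_0}{\sqrt{\log(|\mathcal E|d/\delta)}},$$ $$\mu\Big(1+\frac{\log(1/\delta)}{\Delta}\|\widetilde Da^*\|_1\Big)\le c_0\min\Big\{\frac{\sqrt m\log^2(1/\delta)}{d\,\Delta_G\,\Delta^2},\ \frac{\sqrt m\log(1/\delta)}{d\log(d|\mathcal E|/\delta)}\Big\},$$ then with probability at least $1-\delta$, $$\frac1{\sqrt m}\|\widehat a-a^*\|_2\le C\left(\frac{\mathfrak M}{\sqrt{mT}}+\sqrt{\frac{\mathfrak M}{m\sqrt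 T}\|\widetilde Da^*\|_1}\right).$$ (Few-changes regime) If, with $\mathcal S=\mathrm{supp}(\widetilde Da^* )$ and $s=\|\widetilde Da^*\|_0$, $$\mu'\Big(1+\frac{\sqrt s}{\kappa_{\mathcal S}}\Big)\le\frac{c_0}{\sqrt{\log(|\mathcal E|d/\delta)}},\qquad \mu\Big(1+\frac{\sqrt s}{\kappa_{\mathcal S}}\Big)\le c_0\min\Big\{\frac{\sqrt m\log^2(1/\delta)}{d\,\Delta_G\,\Delta^2},\ \frac{\sqrt m\log(1/\delta)}{d\log(d|\mathcal E|/\delta)}\Big\},$$ then with probability at least $1-\delta$, $$\frac1{\sqrt m}\|\widehat a-a^*\|_2\le C\,\frac{\mathfrak M}{\sqrt{mT}}\Big(1+\frac{\sqrt s}{\kappa_{\mathcal S}}\Big).$$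
   Context: Setup. Let $d,T\ge1$, $m\ge2$ be integers and $G=([m],\mathcal E)$ an undirected connected graph. Let $A_1^*,\dots,A_m^*\in\mathbb R^{d\times d}$ be deterministic matrices. For each $l\in[m]$, $x_{l,0}=0$ and $x_{l,t+1}=A_l^*x_{l,t}+\eta_{l,t+1}$ for $t=0,\dots,T$, where the $\eta_{l,t}$ are i.i.d. $\mathcal N(0,I_d)$ over all $l,t$. Vectorized model. $\mathrm{vec}$ stacks columns. $X_l=[x_{l,1}\cdots x_{l,T}]$, $\widetilde X_l=[x_{l,2}\cdots x_{l,T+1}]$, both in $\mathbb R^{d\times T}$. $Q=\mathrm{blkdiag}(X_l^\top\otimes I_d)_{l=1}^m$; $a^*\in\mathbb R^{md^2}$ and $\widetilde x\in\mathbb R^{mdT}$ are obtained by stacking over $l$ the vectors $\mathrm{vec}(A_l^* )$ and $\mathrm{vec}(\widetilde X_l)$. Graph quantities. $D\in\{-1,0,1\}^{|\mathcal E|\times m}$ is the incidence matrix of an arbitrary orientation of $G$ (each row has one $+1$ and one $-1$, at the endpoints of the edge), $\widetilde D=D\otimes I_{d^2}$, and $D^\dagger$ is the Moore–Penrose pseudoinverse. $\mu$ is the maximum Euclidean norm of a column of $D^\dagger\in\mathbb R^{m\times|\mathcal E|}$, and $\mu'$ the maximum Euclidean norm of a row of $D^\dagger$. For $\mathcal T\subseteq[d^2|\mathcal E|]$ the compatibility factor is $\kappa_\emptyset=1$ and $\kappa_{\mathcal T}=\inf_{\theta\in\mathbb R^{md^2}}\frac{\sqrt{|\mathcal T|}\,\|\theta\|_2}{\|(\widetilde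 D\theta)_{\mathcal T}\|_1}$ for $\mathcal T\ne\emptyset$ (infimum over $\theta$ with nonzero denominator), where $(x)_{\mathcal T}$ denotes restriction of $x$ to coordinates in $\mathcal T$. $\|x\|_0$ is the number of nonzero entries of $x$. System quantities. $\Gamma_t(A)=\sum_{k=0}^tA^k(A^k)^\top$, $G_l=\sum_{t=1}^T\Gamma_{t-1}(A_l^* )$, $\overline G=\frac1m\sum_{l=1}^mG_l$, and $\Delta_G=\max_{a,b\in[d]}\big(\sum_{l=1}^m[(G_l)_{b,a}-(\overline G)_{b,a}]^2\big)^{1/2}$; a fraction with $\Delta_G=0$ in the denominator is read as $+\infty$. $\|\cdot\|_2$ of a matrix is the spectral norm. Estimator. For $\lambda\ge0$, $\widehat a\in\arg\min_{a\in\mathbb R^{md^2}}\big\{\frac1{2m}\|\widetilde x-Qa\|_2^2+\lambda\|\widetilde Da\|_1\big\}$ (any minimizer). *)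

(* Defs.v *)
From HB Require Import structures.
From mathcomp Require Import all_boot all_order all_algebra.
From mathcomp Require Export mxtens.
From mathcomp Require Import all_classical all_reals all_analysis.

Set Implicit Arguments.
Unset Strict Implicit.
Unset Printing Implicit Defensive.

Import Order.TTheory GRing.Theory Num.Theory.

Local Open Scope classical_set_scope.
Local Open Scope ring_scope.

Definition l2norm (R : realType) (n : nat) (x : 'cV[R]_n) : R :=
  Num.sqrt (\sum_i (x i 0) ^+ 2).

Definition l1norm (R : realType) (n : nat) (x : 'cV[R]_n) : R :=
  \sum_i `|x i 0|.

Definition l1norm_on (R : realType) (n : nat) (S : {set 'I_n}) (x : 'cV[R]_n) : R :=
  \sum_(i in S) `|x i 0|.

Definition supp (R : realType) (n : nat) (x : 'cV[R]_n) : {set 'I_n} :=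
  [set i | x i 0 != 0]%SET.

Definition spectral_norm (R : realType) (p n : nat) (A : 'M[R]_(p, n)) : R :=
  sup [set l2norm (A *m v) | v in [set v : 'cV[R]_n | l2norm v <= 1]].

(* Indices of product size are split by [mxtens_unindex k = (k %/ n, k %% n)],
   the convention of the Kronecker product [tensmx]. In [vec] the quotient is
   the column, so that columns are stacked. *)
Definition vec (R : realType) (p n : nat) (X : 'M[R]_(p, n)) : 'cV[R]_(n * p) :=
  \col_k X (mxtens_unindex k).2 (mxtens_unindex k).1.

Definition stack (R : realType) (m n : nat) (v : 'I_m -> 'cV[R]_n) :
    'cV[R]_(m * n) :=
  \col_k v (mxtens_unindex k).1 (mxtens_unindex k).2 0.

(* [mxdiag] only allows square blocks. *)
Definition blkdiag (R : realType) (m p n : nat) (B : 'I_m -> 'M[R]_(p, n)) :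
    'M[R]_(m * p, m * n) :=
  \matrix_(i, j)
    if (mxtens_unindex i).1 == (mxtens_unindex j).1
    then B (mxtens_unindex i).1 (mxtens_unindex i).2 (mxtens_unindex j).2
    else 0.

(* Mutual independence: product rule over every subfamily. *)
Definition mutually_independent (R : realType) (disp disp' : measure_display)
    (Omega : measurableType disp) (V : measurableType disp')
    (P : probability Omega R) (I : finType) (X : I -> {RV P >-> V}) : Prop :=
  forall (J : {set I}) (B : I -> set V), (forall i, measurable (B i)) ->
    P [set w | forall i, i \in J -> B i (X i w)] =
    (\prod_(i in J) P (X i @^-1` B i))%E.

(* N(0, I_d) is the product measure of d copies of N(0, 1), which is
   determined by its values on measurable boxes. *)
Definition std_gaussian_vector (R : realType) (disp : measure_display)
    (Omega : measurableType disp) (P : probability Omega R) (d : nat)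
    (X : {RV P >-> d.-tuple R}) : Prop :=
  forall B : 'I_d -> set R, (forall i, measurable (B i)) ->
    distribution P X [set x | forall i, B i (tnth x i)] =
    (\prod_(i < d) normal_prob 0 1 (B i))%E.

(* A is only required to contain an event of probability at least p, as A need
   not be an event. *)
Definition with_prob_at_least (R : realType) (disp : measure_display)
    (Omega : measurableType disp) (P : probability Omega R) (p : R)
    (A : set Omega) : Prop :=
  exists E : set Omega, [/\ measurable E, E `<=` A & (p%:E <= P E)%E].

(* A simple graph on 'I_m is given by its set of edges, which are
   two-element sets. *)
Definition simple_graph (m : nat) (E : {set {set 'I_m}}) : Prop :=
  forall e, e \in E -> #|e| = 2.

Definition connected_graph (m : nat) (E : {set {set 'I_m}}) : Prop :=
  forall i j : 'I_m, connect [rel u v | [set u; v]%SET \in E] i j.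

(* The k-th edge is directed from (o k).1 to (o k).2. *)
Definition orientation (m : nat) (E : {set {set 'I_m}})
    (o : 'I_#|E| -> 'I_m * 'I_m) : Prop :=
  forall k, enum_val k = [set (o k).1; (o k).2]%SET.

Definition incidence (R : realType) (m p : nat) (o : 'I_p -> 'I_m * 'I_m) :
    'M[R]_(p, m) :=
  \matrix_(k, i) ((i == (o k).1)%:R - (i == (o k).2)%:R).

(* The four Penrose equations, which have exactly one solution B. *)
Definition is_pinv (R : realType) (p n : nat)
    (A : 'M[R]_(p, n)) (B : 'M[R]_(n, p)) : Prop :=
  [/\ A *m B *m A = A, B *m A *m B = B,
      (A *m B)^T = A *m B & (B *m A)^T = B *m A].

Definition max_col_norm (R : realType) (p n : nat) (B : 'M[R]_(p, n)) : R :=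
  \big[Num.max/0]_(j < n) l2norm (col j B).

Definition max_row_norm (R : realType) (p n : nat) (B : 'M[R]_(p, n)) : R :=
  \big[Num.max/0]_(i < p) l2norm (row i B)^T.

Definition compat_factor (R : realType) (p n : nat) (M : 'M[R]_(p, n))
    (S : {set 'I_p}) : R :=
  if S == finset.set0 then 1
  else inf [set Num.sqrt #|S|%:R * l2norm theta / l1norm_on S (M *m theta)
           | theta in [set theta : 'cV[R]_n | l1norm_on S (M *m theta) != 0]].

Definition Gramian (R : realType) (d t : nat) (A : 'M[R]_d) : 'M[R]_d :=
  \sum_(0 <= k < t.+1) (A ^+ k) *m (A ^+ k)^T.

(* Summing Gamma_(t-1) over 1 <= t <= T is summing Gamma_t over 0 <= t < T. *)
Definition cumul_Gramian (R : realType) (d T : nat) (A : 'M[R]_d) : 'M[R]_d :=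
  \sum_(1 <= t < T.+1) Gramian t.-1 A.

Definition mean_Gramian (R : realType) (d m T : nat) (A : 'I_m -> 'M[R]_d) :
    'M[R]_d :=
  m%:R^-1 *: \sum_(l < m) cumul_Gramian T (A l).

Definition Gramian_spread (R : realType) (d m T : nat) (A : 'I_m -> 'M[R]_d) :
    R :=
  \big[Num.max/0]_(a < d) \big[Num.max/0]_(b < d)
    Num.sqrt (\sum_(l < m) (cumul_Gramian T (A l) b a - mean_Gramian T A b a) ^+ 2).

(* The noise entering the state at time t is eta t; eta 0 is never used. *)
Fixpoint state (R : realType) (d : nat) (A : 'M[R]_d) (eta : nat -> 'cV[R]_d)
    (t : nat) : 'cV[R]_d :=
  if t is s.+1 then A *m state A eta s + eta s.+1 else 0.

Definition noise_path (R : realType) (disp : measure_display)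
    (Omega : measurableType disp) (P : probability Omega R) (d : nat)
    (eta : nat -> {RV P >-> d.-tuple R}) (w : Omega) : nat -> 'cV[R]_d :=
  fun t => \col_i tnth (eta t w) i.

(* [x 1, ..., x T] and [x 2, ..., x (T + 1)]. *)
Definition regressors (R : realType) (d T : nat) (x : nat -> 'cV[R]_d) :
    'M[R]_(d, T) :=
  \matrix_(i, t) x t.+1 i 0.

Definition responses (R : realType) (d T : nat) (x : nat -> 'cV[R]_d) :
    'M[R]_(d, T) :=
  \matrix_(i, t) x t.+2 i 0.

Definition design (R : realType) (d m T : nat) (x : 'I_m -> nat -> 'cV[R]_d) :
    'M[R]_(m * (T * d), m * (d * d)) :=
  blkdiag (fun l => tensmx (regressors T (x l))^T (1%:M : 'M[R]_d)).

Definition targets (R : realType) (d m T : nat) (x : 'I_m -> nat -> 'cV[R]_d) :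
    'cV[R]_(m * (T * d)) :=
  stack (fun l => vec (responses T (x l))).

Definition tv_objective (R : realType) (m n q p : nat) (y : 'cV[R]_n)
    (Q : 'M[R]_(n, q)) (Dt : 'M[R]_(p, q)) (lambda : R) (a : 'cV[R]_q) : R :=
  (2 * m%:R)^-1 * l2norm (y - Q *m a) ^+ 2 + lambda * l1norm (Dt *m a).

Definition minimizer (R : realType) (n : nat) (f : 'cV[R]_n -> R)
    (a : 'cV[R]_n) : Prop :=
  forall b, f a <= f b.

(* Main.v *)
(* Let h be the estimation error, viewed as a vector h_l per vertex, and Q the
   design matrix.

   Noise. Writing h as its mean over the graph plus the image under the
   pseudoinverse of its jumps across edges, the inner product of Q h with the
   noise is a combination of scalar martingales. Exponential moments bound them
   all, and the basic inequality then bounds |Q h|^2 by a multiple of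
   |h| + |D h|_1 + 2 (|D a*|_1 - |D ahat|_1).

   Restricted eigenvalue. It remains to show that |Q h|^2 is at least
   c T (|h|^2 - mu'^2 L |D h|_1^2). For fixed directions v_l and s >= 0, one
   integrates out the Gaussian noise one time step at a time to get
     E exp(- s sum_l |X_l^T v_l|^2) <= exp(- (T / 4) sum_l min(s |v_l|^2, 1)).
   To make this uniform in h, cut the vertices into dyadic shells according to
   |h_l|. On each shell h is replaced (Maurey) by the mean of a few normalized
   columns of the pseudoinverse, of which there are few tuples; the thresholds
   between shells are chosen by the coarea inequality, so that the union bound
   over all vertex sets, which costs only the size of their edge boundary, is
   paid for by |D h|_1. *)

Require Import Defs.
From HB Require Import structures.
From mathcomp Require Import all_boot all_order all_algebra.
From mathcomp Require Import all_classical all_reals all_analysis.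
From mathcomp Require Import measurable_realfun ring lra.

Set Implicit Arguments.
Unset Strict Implicit.
Unset Printing Implicit Defensive.

Import Order.TTheory GRing.Theory Num.Theory.

Local Open Scope classical_set_scope.
Local Open Scope ring_scope.

(** * Gaussian integrals *)

(** The obstacle is that [T] may be far smaller than [d]. The regressors of one vertex then span a
    proper subspace, and [|Q h|^2] can vanish for an error carried by a single vertex. Curvature can
    only come from many vertices together; an error carried by few of them has to show in its jumps,
    which is why [|D h|_1^2] is subtracted. The rows of the matrices decouple, but even for one row
    a net over all [h] has entropy of order [m d], against a failure exponent of order [m T].
    Sampling replaces this entropy by (number of draws) times [log (d |E| / delta)], with a number
    of draws independent of [d] and [m] on each shell. Shells are needed because the exponent
    saturates: [min(s |v_l|^2, 1)] is useful only when [s] matches the size of [v_l], so within a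
    shell the sizes must be comparable. A cut of [N] edges costs [N log (d |E| / delta)]. As a
    nonempty cut satisfies [1 <= 4 mu'^2 N], this is at most quadratic in [N], so that the total
    cost scales like [|D h|_1^2] and is homogeneous with [|h|^2]. Numerical constants are round and
    not optimized. *)

Lemma le_integral_pos d (T : measurableType d) (R : realType)
    (mu : {measure set T -> \bar R}) (f g : T -> \bar R) :
  (forall x, 0 <= f x)%E -> (forall x, f x <= g x)%E ->
  (\int[mu]_x f x <= \int[mu]_x g x)%E.
Proof.
move=> f0 fg.
have g0 x : (0 <= g x)%E by exact: le_trans (f0 x) (fg x).
(* The integral of a nonnegative function is a supremum over the simple functions below it, so the
   comparison needs no measurability. Nested integrals can then be compared without checking that
   the inner ones are measurable. *)
rewrite !ge0_integralTE//; apply: le_ereal_sup => _ [h hf <-].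
by exists h => // x; exact: le_trans (hf x) (fg x).
Qed.

Section gaussian_integral.
Context {R : realType}.
Local Notation gam := (@normal_prob R 0 1).
Local Notation lam := (@lebesgue_measure R).
Local Notation pdf := (normal_pdf (0 : R) 1).

Let mpdf : measurable_fun setT (fun x : measurableTypeR R => (pdf x)%:E : \bar R).
Proof. by apply/measurable_EFinP; exact: measurable_normal_pdf. Qed.

Let pdf0 x : (0 <= (pdf x)%:E)%E.
Proof. by rewrite lee_fin normal_pdf_ge0. Qed.

Import HBNNSimple.

Let gauss_indic E : measurable E ->
  (\int[gam]_x (\1_E x)%:E = \int[lam]_x ((\1_E x)%:E * (pdf x)%:E))%E.
Proof.
move=> mE; rewrite integral_indic//= setIT /normal_prob integral_mkcond/=.
apply: eq_integral => x _; rewrite patchE indicE.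
by case: ifPn => _; rewrite ?mul1e ?mul0e.
Qed.

Let gauss_nnsfun (f : {nnsfun _ >-> R}) :
  (\int[gam]_x (f x)%:E = \int[lam]_x ((f x)%:E * (pdf x)%:E))%E.
Proof.
under [LHS]eq_integral do rewrite fimfunE -fsumEFin//.
rewrite [LHS]ge0_integral_fsum//; last 2 first.
  - by move=> r; exact/measurable_EFinP/measurableT_comp.
  - by move=> n x _; rewrite EFinM nnfun_muleindic_ge0.
under [RHS]eq_integral.
  move=> x xD; rewrite fimfunE -fsumEFin// muleC ge0_mule_fsumr; last first.
    by move=> r; rewrite EFinM nnfun_muleindic_ge0.
  over.
rewrite [RHS]ge0_integral_fsum//; last 2 first.
  - move=> r; apply: emeasurable_funM => //.
    by apply/measurable_EFinP; do 2 apply/measurableT_comp => //.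
  - by move=> n x _; rewrite EFinM mule_ge0//; rewrite nnfun_muleindic_ge0.
apply: eq_fsbigr => r rf.
have r0 : (0 <= r)%R.
  by move: rf; rewrite inE => -[x _ <-].
transitivity (r%:E * \int[gam]_x (\1_(f @^-1` [set r]) x)%:E)%E.
  rewrite -ge0_integralZl//; last exact/measurable_EFinP/measurable_indic.
rewrite gauss_indic// -ge0_integralZl//; last 2 first.
  - apply: emeasurable_funM => //; exact/measurable_EFinP/measurable_indic.
  - by move=> x _; rewrite mule_ge0// lee_fin.
by apply: eq_integral => x _; rewrite [RHS]muleC EFinM muleA.
Qed.

Lemma integral_std_normal (f : measurableTypeR R -> \bar R) :
  measurable_fun setT f -> (forall x, 0 <= f x)%E ->
  (\int[gam]_x f x = \int[lam]_x (f x * (pdf x)%:E))%E.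
Proof.
move=> mf f0.
pose f_ := nnsfun_approx measurableT mf.
have mfn n : measurable_fun setT (fun x : measurableTypeR R => (f_ n x)%:E : \bar R).
  exact/measurable_EFinP/measurable_funTS.
have nd x n k : (n <= k)%N -> f_ n x <= f_ k x.
  by move=> nk; exact/lefP/nd_nnsfun_approx.
transitivity (lim (\int[gam]_x (f_ n x)%:E @[n --> \oo])%E).
  rewrite -monotone_convergence//=.
  - apply: eq_integral => ? /[!inE] xD; apply/esym/cvg_lim => //=.
    exact: cvg_nnsfun_approx.
  - by move=> n ? _; rewrite lee_fin.
  - by move=> x _ n k nk; rewrite lee_fin; exact: nd.
rewrite [RHS](_ : _ = lim
    (\int[lam]_x ((f_ n x)%:E * (pdf x)%:E) @[n --> \oo])%E); last first.
  rewrite -monotone_convergence//=.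
  - apply: eq_integral => x _; apply/esym/cvg_lim => //.
    by apply: cvgeZr => //; exact: cvg_nnsfun_approx.
  - by move=> n; apply: (emeasurable_funM (mfn n) mpdf).
  - by move=> n ? _; rewrite mule_ge0// lee_fin.
  - by move=> x _ n k nk; rewrite lee_wpmul2r// lee_fin; exact: nd.
by apply: congr_lim; apply/funext => n; exact: gauss_nnsfun.
Qed.

(** Completing the square turns the integrand times the density into a constant times the normal
    density of mean [a / c] and variance [1 / c]. Values of [b] in [(-1/2, 0)] are included; they
    give the moments of positive quadratic exponents. *)
Lemma integral_exp_quadratic (C a b : R) : 0 < 1 + 2 * b ->
  (\int[gam]_x (expR (C + a * x - b * x ^+ 2))%:E =
   ((Num.sqrt (1 + 2 * b))^-1 * expR (C + a ^+ 2 / (2 * (1 + 2 * b))))%:E)%E.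
Proof.
move=> b0; set c := 1 + 2 * b.
have c0 : c != 0 by rewrite gt_eqF.
pose s := (Num.sqrt c)^-1.
have s0 : s != 0 by rewrite invr_eq0 gt_eqF// sqrtr_gt0.
have s2 : s ^+ 2 = c^-1 by rewrite exprVn sqr_sqrtr// ltW.
pose K := (Num.sqrt c)^-1 * expR (C + a ^+ 2 / (2 * c)).
rewrite integral_std_normal; last 2 first.
- apply/measurable_EFinP; apply: measurableT_comp => //.
  apply: measurable_funB; last by apply: measurable_funM => //.
  by apply: measurable_funD => //; apply: measurable_funM.
- by move=> x; rewrite lee_fin expR_ge0.
transitivity (\int[lam]_x (K%:E * (normal_pdf (a / c) s x)%:E))%E.
  apply: eq_integral => x _; rewrite -!EFinM; congr EFin.
  rewrite /normal_pdf oner_eq0 (negbTE s0) /normal_fun /K.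
  have -> : normal_peak s = Num.sqrt c * normal_peak 1.
    rewrite /normal_peak s2 expr1n mul1r -mulrnAr sqrtrM ?invr_ge0 ?ltW//.
    by rewrite sqrtrV ?ltW// invfM invrK.
  have iq : (Num.sqrt c)^-1 * Num.sqrt c = 1 by rewrite mulVf// gt_eqF// sqrtr_gt0.
  transitivity (normal_peak 1 * (expR (C + a ^+ 2 / (2 * c)) *
      expR (- (x - a / c) ^+ 2 / (s ^+ 2 *+ 2)))); last first.
    by rewrite -[LHS]mul1r -iq; ring.
  rewrite mulrCA -!expRD; congr (_ * expR _).
  rewrite s2 /c -[_ *+ 2]mulr_natr -[in RHS]mulr_natr.
  by field; rewrite ?pnatr_eq0 -/c c0.
rewrite ge0_integralZl//; last 3 first.
- by apply/measurable_EFinP; exact: measurable_normal_pdf.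
- by move=> x _; rewrite lee_fin normal_pdf_ge0.
- by rewrite lee_fin mulr_ge0 ?invr_ge0 ?expR_ge0.
by rewrite integral_normal_pdf mule1.
Qed.

End gaussian_integral.

(** * Iterated Gaussian integration *)

Lemma measure_tuple_boxes_unique (R : realType) n
    (m1 m2 : {measure set (n.-tuple R) -> \bar R}) :
  (m1 setT < +oo)%E ->
  (forall B : 'I_n -> set R, (forall i, measurable (B i)) ->
    m1 [set t | forall i, B i (tnth t i)] =
    m2 [set t | forall i, B i (tnth t i)]) ->
  forall A, measurable A -> m1 A = m2 A.
Proof.
move=> fin12 eqB A mA.
pose G : set (set (n.-tuple R)) := [set C | exists B : 'I_n -> set R,
  (forall i, measurable (B i)) /\ C = [set t | forall i, B i (tnth t i)]].
have GT : G setT.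
  exists (fun=> setT); split => //.
  by apply/seteqP; split => // t _ i.
have mG : G `<=` measurable.
  move=> _ [B [mB ->]].
  have -> : [set t | forall i, B i (tnth t i)] =
      \bigcap_(i in [set: 'I_n]) ((fun t : n.-tuple R => tnth t i) @^-1` B i).
    apply/seteqP; split => [t tB i _|t tB i]; [exact: tB|exact: (tB i)].
  apply: fin_bigcap_measurable; first exact: finite_finset.
  move=> i _; rewrite -[X in measurable X]setTI.
  exact: measurable_tnth.
apply: (g_sigma_algebra_measure_unique G mG (fun=> setT)) => //.
- by rewrite bigcup_const.
- move=> _ _ [B1 [mB1 ->]] [B2 [mB2 ->]].
  exists (fun i => B1 i `&` B2 i); split; first by move=> i; exact: measurableI.
  apply/seteqP; split => [t [t1 t2] i|t t12]; first by split.
  by split => i; have [] := t12 i.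
- by move=> _ [B [mB ->]]; exact: eqB.
- move: A mA; apply: smallest_sub; first exact: smallest_sigma_algebra.
  move=> A; rewrite -bigcup_seq => -[i _] [B mB <-].
  apply: sub_sigma_algebra.
  exists (fun j => if j == i then B else setT); split.
    by move=> j; case: ifP => //.
  apply/seteqP; split => [t [_ tB] j|t tB].
    by case: eqP => [->|].
  by split => //; have := tB i; rewrite eqxx.
Qed.

Section iterated_gaussian_integral.
Context {R : realType}.
Local Notation gam := (@normal_prob R 0 1).

Fixpoint iterint n (F : seq R -> \bar R) : \bar R :=
  if n is n'.+1 then (\int[gam]_x iterint n' (fun s => F (x :: s)))%E
  else F [::].

(** The law of (head, tail) is the product of [gam] and the law of the tail: for a fixed head set,
    both sides are finite measures of the tail set that agree on boxes. Tonelli then peels off one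
    integral. [F] takes lists so that the recursion on [n] needs no dependent types. *)
Lemma iterint_law n (mu : probability (n.-tuple R) R) (F : seq R -> \bar R) :
  (forall B : 'I_n -> set R, (forall i, measurable (B i)) ->
    mu [set t | forall i, B i (tnth t i)] = (\prod_(i < n) gam (B i))%E) ->
  (forall s, 0 <= F s)%E ->
  measurable_fun setT (fun t : n.-tuple R => F t) ->
  (\int[mu]_t F t = iterint n F)%E.
Proof.
elim: n mu F => [|n IH] mu F muB F0 mF /=.
  rewrite (eq_integral (fun=> F [::])); last by move=> t _; rewrite tuple0.
  rewrite integral_cst//= probability_setT mule1//.
pose hd := fun t : n.+1.-tuple R => thead t.
pose tl := fun t : n.+1.-tuple R => [tuple of behead t] : n.-tuple R.
have tlE t i : tnth (tl t) i = tnth t (lift ord0 i).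
  by rewrite [in RHS](tuple_eta t) tnthS.
have mhd : measurable_fun setT hd by exact: measurable_tnth.
have mtl : measurable_fun setT tl by exact: measurable_behead.
pose phi := fun t : n.+1.-tuple R => (hd t, tl t) : measurableTypeR R * n.-tuple R.
have mphi : measurable_fun setT phi by exact: measurable_fun_pair.
pose tlm : {mfun (n.+1.-tuple R) >-> (n.-tuple R)} :=
  HB.pack tl (isMeasurableFun.Build _ _ _ _ tl mtl).
pose mu' : probability (n.-tuple R) R := distribution mu tlm.
have box (B0 : set R) (B : 'I_n -> set R) : measurable B0 ->
    (forall i, measurable (B i)) ->
    mu [set t | B0 (hd t) /\ forall i, B i (tnth (tl t) i)] =
    (gam B0 * \prod_(i < n) gam (B i))%E.
  move=> mB0 mB.
  pose C i := if unlift ord0 i is Some j then B j else B0.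
  have -> : [set t | B0 (hd t) /\ forall i, B i (tnth (tl t) i)] =
      [set t : n.+1.-tuple R | forall i, C i (tnth t i)].
    apply/seteqP; split => t /=.
      move=> [t0 tB] i; rewrite /C; case: unliftP => [j ->|->//].
      by have := tB j; rewrite tlE.
    move=> tC; split; first by have := tC ord0; rewrite /C unlift_none.
    move=> i; have := tC (lift ord0 i); rewrite /C liftK.
    by rewrite tlE.
  rewrite muB; last by move=> i; rewrite /C; case: unliftP.
  rewrite big_ord_recl /C unlift_none; congr (_ * _)%E.
  by apply: eq_bigr => i _; rewrite liftK.
have mu'B (B : 'I_n -> set R) : (forall i, measurable (B i)) ->
    mu' [set t | forall i, B i (tnth t i)] = (\prod_(i < n) gam (B i))%E.
  move=> mB; have := box setT B measurableT mB.
  rewrite [X in (X * _)%E]probability_setT mul1e => <-.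
  by congr (mu _); apply/seteqP; split => t //= [].
pose muphi : {measure set (measurableTypeR R * n.-tuple R) -> \bar R} :=
  measure_function_pushforward__canonical__measure_function_Measure mu mphi.
have lawE : forall X, measurable X -> (gam \x mu')%E X = muphi X.
  apply: (@product_measure_unique _ _ _ _ R gam mu' muphi) => A C mA mC.
  have mhA : measurable (hd @^-1` A) by rewrite -[X in measurable X]setTI; exact: mhd.
  pose rA : {nonneg R} := NngNum (fine_ge0 (measure_ge0 gam A)).
  have rAE : (rA%:num%:E = gam A)%E.
    by rewrite /= fineK// fin_num_measure.
  transitivity (mscale rA mu' C); last by rewrite /mscale rAE.
  pose mC' : {measure set (n.-tuple R) -> \bar R} :=
    measure_function_pushforward__canonical__measure_function_Measure
      (measure_function_mrestr__canonical__measure_function_Measure mu mhA) mtl.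
  transitivity (mC' C).
    rewrite /mC' /muphi /= /pushforward /mrestr /=; congr (mu _).
    by apply/seteqP; split => t //= [].
  apply: measure_tuple_boxes_unique => //.
    rewrite /mC' /= /pushforward /mrestr /=.
    rewrite (le_lt_trans (probability_le1 _ _)) ?ltry//.
    by apply: measurableI => //; rewrite preimage_setT.
  move=> B mB; rewrite /mC' /= /mscale rAE [in RHS]/= mu'B// -box//.
  rewrite /pushforward /mrestr.
  by congr (mu _); apply/seteqP; split => t //= [].
rewrite (_ : (\int[mu]_t F t)%E =
  (\int[mu]_t ((fun z : measurableTypeR R * n.-tuple R => F (z.1 :: z.2)) \o phi) t)%E);
  last first.
  by apply: eq_integral => t _; congr F; rewrite [in LHS](tuple_eta t).
have mFc : measurable_fun setT (fun z : measurableTypeR R * n.-tuple R => F (z.1 :: z.2)).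
  have mc : measurable_fun setT (fun z : measurableTypeR R * n.-tuple R => [the
    n.+1.-tuple R of z.1 :: z.2]).
    exact: measurable_cons.
  exact: (measurableT_comp mF mc).
rewrite -(@ge0_integral_pushforward _ _ _ _ _ phi mphi mu setT)//=.
transitivity (\int[(gam \x mu')%E]_z F (z.1 :: z.2))%E.
  by apply: eq_measure_integral => X mX _; exact/esym/lawE.
rewrite fubini_tonelli1//=; apply: eq_integral => x _; rewrite /fubini_F /=.
apply: IH => //.
have mx : measurable_fun setT (fun t : n.-tuple R => [the n.+1.-tuple R of x :: t]).
  exact: measurable_cons.
exact: (measurableT_comp mF mx).
Qed.

Definition upd (I : eqType) (g : I -> R) (i : I) (x : R) : I -> R :=
  fun j => if j == i then x else g j.

Fixpoint upds (I : eqType) (g : I -> R) (s : seq I) (t : seq R) : I -> R :=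
  match s, t with
  | i :: s', x :: t' => upds (upd g i x) s' t'
  | _, _ => g
  end.

(** An expectation conditional on the coordinates outside [s]: those in [s] are integrated out, the
    head of the list outermost, and the others stay frozen at [g]. *)
Fixpoint gint (I : eqType) (s : seq I) (F : (I -> R) -> \bar R) (g : I -> R)
    : \bar R :=
  if s is i :: s' then (\int[gam]_x gint s' F (upd g i x))%E else F g.

Lemma gint_iterint (I : eqType) (s : seq I) F (g : I -> R) :
  gint s F g = iterint (size s) (fun t => F (upds g s t)).
Proof.
by elim: s g => //= i s IH g; apply: eq_integral => x _; rewrite IH.
Qed.

Lemma gint_ge0 (I : eqType) (s : seq I) F (g : I -> R) :
  (forall g, 0 <= F g)%E -> (0 <= gint s F g)%E.
Proof.
by move=> F0; elim: s g => //= i s IH g; apply: integral_ge0 => x _; exact: IH.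
Qed.

Lemma le_gint (I : eqType) (s : seq I) (F G : (I -> R) -> \bar R) (g : I -> R) :
  (forall g, 0 <= F g)%E -> (forall g, F g <= G g)%E -> (gint s F g <= gint s G g)%E.
Proof.
move=> F0 FG; elim: s g => //= i s IH g.
by apply: le_integral_pos => x; [exact: gint_ge0|exact: IH].
Qed.

Lemma gint_cat (I : eqType) (s1 s2 : seq I) F (g : I -> R) :
  gint (s1 ++ s2) F g = gint s1 (gint s2 F) g.
Proof.
by elim: s1 g => //= i s IH g; apply: eq_integral => x _; rewrite IH.
Qed.

(* Measurability for the product structure, stated through test maps because
   [I -> R] carries no measurable structure. *)
Definition coord_measurable d' (U : measurableType d') (I : Type)
    (F : (I -> R) -> U) : Prop :=
  forall d (T : measurableType d) (h : T -> I -> R),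
    (forall i, measurable_fun setT (fun t => h t i)) ->
    measurable_fun setT (fun t => F (h t)).

Lemma upds_notin (I : eqType) (s : seq I) (g : I -> R) t i :
  i \notin s -> upds g s t i = g i.
Proof.
elim: s g t => //= j s IH g [|x t]//; rewrite inE negb_or => /andP[ij si].
by rewrite IH// /upd (negbTE ij).
Qed.

Lemma upds_map (I : eqType) (s : seq I) (g f : I -> R) i :
  i \in s -> upds g s (map f s) i = f i.
Proof.
elim: s g => //= j s IH g; rewrite inE.
have [si _|si] := boolP (i \in s); first exact: IH.
by rewrite orbF => /eqP ij; rewrite upds_notin// /upd ij eqxx.
Qed.

Lemma upds_index (I : eqType) (s : seq I) (g : I -> R) t i :
  uniq s -> size t = size s -> i \in s -> upds g s t i = nth 0 t (index i s).
Proof.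
elim: s g t => //= j s IH g [|x t]// /andP[js us] /= [st].
rewrite inE eq_sym; case: eqVneq => [<- _|ij /= si]; last exact: IH.
by rewrite upds_notin// /upd eqxx.
Qed.

(** Since [s] exhausts the coordinates, the base point [g] is immaterial, and so is the order of the
    list: any order convenient for conditioning may be chosen. *)
Lemma gint_law (I : finType) (s : seq I) d (Omega : measurableType d)
    (P : probability Omega R) (G : I -> Omega -> R)
    (F : (I -> R) -> \bar R) (g : I -> R) :
  uniq s -> (forall i, i \in s) ->
  (forall i, measurable_fun setT (G i)) ->
  (forall B : I -> set R, (forall i, measurable (B i)) ->
    P [set w | forall i, B i (G i w)] = (\prod_i gam (B i))%E) ->
  (forall g, 0 <= F g)%E -> coord_measurable F ->
  (\int[P]_w F (G^~ w) = gint s F g)%E.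
Proof.
move=> us sT mG boxG F0 mF.
pose n := size s.
pose Y w : n.-tuple R := [tuple of map (G^~ w) (in_tuple s)].
have mY : measurable_fun setT Y.
  apply/measurable_fun_tnthP => i.
  rewrite (_ : _ \o _ = G (tnth (in_tuple s) i)); first exact: mG.
  by apply/funext => w; rewrite /= tnth_map.
pose Ym : {mfun Omega >-> (n.-tuple R)} :=
  HB.pack Y (isMeasurableFun.Build _ _ _ _ Y mY).
have mupds i : measurable_fun setT (fun t : n.-tuple R => upds g s t i).
  have ilt : (index i s < n)%N by rewrite index_mem.
  rewrite (_ : (fun t : n.-tuple R => _) = (fun t => tnth t (Ordinal ilt))).
    exact: measurable_tnth.
  by apply/funext => t; rewrite upds_index ?size_tuple// (tnth_nth 0).
have mFu : measurable_fun setT (fun t : n.-tuple R => F (upds g s t)) by exact: mF.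
rewrite gint_iterint.
rewrite -(@iterint_law n (distribution P Ym) (fun t => F (upds g s t)))//.
  rewrite ge0_integral_distribution//=.
  apply: eq_integral => w _ /=; congr F; apply/funext => i.
  by rewrite upds_map.
move=> B mB.
pose C i := if insub (index i s) is Some k then B k else setT.
have Ck (k : 'I_n) : C (tnth (in_tuple s) k) = B k.
  have xs : tnth (in_tuple s) k = nth (tnth (in_tuple s) k) s k by exact: tnth_nth.
  rewrite /C {1}xs index_uniq// insubT//= => kn.
  by congr B; apply/val_inj.
have mC i : measurable (C i) by rewrite /C; case: insub.
have := boxG C mC.
have -> : [set w | forall i, C i (G i w)] = Ym @^-1` [set t | forall i, B i (tnth t i)].
  apply/seteqP; split => w /= wC i.
    by rewrite tnth_map -Ck.
  have ilt : (index i s < n)%N by rewrite index_mem.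
  have := wC (Ordinal ilt); rewrite tnth_map (tnth_nth i) /= nth_index//.
  by rewrite /C insubT.
move=> E; transitivity (\prod_i gam (C i))%E; first exact: E.
rewrite (perm_big s); last by apply: uniq_perm; rewrite ?index_enum_uniq// => i;
  rewrite sT mem_index_enum.
by rewrite big_tnth; apply: eq_bigr => k _; rewrite Ck.
Qed.

End iterated_gaussian_integral.

(** * Exponential moments of linear and quadratic forms, integrated block by block *)

Section gaussian_blocks.
Context {R : realType}.
Local Notation gam := (@normal_prob R 0 1).

(** With [Q g'] stating that some quantity independent of the coordinates in [s] has the same value
    at [g'] as at the starting point, this allows that quantity to be treated as a constant under
    the integral. *)
Lemma le_gint_inv (I : eqType) (s : seq I) (Q : (I -> R) -> Prop)
    (F G : (I -> R) -> \bar R) (g : I -> R) :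
  (forall g, 0 <= F g)%E ->
  (forall g i x, i \in s -> Q g -> Q (upd g i x)) ->
  (forall g, Q g -> (F g <= G g)%E) -> Q g -> (gint s F g <= gint s G g)%E.
Proof.
move=> F0 + FG; elim: s g => [|i s IH] g Qupd Qg /=; first exact: FG.
apply: le_integral_pos => x; first exact: gint_ge0.
by apply: IH; [move=> ? ? ? js; apply: Qupd; rewrite inE js orbT|
  apply: Qupd; rewrite ?mem_head].
Qed.

Lemma eq_gint_inv (I : eqType) (s : seq I) (Q : (I -> R) -> Prop)
    (F G : (I -> R) -> \bar R) (g : I -> R) :
  (forall g i x, i \in s -> Q g -> Q (upd g i x)) ->
  (forall g, Q g -> F g = G g) -> Q g -> gint s F g = gint s G g.
Proof.
move=> + FG; elim: s g => [|i s IH] g Qupd Qg /=; first exact: FG.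
apply: eq_integral => x _.
by apply: IH; [move=> ? ? ? js; apply: Qupd; rewrite inE js orbT|
  apply: Qupd; rewrite ?mem_head].
Qed.

(** The form [Z = sum v_i g_i] is centered Gaussian with variance [V = sum v_i^2], and this is the
    expectation of [exp (C - k (b + Z)^2)]. A negative [k] is allowed as long as the moment is
    finite. *)
Lemma gint_exp_sq (I : eqType) (s : seq I) (v : I -> R) (k b C : R) g :
  uniq s -> 0 < 1 + 2 * k * \sum_(i <- s) v i ^+ 2 ->
  (gint s (fun g => (expR (C - k * (b + \sum_(i <- s) v i * g i) ^+ 2))%:E) g =
   ((Num.sqrt (1 + 2 * k * \sum_(i <- s) v i ^+ 2))^-1 *
     expR (C - k / (1 + 2 * k * \sum_(i <- s) v i ^+ 2) * b ^+ 2))%:E)%E.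
Proof.
elim: s b g => [|i s IH] b g /=.
  by move=> _ _; rewrite !big_nil !mulr0 !addr0 sqrtr1 invr1 mul1r mulr1.
move=> /andP[is_ us]; rewrite big_cons.
set V := \sum_(j <- s) v j ^+ 2; move=> pos.
have V0 : 0 <= V by apply: sumr_ge0 => j _; exact: sqr_ge0.
have v0 : 0 <= v i ^+ 2 by exact: sqr_ge0.
have posV : 0 < 1 + 2 * k * V.
  have [k0|/ltW k0] := leP 0 k; first by have := mulr_ge0 k0 V0; nra.
  by have := mulr_le0_ge0 k0 v0; nra.
set D := 1 + 2 * k * V in posV *.
(* Integrating out the tail of the list reproduces the same form with [k] replaced by [ks], so only
   one scalar integral remains. *)
set ks := k / D.
have pos2 : 0 < 1 + 2 * (ks * v i ^+ 2).
  have -> : 1 + 2 * (ks * v i ^+ 2) = (1 + 2 * k * (v i ^+ 2 + V)) / D.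
    by rewrite /ks /D; field; rewrite gt_eqF.
  by rewrite divr_gt0.
transitivity (\int[gam]_x ((Num.sqrt D)^-1%:E * (expR ((C - ks * b ^+ 2) +
    (- 2 * ks * b * v i) * x - (ks * v i ^+ 2) * x ^+ 2))%:E))%E.
  apply: eq_integral => x _.
  transitivity (gint s (fun g' => (expR (C - k * ((b + v i * x) +
      \sum_(i0 <- s) v i0 * g' i0) ^+ 2))%:E) (upd g i x)).
    apply: (@eq_gint_inv _ _ (fun g' => g' i = x)).
    - move=> g' j y js g'i; rewrite /upd; case: eqP => // ij.
      by move: is_; rewrite ij js.
    - by move=> g' g'i; rewrite big_cons g'i addrA.
    - by rewrite /upd eqxx.
  rewrite IH// -/V -/D -EFinM; congr ((_ * expR _)%:E).
  by rewrite -/ks; ring.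
rewrite ge0_integralZl//; last first.
  apply/measurable_EFinP; apply: measurableT_comp => //.
  apply: measurable_funB; last by apply: measurable_funM => //.
  by apply: measurable_funD => //; apply: measurable_funM.
rewrite integral_exp_quadratic// -EFinM.
have mulVVA (x y z : R) : x^-1 * (y^-1 * z) = (x * y)^-1 * z.
  by rewrite invfM mulrA.
rewrite mulVVA -sqrtrM; last exact: ltW.
have DE : D * (1 + 2 * (ks * v i ^+ 2)) = 1 + 2 * k * (v i ^+ 2 + V).
  by rewrite /ks /D; field; rewrite gt_eqF.
rewrite DE; congr ((_ * expR _)%:E).
rewrite -[X in C - k / X * _]DE /ks.
have D0 : D != 0 by rewrite gt_eqF.
have E0 : 1 + 2 * (k / D * v i ^+ 2) != 0 by rewrite gt_eqF.
set e := 1 + _ in E0 *.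
have -> : (- 2 * (k / D) * b * v i) ^+ 2 = 2 * (k / D) * b ^+ 2 * (e - 1).
  by rewrite /e; ring.
by clearbody e D; field; rewrite D0 E0.
Qed.

Lemma gint_exp_linear (I : eqType) (s : seq I) (a : I -> R) (C : R) g :
  uniq s ->
  (gint s (fun g => (expR (C + \sum_(i <- s) a i * g i))%:E) g =
   (expR (C + 2^-1 * \sum_(i <- s) a i ^+ 2))%:E)%E.
Proof.
elim: s C g => [|i s IH] C g /=; first by rewrite !big_nil mulr0.
move=> /andP[is_ us]; rewrite big_cons.
set V := \sum_(j <- s) a j ^+ 2.
transitivity (\int[gam]_x (expR ((C + 2^-1 * V) + a i * x - 0 * x ^+ 2))%:E)%E.
  apply: eq_integral => x _.
  transitivity (gint s (fun g' => (expR ((C + a i * x) +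
      \sum_(i0 <- s) a i0 * g' i0))%:E) (upd g i x)).
    apply: (@eq_gint_inv _ _ (fun g' => g' i = x)).
    - move=> g' j y js g'i; rewrite /upd; case: eqP => // ij.
      by move: is_; rewrite ij js.
    - by move=> g' g'i; rewrite big_cons g'i addrA.
    - by rewrite /upd eqxx.
  by rewrite IH// -/V; congr ((expR _)%:E); ring.
rewrite integral_exp_quadratic; last by rewrite mulr0 addr0.
rewrite mulr0 addr0 sqrtr1 invr1 mul1r; congr ((expR _)%:E).
by field.
Qed.

(** The left side decays only polynomially in [y], hence the truncation at 1. After squaring, [exp
    (z / 2) <= 1 / (1 - z / 2) <= 1 + 2 z] for [z] in [[0, 1]]. *)
Lemma inv_sqrt_le_exp_min (y : R) : 0 <= y ->
  (Num.sqrt (1 + 2 * y))^-1 <= expR (- (4^-1 * Num.min y 1)).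
Proof.
move=> y0; rewrite expRN lef_pV2 ?posrE ?expR_gt0 ?sqrtr_gt0//; last by lra.
rewrite -(@ler_pXn2r _ 2) ?nnegrE ?expR_ge0 ?sqrtr_ge0//.
rewrite sqr_sqrtr; last by lra.
rewrite -expRM_natl.
set z := Num.min y 1.
have z0 : 0 <= z by rewrite le_min y0 ler01.
have z1 : z <= 1 by rewrite ge_min lexx orbT.
have zy : z <= y by rewrite ge_min lexx.
have := expR_ge1Dx (- (2 * (4^-1 * z))); rewrite expRN => h.
have h2 : 0 < expR (2 * (4^-1 * z)) by exact: expR_gt0.
have h3 : expR (2 * (4^-1 * z)) * (1 + - (2 * (4^-1 * z))) <= 1.
  by rewrite mulrC -ler_pdivlMr// div1r.
nra.
Qed.

Lemma inv_sqrt_le_exp (y : R) : 0 <= y -> y <= 4^-1 ->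
  (Num.sqrt (1 - 2 * y))^-1 <= expR (2 * y).
Proof.
move=> y0 y1.
rewrite -[expR _]invrK -expRN lef_pV2 ?posrE ?expR_gt0 ?sqrtr_gt0//; last by lra.
rewrite -(@ler_pXn2r _ 2) ?nnegrE ?expR_ge0 ?sqrtr_ge0//.
rewrite sqr_sqrtr; last by lra.
rewrite -expRM_natl.
have h2 : 0 < expR (2%:R * - (2 * y)) by exact: expR_gt0.
have := expR_ge1Dx (4 * y).
have -> : expR (4 * y) = (expR (2%:R * - (2 * y)))^-1.
  by rewrite -expRN; congr expR; ring.
move=> h.
have h3 : expR (2%:R * - (2 * y)) * (1 + 4 * y) <= 1.
  by rewrite mulrC -ler_pdivlMr// div1r.
nra.
Qed.

Definition indep_of (I : eqType) (s : seq I) (phi : (I -> R) -> R) :=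
  forall g i x, i \in s -> phi (upd g i x) = phi g.

(** Discrete counterpart of adaptedness to a filtration: the term of a block does not depend on the
    blocks listed after it. *)
Fixpoint adapted (I K : eqType) (blk : K -> seq I) (phi : K -> (I -> R) -> R)
    (bs : seq K) : Prop :=
  if bs is b :: bs' then
    (forall b', b' \in bs' -> indep_of (blk b') (phi b)) /\
    adapted blk phi bs'
  else True.

(** The later blocks are integrated first, with the term of the current block frozen and moved into
    [C]. Since the conditional bound [c b] is uniform in the past, what comes out is a constant, and
    the current block can be integrated in turn. *)
Lemma gint_exp_blocks (I K : eqType) (blk : K -> seq I)
    (phi : K -> (I -> R) -> R) (c : K -> R) (bs : seq K) (C : R) g :
  adapted blk phi bs ->
  (forall b, b \in bs -> forall C g,
    gint (blk b) (fun g => (expR (C + phi b g))%:E) g <= (expR (C + c b))%:E)%E ->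
  (gint (flatten (map blk bs))
     (fun g => (expR (C + \sum_(b <- bs) phi b g))%:E) g
   <= (expR (C + \sum_(b <- bs) c b))%:E)%E.
Proof.
elim: bs C g => [|b bs IH] C g /=; first by rewrite !big_nil.
move=> [ind ad] step; rewrite gint_cat big_cons.
apply: (@le_trans _ _ (gint (blk b)
  (fun g => (expR ((C + \sum_(b <- bs) c b) + phi b g))%:E) g)); last first.
  by rewrite (le_trans (step _ (mem_head _ _) _ _))// lee_fin ler_expR; lra.
apply: le_gint => g'; first by apply: gint_ge0 => h; rewrite lee_fin expR_ge0.
apply: (@le_trans _ _ (gint (flatten (map blk bs))
   (fun g => (expR ((C + phi b g') + \sum_(b <- bs) phi b g))%:E) g')).
  apply: (@le_gint_inv _ _ (fun h => phi b h = phi b g')) => //.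
  - move=> h i x /flattenP[_ /mapP[b' b'bs ->] ib'] <-.
    exact: (ind b').
  - by move=> h hE; rewrite big_cons hE addrA.
have := IH (C + phi b g') g' ad; move=> /(_ _)/le_trans; apply.
  by move=> b' b'bs; apply: step; rewrite inE b'bs orbT.
by rewrite lee_fin ler_expR; lra.
Qed.

(** A shift [b] decided by the past only decreases the expectation of [exp (- k (b + Z)^2)] for a
    centered Gaussian [Z], so its factor is dropped. *)
Lemma gint_exp_neg_sq_le (I : eqType) (s : seq I) (v : I -> R) (k : R)
    (b : (I -> R) -> R) (C : R) g :
  uniq s -> 0 <= k -> indep_of s b ->
  (gint s (fun g => (expR (C + - (k * (b g + \sum_(i <- s) v i * g i) ^+ 2)))%:E) g <=
   (expR (C + - (4^-1 * Num.min (k * \sum_(i <- s) v i ^+ 2) 1)))%:E)%E.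
Proof.
move=> us k0 ind; set V := \sum_(i <- s) v i ^+ 2.
have V0 : 0 <= V by apply: sumr_ge0 => j _; exact: sqr_ge0.
have kV : 0 <= k * V by exact: mulr_ge0.
have pos : 0 < 1 + 2 * k * V by nra.
rewrite (@eq_gint_inv _ _ (fun h => b h = b g) _
  (fun h => (expR (C - k * (b g + \sum_(i <- s) v i * h i) ^+ 2))%:E)) //.
- rewrite gint_exp_sq// -/V lee_fin mulrC [leRHS]expRD ler_pM ?expR_ge0 ?invr_ge0//.
    rewrite ler_expR gerDl oppr_le0 mulr_ge0 ?sqr_ge0// divr_ge0// ltW//.
  rewrite -mulrA; exact: inv_sqrt_le_exp_min.
- by move=> h i x si <-; exact: ind.
- by move=> h ->.
Qed.

Lemma gint_exp_pos_sq_le (I : eqType) (s : seq I) (v : I -> R) (k : R)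
    (C : R) g :
  uniq s -> 0 <= k -> k * \sum_(i <- s) v i ^+ 2 <= 4^-1 ->
  (gint s (fun g => (expR (C + k * (\sum_(i <- s) v i * g i) ^+ 2))%:E) g <=
   (expR (C + 2 * (k * \sum_(i <- s) v i ^+ 2)))%:E)%E.
Proof.
move=> us k0; set V := \sum_(i <- s) v i ^+ 2 => kV1.
have V0 : 0 <= V by apply: sumr_ge0 => j _; exact: sqr_ge0.
have kV : 0 <= k * V by exact: mulr_ge0.
have pos : 0 < 1 + 2 * (- k) * V by nra.
rewrite (@eq_gint_inv _ _ (fun=> True) _
  (fun h => (expR (C - (- k) * (0 + \sum_(i <- s) v i * h i) ^+ 2))%:E)) //.
  rewrite gint_exp_sq// -/V expr0n mulr0 subr0 lee_fin mulrC expRD.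
  rewrite ler_pM2l ?expR_gt0//.
  rewrite (_ : 1 + _ = 1 - 2 * (k * V)); last by ring.
  exact: inv_sqrt_le_exp.
by move=> h _; rewrite add0r mulNr opprK.
Qed.

End gaussian_blocks.

(** * Systems driven by Gaussian noise *)

Lemma adapted_pairwise (R : realType) (I K : eqType) (blk : K -> seq I)
    (phi : K -> (I -> R) -> R) (r : rel K) (bs : seq K) :
  pairwise r bs -> (forall b b', r b b' -> indep_of (blk b') (phi b)) ->
  adapted blk phi bs.
Proof.
move=> + H; elim: bs => //= b bs IH /andP[/allP rb pbs]; split; last exact: IH.
by move=> b' /rb; exact: H.
Qed.

Section noise_space.
Context {R : realType} (m T d : nat).
Local Notation K := ('I_m * 'I_T.+1)%type.
Local Notation I := (('I_m * 'I_T.+1) * 'I_d)%type.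
Implicit Types (g : I -> R) (l : 'I_m) (t : 'I_T.+1).

Definition block (b : K) : seq I := [seq (b, i) | i <- enum 'I_d].

Definition blocks : seq K := [seq (l, t) | l <- enum 'I_m, t <- enum 'I_T.+1].

(** Holds both ways between blocks of distinct vertices, whose systems do not interact; within a
    vertex it is the order of time. *)
Definition before (b b' : K) : bool := (b.1 != b'.1) || (b.2 < b'.2)%N.

Lemma pairwise_blocks : pairwise before blocks.
Proof.
rewrite /blocks; elim: (enum 'I_m) (enum_uniq 'I_m) => //= l s IH /andP[ls us].
rewrite pairwise_cat IH// andbT; apply/andP; split.
  apply/allrelP => b b' /mapP[t _ ->] /allpairsP[[l' t'] /= [l's _ ->]].
  by rewrite /before /=; apply/orP; left; apply: contraNneq ls => ->.
rewrite pairwise_map.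
have : pairwise (fun i j : 'I_T.+1 => (i < j)%N) (enum 'I_T.+1).
  rewrite -(pairwise_map (@nat_of_ord T.+1) ltn) val_enum_ord.
  by rewrite -(sorted_pairwise ltn_trans) iota_ltn_sorted.
by apply: sub_pairwise => i j /= ij; rewrite /before /= ij orbT.
Qed.

Lemma flatten_blocks :
  flatten (map block blocks) = [seq (b, i) | b <- blocks, i <- enum 'I_d].
Proof. by []. Qed.

Lemma blocks_uniq : uniq blocks.
Proof.
by apply: allpairs_uniq; rewrite ?enum_uniq// => -[? ?] [? ?] _ _ /= [-> ->].
Qed.

Lemma mem_blocks b : b \in blocks.
Proof. by case: b => l t; apply: allpairs_f; rewrite mem_enum. Qed.

Lemma flatten_blocks_uniq : uniq (flatten (map block blocks)).
Proof.
rewrite flatten_blocks; apply: allpairs_uniq; rewrite ?blocks_uniq ?enum_uniq//.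
by move=> [? ?] [? ?] _ _ /= [-> ->].
Qed.

Lemma mem_flatten_blocks i : i \in flatten (map block blocks).
Proof.
by case: i => b i; rewrite flatten_blocks; apply: allpairs_f;
  rewrite ?mem_blocks ?mem_enum.
Qed.

Lemma block_uniq b : uniq (block b).
Proof. by rewrite map_inj_uniq ?enum_uniq// => ? ? []. Qed.

Lemma sum_block (b : K) (F : I -> R) :
  \sum_(i <- block b) F i = \sum_(i < d) F (b, i).
Proof. by rewrite big_map big_enum. Qed.

Lemma sum_blocks (F : K -> R) : \sum_(b <- blocks) F b = \sum_l \sum_t F (l, t).
Proof.
rewrite (perm_big (index_enum _)); last first.
  apply: uniq_perm; rewrite ?blocks_uniq ?index_enum_uniq// => b.
  by rewrite mem_blocks mem_index_enum.
by rewrite pair_bigA; apply: eq_bigr => -[].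
Qed.

(** Block [(l, t)] holds the noise entering the state at time [t + 1], whence the predecessor.
    Beyond time [T + 1] the index is out of range and [inord] returns a default, which explains the
    bounds on time below. *)
Definition path_of g l : nat -> 'cV[R]_d :=
  fun t : nat => \col_i g ((l, inord t.-1), i).

Variable A : 'I_m -> 'M[R]_d.

Definition traj g l (t : nat) : 'cV[R]_d := state (A l) (path_of g l) t.

Lemma traj_upd g l (t : nat) (j : I) x : (t <= T.+1)%N ->
  (j.1.1 != l) || (t <= j.1.2)%N -> traj (upd g j x) l t = traj g l t.
Proof.
rewrite /traj; elim: t => //= t IH tT jl.
rewrite IH ?(ltnW tT)//; last by case/orP: jl => [->//|/ltnW ->]; rewrite orbT.
congr (_ + _); apply/matrixP => i k; rewrite !mxE /upd.
case: eqP => // ij; move: jl; rewrite -ij /= eqxx /= inordK//.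
by rewrite ltnn.
Qed.

Lemma trajS g l t : traj g l t.+1 = A l *m traj g l t + \col_i g ((l, t), i).
Proof.
rewrite /traj /=; congr (_ + _); apply/matrixP => i k; rewrite !mxE /=.
by rewrite inord_val.
Qed.

Lemma measurable_traj l (t : nat) a : coord_measurable (fun g => traj g l t a 0).
Proof.
move=> dd S h mh; rewrite /traj; elim: t a => [|t IH] a /=.
  by under eq_fun do rewrite mxE; exact: measurable_cst.
under eq_fun do rewrite !mxE.
apply: measurable_funD; last exact: mh.
apply: measurable_sum => c.
by apply: measurable_funM => //; exact: IH.
Qed.

End noise_space.

(** * Exponential moments of energies and of martingales *)

Section noise_expectation.
Context {R : realType} (m T d : nat).
Local Notation K := ('I_m * 'I_T.+1)%type.
Local Notation I := (('I_m * 'I_T.+1) * 'I_d)%type.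
Local Notation gam := (@normal_prob R 0 1).
Context (disp : measure_display) (Omega : measurableType disp)
  (P : probability Omega R).
Variable eta : 'I_m -> nat -> {RV P >-> d.-tuple R}.
Hypothesis hgauss : forall (l : 'I_m) (t : 'I_T.+1),
  std_gaussian_vector (eta l t.+1).
Hypothesis hindep : mutually_independent
  (fun lt : 'I_m * 'I_T.+1 => eta lt.1 lt.2.+1).
Variable A : 'I_m -> 'M[R]_d.

Definition noise (i : I) (w : Omega) : R := tnth (eta i.1.1 i.1.2.+1 w) i.2.

Lemma measurable_noise i : measurable_fun setT (noise i).
Proof.
apply: (measurableT_comp (measurable_tnth i.2)).
exact: measurable_funP.
Qed.

Lemma traj_noise w l (t : nat) : (t <= T.+1)%N ->
  traj A (noise^~ w) l t = state (A l) (noise_path (eta l) w) t.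
Proof.
rewrite /traj; elim: t => //= t IH tT; rewrite IH ?(ltnW tT)//.
congr (_ + _); apply/matrixP => i k; rewrite !mxE /noise /=.
by rewrite inordK.
Qed.

Lemma noise_boxes (B : I -> set R) : (forall i, measurable (B i)) ->
  P [set w | forall i, B i (noise i w)] = (\prod_i gam (B i))%E.
Proof.
move=> mB.
pose C (b : K) : set (d.-tuple R) := [set x | forall i, B (b, i) (tnth x i)].
have mC b : measurable (C b).
  have -> : C b = \bigcap_(i in [set: 'I_d])
      ((fun x : d.-tuple R => tnth x i) @^-1` B (b, i)).
    by apply/seteqP; split => [x xB i _|x xB i]; [exact: xB|exact: (xB i)].
  apply: fin_bigcap_measurable; first exact: finite_finset.
  move=> i _; rewrite -[X in measurable X]setTI.
  exact: measurable_tnth.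
have := hindep [set: K]%SET mC.
have -> : [set w | forall i : K, i \in [set: K]%SET -> C i (eta i.1 i.2.+1 w)] =
    [set w | forall i, B i (noise i w)].
  apply/seteqP; split => [w wC [b i]|w wB b _ i].
    by apply: wC; rewrite inE.
  exact: (wB (b, i)).
move=> ->.
rewrite [RHS](_ : _ = \prod_(b : K) \prod_(i < d) gam (B (b, i)))%E; last first.
  by rewrite pair_bigA; apply: eq_bigr => -[].
apply: eq_big => [b|b _]; first by rewrite inE.
exact: (hgauss b.1 b.2 (B := fun i => B (b, i))).
Qed.

(** The expectation is integrated vertex by vertex and, within a vertex, in the order of time, so
    that a bound for each block conditional on all the others multiplies up. *)
Lemma expectation_exp_blocks (phi : K -> (I -> R) -> R) (c : K -> R) :
  (forall b b', before b b' -> indep_of (@block m T d b') (phi b)) ->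
  (forall b, coord_measurable (phi b)) ->
  (forall b C g, gint (@block m T d b) (fun g => (expR (C + phi b g))%:E) g <=
    (expR (C + c b))%:E)%E ->
  (\int[P]_w (expR (\sum_l \sum_t phi (l, t) (noise^~ w)))%:E <=
    (expR (\sum_l \sum_t c (l, t)))%:E)%E.
Proof.
move=> ind mphi step.
pose F (g : I -> R) : \bar R := (expR (0 + \sum_(b <- @blocks m T) phi b g))%:E.
rewrite (_ : (\int[P]_w _)%E = (\int[P]_w F (noise^~ w))%E); last first.
  by apply: eq_integral => w _; rewrite /F add0r sum_blocks.
rewrite (@gint_law R _ (flatten (map (@block m T d) (blocks m T))) _ Omega P
  noise F (fun=> 0) (flatten_blocks_uniq _ _ _)
  (@mem_flatten_blocks _ _ _) measurable_noise noise_boxes).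
- rewrite -sum_blocks -[X in expR X]add0r; apply: gint_exp_blocks.
    exact: adapted_pairwise (pairwise_blocks m T) ind.
  by move=> b _; exact: step.
- by move=> g; rewrite lee_fin expR_ge0.
- move=> dd S h mh; apply/measurable_EFinP; apply: measurableT_comp => //.
  apply: measurable_funD => //; apply: measurable_sum => b; exact: mphi.
Qed.

Definition energy (g : I -> R) (l : 'I_m) (v : 'I_d -> R) : R :=
  \sum_(t < T) (\sum_a v a * traj A g l t.+1 a 0) ^+ 2.

Lemma sum_ord_lt (F : nat -> R) :
  \sum_(t < T.+1) (if (t < T)%N then F t else 0) = \sum_(t < T) F t.
Proof.
rewrite big_ord_recr /= ltnn addr0; apply: eq_bigr => t _.
by rewrite ltn_ord.
Qed.

Lemma dot_trajS g l (t : 'I_T.+1) (v : 'I_d -> R) :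
  \sum_a v a * traj A g l t.+1 a 0 =
  \sum_a v a * (A l *m traj A g l t) a 0 + \sum_a v a * g ((l, t), a).
Proof.
rewrite -big_split; apply: eq_bigr => a _.
by rewrite trajS !mxE mulrDr.
Qed.

Lemma traj_indep (b b' : K) (t : nat) : before b b' -> (t <= b.2.+1)%N ->
  forall g i x, i \in @block m T d b' ->
  traj A (upd g i x) b.1 t = traj A g b.1 t.
Proof.
move=> bb' tb g i x /mapP[j _ ->]; apply: traj_upd.
  exact: leq_trans tb (ltn_ord b.2).
rewrite /=; case/orP: bb' => [|lt]; first by rewrite eq_sym => ->.
by rewrite (leq_trans tb lt) orbT.
Qed.

Lemma measurable_energy l v : coord_measurable (fun g => energy g l v).
Proof.
move=> dd S h mh; apply: measurable_sum => t.
apply: measurable_funX; apply: measurable_sum => a.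
by apply: measurable_funM => //; exact: measurable_traj.
Qed.

(** Given the past, [<v, x_(t+1)>] is Gaussian with variance [|v|^2] and a mean fixed by [A x_t].
    Whatever this mean, one time step contributes at most [exp (- min(s |v|^2, 1) / 4)], so the
    bound does not depend on the system matrices. *)
Lemma expectation_exp_neg_energy (L : {set 'I_m}) (s : R)
    (v : 'I_m -> 'I_d -> R) : 0 <= s ->
  (\int[P]_w (expR (- \sum_(l in L) s * energy (noise^~ w) l (v l)))%:E <=
   (expR (- (T%:R / 4 * \sum_(l in L)
      Num.min (s * \sum_a v l a ^+ 2) 1)))%:E)%E.
Proof.
move=> s0.
(* The noise of index [T] enters [x_(T+1)], which is a response but not a regressor: its block gets
   the term 0. *)
pose act (b : K) := (b.1 \in L) && (b.2 < T)%N.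
pose phi (b : K) (g : I -> R) := if act b then
  - (s * (\sum_a v b.1 a * traj A g b.1 b.2.+1 a 0) ^+ 2) else 0.
pose c (b : K) : R := if act b then
  - (4^-1 * Num.min (s * \sum_a v b.1 a ^+ 2) 1) else 0.
have sumif (F G : 'I_m -> nat -> R) : (forall l (t : 'I_T.+1), F l t =
    if (l \in L) && (t < T)%N then - G l t else 0) ->
    \sum_l \sum_(t < T.+1) F l t = - \sum_(l in L) \sum_(t < T) G l t.
  move=> FE; rewrite -sumrN [RHS]big_mkcond; apply: eq_bigr => l _.
  case: ifP => lL; last by rewrite big1// => t _; rewrite FE lL.
  rewrite -sumrN -(sum_ord_lt (fun t => - G l t)); apply: eq_bigr => t _.
  by rewrite FE lL.
have phiE w : \sum_l \sum_t phi (l, t) (noise^~ w) =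
    - \sum_(l in L) s * energy (noise^~ w) l (v l).
  rewrite (sumif (fun l t => if (l \in L) && (t < T)%N then
    - (s * (\sum_a v l a * traj A (noise^~ w) l t.+1 a 0) ^+ 2) else 0)
    (fun l t => s * (\sum_a v l a * traj A (noise^~ w) l t.+1 a 0) ^+ 2))//.
  by congr (- _); apply: eq_bigr => l _; rewrite mulr_sumr.
have cE : \sum_l \sum_t c (l, t) = - (T%:R / 4 * \sum_(l in L)
      Num.min (s * \sum_a v l a ^+ 2) 1).
  rewrite (sumif (fun l t => if (l \in L) && (t < T)%N then
    - (4^-1 * Num.min (s * \sum_a v l a ^+ 2) 1) else 0)
    (fun l t => 4^-1 * Num.min (s * \sum_a v l a ^+ 2) 1))//.
  congr (- _); rewrite mulr_sumr; apply: eq_bigr => l _.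
  by rewrite sumr_const card_ord -[LHS]mulr_natl; ring.
rewrite (_ : (\int[P]_w _)%E =
    (\int[P]_w (expR (\sum_l \sum_t phi (l, t) (noise^~ w)))%:E)%E); last first.
  by apply: eq_integral => w _; rewrite phiE.
rewrite -cE; apply: expectation_exp_blocks.
- move=> b b' bb' g i x ib'; rewrite /phi; case: ifP => // _.
  by rewrite (traj_indep bb').
- move=> b dd S h mh; rewrite /phi; case: (act b) => //.
  apply: measurableT_comp => //; apply: measurable_funM => //.
  apply: measurable_funX; apply: measurable_sum => a.
  by apply: measurable_funM => //; exact: measurable_traj.
- move=> b C g; rewrite /phi /c; case: ifP => ab; last first.
    rewrite (@eq_gint_inv _ _ _ (fun=> True) _
      (fun h => (expR (C + \sum_(i <- block d b) 0 * h i))%:E))//.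
      rewrite gint_exp_linear ?block_uniq// big1 ?mulr0//.
      by move=> i _; rewrite expr0n.
    by move=> h _; rewrite big1// => i _; rewrite mul0r.
  have := @gint_exp_neg_sq_le R I (block d b) (fun i => v b.1 i.2) s
    (fun g => \sum_a v b.1 a * (A b.1 *m traj A g b.1 b.2) a 0) C g
    (block_uniq _ _) s0.
  rewrite !sum_block /= => H.
  apply: le_trans (H _).
    apply: le_gint => h; rewrite ?lee_fin ?expR_ge0// sum_block.
    case: b {H} ab => l t ab; rewrite dot_trajS //.
  move=> h i x ib; apply: eq_bigr => a _; rewrite traj_upd//.
    exact/ltnW/ltn_ord.
  by case/mapP: ib => j _ -> /=; rewrite leqnn orbT.
Qed.

Lemma expectation_exp_pos_sq (beta : 'I_m -> R) (v : 'I_m -> 'I_d -> R) :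
  (forall l, 0 <= beta l) ->
  (forall l, beta l * \sum_a v l a ^+ 2 <= 4^-1) ->
  (\int[P]_w (expR (\sum_l \sum_(t < T) beta l *
      (\sum_a v l a * noise ((l, inord t), a) w) ^+ 2))%:E <=
   (expR (\sum_l T%:R * (2 * (beta l * \sum_a v l a ^+ 2))))%:E)%E.
Proof.
move=> b0 b1.
pose phi (b : K) (g : I -> R) := if (b.2 < T)%N then
  beta b.1 * (\sum_a v b.1 a * g ((b.1, inord b.2), a)) ^+ 2 else 0.
pose c (b : K) : R := if (b.2 < T)%N then
  2 * (beta b.1 * \sum_a v b.1 a ^+ 2) else 0.
rewrite (_ : (\int[P]_w _)%E =
    (\int[P]_w (expR (\sum_l \sum_t phi (l, t) (noise^~ w)))%:E)%E); last first.
  apply: eq_integral => w _; congr ((expR _)%:E); apply: eq_bigr => l _.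
  by rewrite -(sum_ord_lt (fun t => beta l *
      (\sum_a v l a * noise ((l, inord t), a) w) ^+ 2)).
rewrite (_ : \sum_l _ = \sum_l \sum_t c (l, t)); last first.
  apply: eq_bigr => l _.
  rewrite (sum_ord_lt (fun t => 2 * (beta l * \sum_a v l a ^+ 2))).
  by rewrite sumr_const card_ord -[RHS]mulr_natl.
apply: expectation_exp_blocks.
- move=> b b' bb' g i x ib'; rewrite /phi; case: ifP => // _.
  congr (_ * _ ^+ 2); apply: eq_bigr => a _; congr (_ * _).
  rewrite /upd inord_val; case: eqP => // ia; move: ib'; rewrite -ia.
  case/mapP => j _ [bE _]; move: bb'; rewrite -bE.
  by rewrite /before /= eqxx ltnn.
- move=> b dd S h mh; rewrite /phi; case: (b.2 < T)%N => //.
  apply: measurable_funM => //.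
  apply: measurable_funX; apply: measurable_sum => a.
  by apply: measurable_funM.
- move=> b C g; rewrite /phi /c; case: ifP => ab; last first.
    rewrite (@eq_gint_inv _ _ _ (fun=> True) _
      (fun h => (expR (C + \sum_(i <- block d b) 0 * h i))%:E))//.
      rewrite gint_exp_linear ?block_uniq// big1 ?mulr0//.
      by move=> i _; rewrite expr0n.
    by move=> h _; rewrite big1// => i _; rewrite mul0r.
  have := @gint_exp_pos_sq_le R I (block d b) (fun i => v b.1 i.2) (beta b.1)
    C g (block_uniq _ _) (b0 _).
  rewrite !sum_block /= => /(_ (b1 _)) H.
  apply: le_trans H.
  apply: le_gint => h; rewrite ?lee_fin ?expR_ge0// sum_block inord_val.
  by case: b ab.
Qed.

(** The entry [(b, a)] of the sum over [t] of the products of the noise at time [t + 1] with the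
    transpose of [x_t]. The summand at [t = 0] vanishes because [x_0 = 0]; it is kept so that the
    sum runs over all blocks. *)
Definition crossterm (g : I -> R) (l : 'I_m) (b a : 'I_d) : R :=
  \sum_(t < T.+1) g ((l, t), b) * traj A g l t a 0.

(** The exponential supermartingale: for a coefficient [y] fixed by the past and a standard Gaussian
    [g], [exp (y g - y^2 / 2)] has conditional mean 1. *)
Lemma expectation_exp_martingale (w : 'I_m -> R) (b a : 'I_d) :
  (\int[P]_o (expR (\sum_l (w l * crossterm (noise^~ o) l b a -
      w l ^+ 2 / 2 * \sum_(t < T.+1) traj A (noise^~ o) l t a 0 ^+ 2)))%:E <=
   1)%E.
Proof.
pose phi (k : K) (g : I -> R) :=
  w k.1 * traj A g k.1 k.2 a 0 * g (k, b) -
  (w k.1 * traj A g k.1 k.2 a 0) ^+ 2 / 2.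
rewrite (_ : (\int[P]_w _)%E =
    (\int[P]_w (expR (\sum_l \sum_t phi (l, t) (noise^~ w)))%:E)%E); last first.
  apply: eq_integral => o _; congr ((expR _)%:E); apply: eq_bigr => l _.
  rewrite !mulr_sumr -sumrB; apply: eq_bigr => t _.
  by rewrite /phi /=; field.
rewrite (_ : 1%E = (expR (\sum_(l < m) \sum_(t < T.+1) 0))%:E); last first.
  by rewrite big1 ?expR0// => l _; rewrite big1.
apply: (@expectation_exp_blocks phi (fun=> 0)).
- move=> k k' kk' g i x ik'; rewrite /phi (traj_indep kk')//.
  congr (_ * _ - _); rewrite /upd; case: eqP => // ki.
  move: ik'; rewrite -ki => /mapP[j _ [kE _]]; move: kk'.
  by rewrite -kE /before eqxx ltnn.
- move=> k dd S h mh; rewrite /phi.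
  have mt := measurable_traj A k.1 k.2 a mh.
  apply: measurable_funB.
    by apply: measurable_funM => //; apply: measurable_funM.
  by apply: measurable_funM => //; apply: measurable_funX; apply: measurable_funM.
- move=> k C g.
  set y := w k.1 * traj A g k.1 k.2 a 0.
  rewrite (@eq_gint_inv _ _ _ (fun h => traj A h k.1 k.2 = traj A g k.1 k.2) _
    (fun h => (expR ((C - y ^+ 2 / 2) + \sum_(i <- block d k)
       (if i == (k, b) then y else 0) * h i))%:E))//.
  + rewrite gint_exp_linear ?block_uniq// lee_fin ler_expR sum_block.
    rewrite (bigD1 b)//= eqxx big1 ?addr0; first by lra.
    by move=> i ib; rewrite xpair_eqE eqxx (negbTE ib) expr0n.
  + move=> h i x ik <-; apply: traj_upd; first exact/ltnW/ltn_ord.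
    by case/mapP: ik => j _ -> /=; rewrite leqnn orbT.
  + move=> h hE; congr ((expR _)%:E); rewrite /phi hE -/y sum_block.
    rewrite (bigD1 b)//= eqxx big1 ?addr0; first by ring.
    by move=> i ib; rewrite xpair_eqE eqxx (negbTE ib) mul0r.
Qed.

End noise_expectation.

(** * Euclidean norms and energies of trajectories *)

Section euclidean.
Context {R : realType}.

Lemma weighted_cauchy_schwarz n (a q : 'I_n -> R) : (forall i, 0 < q i) ->
  (\sum_i a i) ^+ 2 <= (\sum_i q i) * \sum_i (a i ^+ 2 / q i).
Proof.
move=> q0.
have [Q0|Q0] := leP (\sum_i q i) 0.
  have n0 : n = 0%N.
    case: n a q q0 Q0 => // n a q q0; rewrite big_ord_recl => /=.
    have : 0 <= \sum_(i < n) q (lift ord0 i) by apply: sumr_ge0 => i _; exact: ltW.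
    by move=> h1 h2; exfalso; have := q0 ord0; lra.
  by subst n; rewrite !big_ord0 mul0r expr0n.
set S := \sum_i a i; set Q := \sum_i q i in Q0 *.
have : 0 <= \sum_i q i * (a i / q i - S / Q) ^+ 2.
  by apply: sumr_ge0 => i _; rewrite mulr_ge0 ?sqr_ge0// ltW.
have -> : \sum_i q i * (a i / q i - S / Q) ^+ 2 =
    \sum_i (a i ^+ 2 / q i) - S ^+ 2 / Q.
  transitivity (\sum_i (a i ^+ 2 / q i + (- (2 * (S / Q)) * a i + (S / Q) ^+ 2 * q i))).
    apply: eq_bigr => i _; field; rewrite gt_eqF//=; by rewrite gt_eqF// q0.
  rewrite !big_split /= -!mulr_sumr -/S -/Q; field; by rewrite gt_eqF.
by rewrite subr_ge0 ler_pdivrMr// mulrC.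
Qed.

Lemma cauchy_schwarz_sum n (a b : 'I_n -> R) :
  (\sum_i a i * b i) ^+ 2 <= (\sum_i a i ^+ 2) * \sum_i b i ^+ 2.
Proof.
set A := \sum_i a i ^+ 2; set B := \sum_i b i ^+ 2; set C := \sum_i a i * b i.
have A0 : 0 <= A by apply: sumr_ge0 => i _; exact: sqr_ge0.
have : 0 <= \sum_i (A * b i - C * a i) ^+ 2.
  by apply: sumr_ge0 => i _; exact: sqr_ge0.
have -> : \sum_i (A * b i - C * a i) ^+ 2 = A * (A * B - C ^+ 2).
  transitivity (\sum_i (A ^+ 2 * b i ^+ 2 + (- (2 * A * C) * (a i * b i) +
    C ^+ 2 * a i ^+ 2))).
    by apply: eq_bigr => i _; ring.
  by rewrite !big_split /= -!mulr_sumr -/A -/B -/C; ring.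
have [A1|A1] := ltP 0 A; first by rewrite pmulr_rge0// subr_ge0.
move=> _; have A00 : A = 0 by apply/le_anti; rewrite A0 A1.
have /psumr_eq0P a0 : A = 0 by [].
rewrite /C big1 ?expr0n ?A00 ?mul0r// => i _.
have /eqP := a0 (fun i _ => sqr_ge0 _) i isT.
by rewrite sqrf_eq0 => /eqP ->; rewrite mul0r.
Qed.

Lemma l2norm_ge0 n (x : 'cV[R]_n) : 0 <= l2norm x.
Proof. exact: sqrtr_ge0. Qed.

Lemma l2norm_sqr n (x : 'cV[R]_n) : l2norm x ^+ 2 = \sum_i x i 0 ^+ 2.
Proof. by rewrite sqr_sqrtr//; apply: sumr_ge0 => i _; exact: sqr_ge0. Qed.

Lemma ler_abs_of_sqr (x y : R) : 0 <= y -> x ^+ 2 <= y ^+ 2 -> `|x| <= y.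
Proof.
by move=> y0; rewrite -(real_normK (num_real x)) ler_pXn2r ?nnegrE.
Qed.

Lemma dot_le_l2norm n (x y : 'cV[R]_n) :
  `|\sum_i x i 0 * y i 0| <= l2norm x * l2norm y.
Proof.
apply: ler_abs_of_sqr; first by rewrite mulr_ge0 ?l2norm_ge0.
by rewrite exprMn !l2norm_sqr cauchy_schwarz_sum.
Qed.

Lemma l2norm_eq0 n (x : 'cV[R]_n) : l2norm x = 0 -> x = 0.
Proof.
move=> x0; have := l2norm_sqr x; rewrite x0 expr0n /= => /esym/psumr_eq0P h.
apply/matrixP => i j; rewrite !mxE ord1.
have /eqP := h (fun i _ => sqr_ge0 _) i isT.
by rewrite sqrf_eq0 => /eqP.
Qed.

Lemma l2normZ n (c : R) (x : 'cV[R]_n) : 0 <= c -> l2norm (c *: x) = c * l2norm x.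
Proof.
move=> c0; rewrite /l2norm.
under eq_bigr do rewrite mxE exprMn.
by rewrite -mulr_sumr sqrtrM ?sqr_ge0// sqrtr_sqr ger0_norm.
Qed.

Lemma spectral_norm_has_ub p n (A : 'M[R]_(p, n)) :
  has_ubound [set l2norm (A *m v) | v in [set v : 'cV[R]_n | l2norm v <= 1]].
Proof.
exists (Num.sqrt (\sum_i \sum_j A i j ^+ 2)) => _ [w /= w1 <-].
rewrite ler_sqrt; last by apply: sumr_ge0 => i _; apply: sumr_ge0 => j _; exact: sqr_ge0.
apply: ler_sum => i _; rewrite mxE.
rewrite (le_trans (cauchy_schwarz_sum _ _))//.
rewrite ler_piMr//; first by apply: sumr_ge0 => j _; exact: sqr_ge0.
by rewrite -l2norm_sqr expr_le1 ?l2norm_ge0.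
Qed.

Lemma l2norm0 n : l2norm (0 : 'cV[R]_n) = 0.
Proof. by rewrite /l2norm big1 ?sqrtr0// => i _; rewrite mxE expr0n. Qed.

Lemma spectral_norm_ge0 p n (A : 'M[R]_(p, n)) : 0 <= spectral_norm A.
Proof.
apply: (ub_le_sup (spectral_norm_has_ub A)); exists 0 => /=.
  by rewrite l2norm0.
by rewrite mulmx0 l2norm0.
Qed.

Lemma spectral_norm_bound p n (A : 'M[R]_(p, n)) (v : 'cV[R]_n) :
  l2norm (A *m v) <= spectral_norm A * l2norm v.
Proof.
have [v0|v0] := eqVneq (l2norm v) 0.
  by rewrite v0 (l2norm_eq0 v0) mulmx0 l2norm0 mulr0.
have vp : 0 < l2norm v by rewrite lt0r v0 l2norm_ge0.
have -> : v = l2norm v *: ((l2norm v)^-1 *: v) by rewrite scalerA divff// scale1r.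
set u := (_^-1 *: v).
have u1 : l2norm u = 1 by rewrite l2normZ ?invr_ge0 ?l2norm_ge0// mulVf.
clearbody u; rewrite -scalemxAr !l2normZ ?l2norm_ge0// u1 mulr1 mulrC ler_pM2r//.
by apply: (ub_le_sup (spectral_norm_has_ub A)); exists u => //; rewrite /= u1.
Qed.

Lemma dot_adjoint p n (A : 'M[R]_(p, n)) (x : 'cV[R]_p) (y : 'cV[R]_n) :
  \sum_i x i 0 * (A *m y) i 0 = \sum_j (A^T *m x) j 0 * y j 0.
Proof.
transitivity (\sum_i \sum_j x i 0 * A i j * y j 0).
  by apply: eq_bigr => i _; rewrite mxE mulr_sumr; apply: eq_bigr => j _; rewrite mulrA.
rewrite exchange_big; apply: eq_bigr => j _; rewrite mxE mulr_suml.
by apply: eq_bigr => i _; rewrite mxE [x i 0 * _]mulrC.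
Qed.

Lemma l2norm_tr_mul_le n (A : 'M[R]_n) (rho : R) (v : 'cV[R]_n) :
  spectral_norm A <= rho -> l2norm (A^T *m v) <= rho * l2norm v.
Proof.
move=> Ar.
have [->|w0] := eqVneq (l2norm (A^T *m v)) 0.
  have := le_trans (l2norm_ge0 _) (spectral_norm_bound A v).
  have := l2norm_ge0 v; have := ler_wpM2r (l2norm_ge0 v) Ar; lra.
have wp : 0 < l2norm (A^T *m v) by rewrite lt0r w0 l2norm_ge0.
rewrite -(ler_pM2r wp) -expr2 l2norm_sqr.
under eq_bigr do rewrite expr2.
rewrite -dot_adjoint (le_trans (ler_norm _))// (le_trans (dot_le_l2norm _ _))//.
rewrite -[leRHS]mulrA [leRHS]mulrCA ler_wpM2l ?l2norm_ge0//.
by rewrite (le_trans (spectral_norm_bound _ _))// ler_wpM2r ?l2norm_ge0.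
Qed.

Lemma l2norm_iter_tr_le n (A : 'M[R]_n) (rho : R) (v : 'cV[R]_n) k :
  spectral_norm A <= rho -> 0 <= rho ->
  l2norm (iter k (mulmx A^T) v) <= rho ^+ k * l2norm v.
Proof.
move=> Ar r0; elim: k => [|k IH] /=; first by rewrite mul1r.
rewrite (le_trans (l2norm_tr_mul_le _ Ar))// exprS -mulrA ler_wpM2l//.
Qed.

Lemma dot_state n (A : 'M[R]_n) (eta : nat -> 'cV[R]_n) (w : 'cV[R]_n) t :
  \sum_i w i 0 * state A eta t i 0 =
  \sum_(j < t) \sum_i (iter j (mulmx A^T) w) i 0 * eta (t - j)%N i 0.
Proof.
elim: t w => [|t IH] w /=.
  by rewrite big_ord0 big1// => i _; rewrite mxE mulr0.
rewrite big_ord_recl /= subn0.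
transitivity (\sum_i w i 0 * (A *m state A eta t) i 0 + \sum_i w i 0 * eta t.+1 i 0).
  by rewrite -big_split; apply: eq_bigr => i _; rewrite mxE mulrDr.
rewrite addrC; congr (_ + _); rewrite dot_adjoint IH; apply: eq_bigr => j _.
by rewrite -iterSr /bump leq0n add1n subSS.
Qed.

Lemma sum_geometric_le (q : R) n : 0 <= q -> q < 1 ->
  (1 - q) * \sum_(j < n) q ^+ j <= 1.
Proof.
move=> q0 q1.
have -> : (1 - q) * \sum_(j < n) q ^+ j = 1 - q ^+ n.
  elim: n => [|n IH]; first by rewrite big_ord0 mulr0 expr0 subrr.
  by rewrite big_ord_recr /= mulrDr IH exprS; ring.
by rewrite gerBl exprn_ge0.
Qed.

Lemma sum_triangle_le (F : nat -> nat -> R) n : (forall i j, 0 <= F i j) ->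
  \sum_(t < n) \sum_(j < t.+1) F j (t - j)%N <= \sum_(j < n) \sum_(s < n) F j s.
Proof.
move=> F0.
pose H t j := if (j <= t)%N then F j (t - j)%N else 0.
have HE (t : 'I_n) : \sum_(j < t.+1) F j (t - j)%N = \sum_(j < n) H t j.
  rewrite (big_ord_widen _ (fun j => F j (t - j)%N) (ltn_ord t)) big_mkcond.
  by apply: eq_bigr => j _; rewrite ltnS.
under eq_bigr do rewrite HE.
rewrite exchange_big; apply: ler_sum => j _.
have sumH k : \sum_(t < k) H t j = \sum_(s < k - j) F j s.
  elim: k => [|k IH]; first by rewrite !big_ord0.
  rewrite big_ord_recr IH /= /H; case: leqP => jk.
    by rewrite subSn// big_ord_recr.
  have -> : (k.+1 - j = 0)%N by apply/eqP; rewrite subn_eq0.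
  have -> : (k - j = 0)%N by apply/eqP; rewrite subn_eq0 ltnW.
  by rewrite addr0.
rewrite sumH (big_ord_widen _ (F j) (leq_subr j n)).
by rewrite [leRHS](bigID (fun i : 'I_n => (i < n - j)%N)) /= lerDl sumr_ge0.
Qed.

(** The state is the sum of [A^j] applied to the noise [j] steps earlier. Cauchy-Schwarz with
    weights [q^j] moves the square inside, and the directions [q^-j (A^T)^j w] stay bounded when the
    norm of [A] is at most [q]. This reduces energies of states to energies of independent noise. *)
Lemma sum_sq_state_le n (A : 'M[R]_n) (eta : nat -> 'cV[R]_n) (w : 'cV[R]_n)
    (q : R) T : 0 < q -> q < 1 ->
  \sum_(t < T) (\sum_i w i 0 * state A eta t.+1 i 0) ^+ 2 <=
  (1 - q)^-1 * \sum_(j < T) q ^+ j * \sum_(s < T)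
    (\sum_i (q ^- j * iter j (mulmx A^T) w i 0) * eta s.+1 i 0) ^+ 2.
Proof.
move=> q0 q1.
pose F (j s : nat) := q ^+ j *
  (\sum_i (q ^- j * iter j (mulmx A^T) w i 0) * eta s.+1 i 0) ^+ 2.
have F0 i j : 0 <= F i j by rewrite mulr_ge0 ?sqr_ge0// exprn_ge0// ltW.
have step (t : 'I_T) : (\sum_i w i 0 * state A eta t.+1 i 0) ^+ 2 <=
    (1 - q)^-1 * \sum_(j < t.+1) F j (t - j)%N.
  rewrite dot_state.
  rewrite (le_trans (weighted_cauchy_schwarz _ (q := fun j : 'I_t.+1 => q ^+ j) _))//.
    by move=> j; rewrite exprn_gt0.
  apply: ler_pM => //.
  - by apply: sumr_ge0 => j _; rewrite exprn_ge0// ltW.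
  - by apply: sumr_ge0 => j _; rewrite divr_ge0 ?sqr_ge0// exprn_ge0// ltW.
  - by rewrite -[leRHS]mulr1 ler_pdivlMl ?subr_gt0// sum_geometric_le// ltW.
  apply: ler_sum => j _; rewrite /F subSn ?leq_ord//.
  under [X in _ <= _ * X ^+ 2]eq_bigr do rewrite -mulrA.
  rewrite -mulr_sumr exprMn mulrA.
  rewrite [leRHS](_ : _ = (\sum_i iter j (mulmx A^T) w i 0 * eta (t - j).+1 i 0) ^+ 2 / q
    ^+ j) //.
  by field; rewrite expf_eq0 gt_eqF// andbF.
rewrite (le_trans (ler_sum _ (fun t _ => step t)))// -mulr_sumr.
rewrite ler_wpM2l ?invr_ge0 ?subr_ge0 ?(ltW q1)//.
rewrite (le_trans (sum_triangle_le _ F0))//.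
by apply: ler_sum => j _; rewrite mulr_sumr.
Qed.

(** Jensen's inequality with the missing mass placed at 0, where the exponential is 1; it follows
    from the tangent line at the barycenter. *)
Lemma expR_subconvex n (p y : 'I_n -> R) : (forall i, 0 <= p i) ->
  \sum_i p i <= 1 ->
  expR (\sum_i p i * y i) <= \sum_i p i * expR (y i) + (1 - \sum_i p i).
Proof.
move=> p0 p1; set c := \sum_i p i * y i.
have tan z : expR c * (1 + z - c) <= expR z.
  have -> : expR z = expR c * expR (z - c) by rewrite -expRD; congr expR; ring.
  rewrite ler_pM2l ?expR_gt0//; have := expR_ge1Dx (z - c); lra.
have h1 : \sum_i p i * (expR c * (1 + y i - c)) <= \sum_i p i * expR (y i).
  by apply: ler_sum => i _; apply: ler_wpM2l.
have h2 : (1 - \sum_i p i) * (expR c * (1 + 0 - c)) <= 1 - \sum_i p i.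
  have := tan 0; rewrite expR0 => h; rewrite ler_piMr// subr_ge0//.
have h3 : \sum_i p i * (expR c * (1 + y i - c)) =
    expR c * ((1 - c) * \sum_i p i + c).
  transitivity (\sum_i (expR c * (1 - c) * p i + expR c * (p i * y i))).
    by apply: eq_bigr => i _; ring.
  by rewrite big_split /= -!mulr_sumr -/c; ring.
rewrite h3 in h1; lra.
Qed.

End euclidean.

(** * Tail bounds *)

Lemma exp_markov (R : realType) (disp : measure_display)
    (Omega : measurableType disp) (P : probability Omega R) (Y : Omega -> R)
    (M s : R) : measurable_fun setT Y ->
  (\int[P]_w (expR (Y w))%:E <= (expR M)%:E)%E ->
  (P [set w | (s <= Y w)%R] <= (expR (M - s))%:E)%E.
Proof.
move=> mY EY.
have mA : measurable [set w | (s <= Y w)%R].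
  rewrite -[X in measurable X]setTI (_ : [set w | _] = Y @^-1` `[s, +oo[).
    exact: mY.
  by apply/seteqP; split => w /=; rewrite in_itv /= andbT.
set A := [set w | _] in mA *.
have h : ((expR s)%:E * P A <= (expR M)%:E)%E.
  apply: le_trans EY.
  have -> : P A = (\int[P]_w (\1_A w)%:E)%E by rewrite integral_indic// setIT.
  rewrite -ge0_integralZl//.
  - apply: le_integral_pos => w; first by rewrite mule_ge0// lee_fin ?expR_ge0.
    rewrite indicE; case: (boolP (w \in A)) => [|_];
      rewrite ?mule1 ?mule0 ?lee_fin ?expR_ge0//.
    by rewrite inE => wA; rewrite ler_expR.
  - exact/measurable_EFinP/measurable_indic.
rewrite expRD expRN EFinM muleC.
by rewrite -lee_pdivlMl ?expR_gt0// in h; rewrite muleC.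
Qed.

Section tails.
Context {R : realType} (m T d : nat).
Local Notation I := (('I_m * 'I_T.+1) * 'I_d)%type.
Context (disp : measure_display) (Omega : measurableType disp)
  (P : probability Omega R).
Variable eta : 'I_m -> nat -> {RV P >-> d.-tuple R}.
Hypothesis hgauss : forall (l : 'I_m) (t : 'I_T.+1),
  std_gaussian_vector (eta l t.+1).
Hypothesis hindep : mutually_independent
  (fun lt : 'I_m * 'I_T.+1 => eta lt.1 lt.2.+1).
Variable A : 'I_m -> 'M[R]_d.
Variable rho : R.
Hypothesis hA : forall l, spectral_norm (A l) <= rho.
Hypothesis hrho : rho < 1.
Hypothesis hrho0 : 0 <= rho.
Local Notation Delta := ((1 - rho) ^+ 2).
Local Notation nz w := ((noise (T := T) eta)^~ w).

Definition coord_energy (g : I -> R) (l : 'I_m) (a : 'I_d) : R :=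
  \sum_(t < T) traj A g l t.+1 a 0 ^+ 2.

Lemma measurable_coord_energy l a : coord_measurable (fun g => coord_energy g l a).
Proof.
move=> dd S h mh; apply: measurable_sum => t.
by apply: measurable_funX; exact: measurable_traj.
Qed.

(** Halfway between [rho] and 1: [rho <= q] keeps the rescaled directions [u] in the unit ball,
    while [(1 - q)^2 = Delta / 4]. *)
Let q := (1 + rho) / 2.
Let q0 : 0 < q. Proof. by rewrite /q; move: hrho hrho0 => h1 h2; lra. Qed.
Let q1 : q < 1. Proof. by rewrite /q; move: hrho hrho0 => h1 h2; lra. Qed.
Let rq : rho <= q. Proof. by rewrite /q; move: hrho hrho0 => h1 h2; lra. Qed.

Let u (l : 'I_m) (a : 'I_d) (j : nat) (i : 'I_d) : R :=
  q ^- j * iter j (mulmx (A l)^T) (delta_mx a 0 : 'cV[R]_d) i 0.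

Let u_le1 l a j : \sum_i u l a j i ^+ 2 <= 1.
Proof.
rewrite /u; under eq_bigr do rewrite exprMn.
rewrite -mulr_sumr -l2norm_sqr -exprMn expr_le1//; last first.
  by rewrite mulr_ge0 ?l2norm_ge0// invr_ge0 exprn_ge0// ltW.
rewrite mulrC ler_pdivrMr ?exprn_gt0// mul1r.
have d1 : l2norm (delta_mx a 0 : 'cV[R]_d) = 1.
  rewrite /l2norm (bigD1 a)//= big1 ?addr0 ?mxE ?eqxx ?expr1n ?sqrtr1//.
  by move=> i ia; rewrite mxE (negbTE ia) expr0n.
rewrite (le_trans (l2norm_iter_tr_le _ _ (hA l) hrho0))// d1 mulr1.
by rewrite lerXn2r ?nnegrE// ltW.
Qed.

Let Z (g : I -> R) (l : 'I_m) (a : 'I_d) (j : nat) : R :=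
  \sum_(s < T) (\sum_i u l a j i * g ((l, inord s), i)) ^+ 2.

Let coord_energy_le g l a :
  coord_energy g l a <= (1 - q)^-1 * \sum_(j < T) q ^+ j * Z g l a j.
Proof.
have := sum_sq_state_le (A l) (path_of g l) (delta_mx a 0 : 'cV[R]_d) T q0 q1.
have -> : \sum_(t < T) (\sum_i (delta_mx a 0 : 'cV[R]_d) i 0 *
    state (A l) (path_of g l) t.+1 i 0) ^+ 2 = coord_energy g l a.
  apply: eq_bigr => t _; congr (_ ^+ 2).
  rewrite (bigD1 a)//= big1 ?addr0; first by rewrite mxE !eqxx mul1r.
  by move=> i ia; rewrite mxE (negbTE ia) mul0r.
move=> h; apply: (le_trans h); rewrite ler_wpM2l ?invr_ge0 ?subr_ge0 ?(ltW q1)//.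
apply: ler_sum => j _; rewrite ler_wpM2l ?exprn_ge0 ?(ltW q0)//.
apply: ler_sum => s _; rewrite (_ : \sum_i _ = \sum_i u l a j i * g ((l, inord s), i))//.
by apply: eq_bigr => i _; rewrite /u /path_of mxE.
Qed.

(** The energy is at most a mixture, with weights [(1 - q) q^j] of mass at most 1, of the noise
    energies [Z _ _ _ j] times [4 / Delta]. For different [j] these share the same noise, so
    Jensen's inequality is used instead of independence. The limit [Delta / 16] makes [beta <= 1/4],
    as the moment of a squared Gaussian requires. *)
Lemma expectation_exp_coord_energy (kap : 'I_m -> R) (a : 'I_d) :
  (forall l, 0 <= kap l <= Delta / 16) ->
  (\int[P]_w (expR (\sum_l kap l * coord_energy (nz w) l a))%:E <=
   (expR (8 * T%:R / Delta * \sum_l kap l))%:E)%E.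
Proof.
move=> hk.
have D0 : 0 < Delta by rewrite exprn_gt0// subr_gt0.
pose p (j : 'I_T) := (1 - q) * q ^+ j.
have p0 j : 0 <= p j by rewrite mulr_ge0 ?subr_ge0 ?(ltW q1)// exprn_ge0// ltW.
have p1 : \sum_j p j <= 1 by rewrite -mulr_sumr sum_geometric_le// ltW.
pose beta l := 4 * kap l / Delta.
have q2 : (1 - q) ^+ 2 = Delta / 4 by rewrite /q; field.
pose Y (j : 'I_T) w := \sum_l beta l * Z (nz w) l a j.
have mZ l j : measurable_fun setT (fun w => Z (nz w) l a j).
  apply: measurable_sum => s; apply: measurable_funX; apply: measurable_sum => i.
  by apply: measurable_funM => //; exact: measurable_noise.
have mY j : measurable_fun setT (Y j).
  by apply: measurable_sum => l; apply: measurable_funM.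
have kY w : \sum_l kap l * coord_energy (nz w) l a <= \sum_j p j * Y j w.
  rewrite [leRHS](_ : _ = \sum_l kap l * ((1 - q)^-1 * \sum_(j < T) q ^+ j * Z (nz w) l a
    j)).
    by apply: ler_sum => l _; rewrite ler_wpM2l// ?coord_energy_le//; have /andP[] := hk l.
  under eq_bigr do rewrite mulr_sumr.
  rewrite exchange_big; apply: eq_bigr => l _; rewrite !mulr_sumr.
  have De : Delta = 4 * (1 - q) ^+ 2 by rewrite q2; field.
  have q10 : 1 - q != 0 by rewrite subr_eq0 gt_eqF.
  apply: eq_bigr => j _; rewrite /p /beta De.
  by move: (q ^+ j) (Z _ _ _ _) (1 - q) q10 => qj z r r0; field.
set M := 8 * T%:R / Delta * \sum_l kap l.
have M0 : 0 <= M.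
  rewrite mulr_ge0//; first by rewrite divr_ge0 ?(ltW D0)// mulr_ge0.
  by apply: sumr_ge0 => l _; have /andP[] := hk l.
have EY j : (\int[P]_w (expR (Y j w))%:E <= (expR M)%:E)%E.
  have b0 l : 0 <= beta l.
    by rewrite divr_ge0 ?(ltW D0)// mulr_ge0//; have /andP[] := hk l.
  have b1 l : beta l <= 4^-1.
    rewrite /beta ler_pdivrMr//; have /andP[_] := hk l; lra.
  have -> : (\int[P]_w (expR (Y j w))%:E = \int[P]_w (expR (\sum_l \sum_(t < T) beta l *
       (\sum_c u l a j c * noise (T := T) eta ((l, inord t), c) w) ^+ 2))%:E)%E.
    apply: eq_integral => w _; congr ((expR _)%:E); apply: eq_bigr => l _.
    by rewrite /Z mulr_sumr.
  apply: (le_trans (expectation_exp_pos_sq hgauss hindep (v := fun l => u l a j) b0 _)).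
    by move=> l; rewrite (le_trans _ (b1 l))// ler_piMr.
  rewrite lee_fin ler_expR /M [leRHS](_ : _ = \sum_l T%:R * (2 * beta l)).
    apply: ler_sum => l _; rewrite ler_wpM2l// ler_wpM2l// ler_piMr//.
  rewrite mulr_sumr; apply: eq_bigr => l _; rewrite /beta.
  by field; rewrite gt_eqF// subr_gt0.
apply: (@le_trans _ _ (\int[P]_w (\sum_j (p j)%:E * (expR (Y j w))%:E +
  (1 - \sum_j p j)%:E))%E).
  apply: le_integral_pos => w; first by rewrite lee_fin expR_ge0.
  rewrite [leRHS](_ : _ = (\sum_j p j * expR (Y j w) + (1 - \sum_j p j))%:E).
    by rewrite lee_fin (le_trans _ (expR_subconvex _ p0 p1))// ler_expR.
  by rewrite [RHS]EFinD -sumEFin; congr (_ + _)%E; apply: eq_bigr => j _; rewrite EFinM.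
have mE j : measurable_fun setT (fun w => (expR (Y j w))%:E).
  by apply/measurable_EFinP; apply: measurableT_comp.
rewrite ge0_integralD//; first last.
- by move=> w _; rewrite lee_fin subr_ge0.
- by apply: emeasurable_sum => j; apply: measurable_funeM.
- by move=> w _; apply: sume_ge0 => j _; rewrite mule_ge0// lee_fin// expR_ge0.
rewrite ge0_integral_sum//; first last.
- by move=> j w _; rewrite mule_ge0// lee_fin// expR_ge0.
- by move=> j; apply: measurable_funeM.
have cstE (r : R) : (\int[P]_w r%:E = r%:E)%E.
  by rewrite integral_cst//= [P _]probability_setT mule1.
rewrite cstE.
apply: (@le_trans _ _ (\sum_j (p j)%:E * (expR M)%:E + (1 - \sum_j p j)%:E)%E).
  rewrite leeD2r//; apply: lee_sum => j _.
  rewrite ge0_integralZl//; first by rewrite lee_wpmul2l ?lee_fin.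
  by rewrite lee_fin.
under eq_bigr do rewrite -EFinM.
rewrite sumEFin -EFinD lee_fin -mulr_suml.
have : 1 <= expR M by have := expR_ge1Dx M; lra.
have : 0 <= \sum_j p j by apply: sumr_ge0.
nra.
Qed.

Lemma coord_energyT g l a :
  \sum_(t < T.+1) traj A g l t a 0 ^+ 2 = coord_energy g l a.
Proof. by rewrite big_ord_recl /= /traj /= mxE expr0n add0r. Qed.

Lemma measurable_crossterm l b a : coord_measurable (fun g : I -> R => crossterm A g l b a).
Proof.
move=> dd S h mh; apply: measurable_sum => t.
by apply: measurable_funM => //; exact: measurable_traj.
Qed.

(** With [N] the martingale and [V] its bracket, [exp (th N)] is the product of square roots of the
    supermartingale [exp (2 th N - 2 th^2 V)] and of [exp (2 th^2 V)]. The mean inequality separates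
    them, and the factors [exp M] and [exp (- M)] balance the two expectations. *)
Lemma expectation_exp_crossterm (w : 'I_m -> R) (th : R) (b a : 'I_d) :
  \sum_l w l ^+ 2 <= 1 -> th ^+ 2 <= Delta / 32 ->
  (\int[P]_o (expR (th * \sum_l w l * crossterm A (nz o) l b a))%:E <=
   (expR (8 * T%:R / Delta * th ^+ 2))%:E)%E.
Proof.
move=> w1 th1.
have D0 : 0 < Delta by rewrite exprn_gt0// subr_gt0.
set M := 8 * T%:R / Delta * th ^+ 2.
pose N o := \sum_l w l * crossterm A (nz o) l b a.
pose V o := \sum_l w l ^+ 2 * coord_energy (nz o) l a.
have mn i : measurable_fun setT (noise eta i) by exact: measurable_noise.
have mN : measurable_fun setT N.
  by apply: measurable_sum => l; apply: measurable_funM => //; exact: measurable_crossterm.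
have mV : measurable_fun setT V.
  by apply: measurable_sum => l; apply: measurable_funM => //;
    exact: measurable_coord_energy.
have E1 : (\int[P]_o (expR (2 * th * N o - 2 * th ^+ 2 * V o))%:E <= 1)%E.
  have := expectation_exp_martingale hgauss hindep A (fun l => 2 * th * w l) b a.
  rewrite (_ : (\int[P]_o _)%E = (\int[P]_o (expR (2 * th * N o - 2 * th ^+ 2 * V
    o))%:E)%E)//.
  apply: eq_integral => o _; congr ((expR _)%:E).
  rewrite /N /V !mulr_sumr -sumrB; apply: eq_bigr => l _.
  by rewrite coord_energyT; field.
have wl1 l : w l ^+ 2 <= 1.
  rewrite (le_trans _ w1)// (bigD1 l)//= lerDl sumr_ge0// => i _; exact: sqr_ge0.
have E2 : (\int[P]_o (expR (2 * th ^+ 2 * V o))%:E <= (expR (2 * M))%:E)%E.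
  have := expectation_exp_coord_energy (kap := fun l => 2 * th ^+ 2 * w l ^+ 2) a.
  rewrite (_ : (\int[P]_o _)%E = (\int[P]_o (expR (2 * th ^+ 2 * V o))%:E)%E); last first.
    apply: eq_integral => o _; congr ((expR _)%:E).
    by rewrite /V mulr_sumr; apply: eq_bigr => l _; rewrite mulrA.
  move=> /(_ _)/le_trans; apply.
    move=> l; have := wl1 l; have := sqr_ge0 (w l); have := sqr_ge0 th => a0 a1 a2.
    apply/andP; split; first by rewrite mulr_ge0// mulr_ge0.
    have : th ^+ 2 * w l ^+ 2 <= th ^+ 2 by rewrite ler_piMr.
    lra.
  rewrite lee_fin ler_expR -mulr_sumr /M.
  have : 0 <= 8 * T%:R / Delta * (2 * th ^+ 2).
    apply: mulr_ge0; last by rewrite mulr_ge0 ?sqr_ge0.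
    by rewrite divr_ge0 ?(ltW D0)// mulr_ge0.
  move=> h; have := ler_wpM2l h w1; rewrite mulr1.
  by rewrite [X in _ -> _ <= X](_ : _ = 8 * T%:R / Delta * (2 * th ^+ 2)) ?mulrA//; ring.
apply: (@le_trans _ _ (\int[P]_o ((2^-1 * expR M)%:E * (expR (2 * th * N o - 2 * th ^+ 2
  * V o))%:E +
    (2^-1 * expR (- M))%:E * (expR (2 * th ^+ 2 * V o))%:E))%E).
  apply: le_integral_pos => o; first by rewrite lee_fin expR_ge0.
  rewrite -!EFinM -EFinD lee_fin.
  set x := expR (2^-1 * (M + (2 * th * N o - 2 * th ^+ 2 * V o))).
  set y := expR (2^-1 * (- M + 2 * th ^+ 2 * V o)).
  have -> : expR (th * \sum_l w l * crossterm A (nz o) l b a) = x * y.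
    by rewrite -expRD -/(N o); congr expR; field.
  have -> : 2^-1 * expR M * expR (2 * th * N o - 2 * th ^+ 2 * V o) = 2^-1 * x ^+ 2.
    rewrite -expRM_natl -mulrA -expRD; by congr (_ * expR _); field.
  have -> : 2^-1 * expR (- M) * expR (2 * th ^+ 2 * V o) = 2^-1 * y ^+ 2.
    rewrite -expRM_natl -mulrA -expRD; by congr (_ * expR _); field.
  have := sqr_ge0 (x - y); nra.
have m1 : measurable_fun setT (fun o => (expR (2 * th * N o - 2 * th ^+ 2 * V o))%:E).
  apply/measurable_EFinP; apply: measurableT_comp => //.
  by apply: measurable_funB; apply: measurable_funM.
have m2 : measurable_fun setT (fun o => (expR (2 * th ^+ 2 * V o))%:E).
  apply/measurable_EFinP; apply: measurableT_comp => //.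
  by apply: measurable_funM.
have c0 (z : R) : (0 <= (2^-1 * expR z)%:E)%E by rewrite lee_fin mulr_ge0// expR_ge0.
have e0 (z : R) : (0 <= (expR z)%:E)%E by rewrite lee_fin expR_ge0.
rewrite ge0_integralD//; first last.
all: try exact: measurable_funeM.
all: try by move=> o _; apply: mule_ge0.
rewrite !ge0_integralZl//.
apply: (@le_trans _ _ ((2^-1 * expR M)%:E * 1 +
  (2^-1 * expR (- M))%:E * (expR (2 * M))%:E)%E).
  by apply: leeD; rewrite lee_wpmul2l.
rewrite mule1 -EFinM -EFinD lee_fin -mulrA -expRD.
rewrite (_ : - M + 2 * M = M); last by ring.
lra.
Qed.

Lemma crossterm_tail (w : 'I_m -> R) (s : R) (b a : 'I_d) : (0 < T)%N -> 0 <= s ->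
  \sum_l w l ^+ 2 <= 1 ->
  (P [set o | (8 * (s + 1) * Num.sqrt (T%:R / Delta) <=
    \sum_l w l * crossterm A (nz o) l b a)%R] <= (expR (- s))%:E)%E.
Proof.
move=> T0 s0 w1.
have D0 : 0 < Delta by rewrite exprn_gt0// subr_gt0.
have T1 : 1 <= T%:R :> R by rewrite ler1n.
have Tn0 : T%:R != 0 :> R by rewrite pnatr_eq0 -lt0n.
have Dn0 : 1 - rho != 0 by rewrite subr_eq0 gt_eqF.
have TD : 0 < T%:R / Delta by rewrite divr_gt0// ltr0n.
set c := Num.sqrt (T%:R / Delta).
have c0 : 0 < c by rewrite sqrtr_gt0.
have c2 : c ^+ 2 = T%:R / Delta by rewrite sqr_sqrtr// ltW.
(* For this value the moment bound is [exp (1/8)], whatever [s], and the event reads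
   [s + 1 <= th N]. The value is not adapted to [s], hence a threshold linear in [s]. *)
pose th := (8 * c)^-1.
have th2 : th ^+ 2 = Delta / (64 * T%:R).
  by rewrite /th exprVn exprMn c2; field; rewrite Tn0 Dn0.
have th1 : th ^+ 2 <= Delta / 32.
  rewrite th2 ler_wpM2l ?(ltW D0)// lef_pV2 ?posrE; lra.
have := expectation_exp_crossterm b a w1 th1.
pose N o := \sum_l w l * crossterm A (nz o) l b a.
have mN : measurable_fun setT (fun o => th * N o).
  apply: measurable_funM => //; apply: measurable_sum => l.
  apply: measurable_funM => //; apply: measurable_crossterm => i.
  exact: measurable_noise.
move=> /(exp_markov (s + 1) mN).
rewrite -/N (_ : [set w0 | _] = [set o | (8 * (s + 1) * c <= N o)%R]); last first.
  apply/seteqP; split => o /=; rewrite /th ler_pdivlMl ?mulr_gt0//;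
    by rewrite (_ : 8 * c * (s + 1) = 8 * (s + 1) * c) //; ring.
move=> h; apply: (le_trans h); rewrite lee_fin ler_expR th2.
rewrite (_ : 8 * T%:R / Delta * (Delta / (64 * T%:R)) = 8^-1); first lra.
by field; rewrite Tn0 Dn0.
Qed.

Lemma energy_tail (L : {set 'I_m}) (s c : R) (v : 'I_m -> 'I_d -> R) : 0 <= s ->
  (P [set o | (\sum_(l in L) s * energy A (nz o) l (v l) <=
      T%:R / 4 * \sum_(l in L) Num.min (s * \sum_a v l a ^+ 2) 1 - c)%R] <=
   (expR (- c))%:E)%E.
Proof.
move=> s0; have E := expectation_exp_neg_energy hgauss hindep A L v s0.
set B := T%:R / 4 * _ in E *.
have mY : measurable_fun setT (fun o => - \sum_(l in L) s * energy A (nz o) l (v l)).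
  apply: measurableT_comp => //.
  under eq_fun do rewrite big_mkcond /=.
  apply: measurable_sum => l; case: (l \in L) => //.
  apply: measurable_funM => //; apply: measurable_energy => i.
  exact: measurable_noise.
have := exp_markov (c - B) mY E.
rewrite (_ : - B - (c - B) = - c); last by ring.
rewrite (_ : [set w | _] = [set o | (\sum_(l in L) s * energy A (nz o) l (v l) <=
  B - c)%R])//.
apply/seteqP; split => o /=; lra.
Qed.

Lemma coord_energy_tail (L : {set 'I_m}) (c : R) (a : 'I_d) :
  (P [set o | (16 / Delta * (T%:R / 2 * #|L|%:R + c) <=
     \sum_(l in L) coord_energy (nz o) l a)%R] <= (expR (- c))%:E)%E.
Proof.
have D0 : 0 < Delta by rewrite exprn_gt0// subr_gt0.
have h1 l : 0 <= (if l \in L then Delta / 16 else 0) <= Delta / 16.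
  by case: ifP => _; rewrite lexx ?andbT divr_ge0// ltW.
have E := expectation_exp_coord_energy a h1.
have mY : measurable_fun setT (fun o => \sum_l (if l \in L then Delta / 16 else 0) *
  coord_energy (nz o) l a).
  apply: measurable_sum => l.
  apply: measurable_funM => //; apply: measurable_coord_energy => i.
  exact: measurable_noise.
have := exp_markov (T%:R / 2 * #|L|%:R + c) mY E.
rewrite (_ : 8 * T%:R / Delta * _ - _ = - c); last first.
  rewrite -big_mkcond sumr_const -[_ *+ #|L|]mulr_natr.
  by field; rewrite subr_eq0 gt_eqF.
rewrite (_ : [set w | _] = [set o | (16 / Delta * (T%:R / 2 * #|L|%:R + c) <=
  \sum_(l in L) coord_energy (nz o) l a)%R])//.
apply/seteqP; split => o /=.
  have -> : \sum_l (if l \in L then Delta / 16 else 0) * coord_energy (nz o) l a =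
      Delta / 16 * \sum_(l in L) coord_energy (nz o) l a.
    rewrite mulr_sumr [RHS]big_mkcond; apply: eq_bigr => l _.
    by case: ifP => _ //; rewrite mul0r.
  rewrite -ler_pdivrMl ?divr_gt0//.
  by rewrite (_ : (Delta / 16)^-1 = 16 / Delta)//; field; rewrite subr_eq0 gt_eqF.
have -> : \sum_l (if l \in L then Delta / 16 else 0) * coord_energy (nz o) l a =
      Delta / 16 * \sum_(l in L) coord_energy (nz o) l a.
    rewrite mulr_sumr [RHS]big_mkcond; apply: eq_bigr => l _.
    by case: ifP => _ //; rewrite mul0r.
rewrite -ler_pdivrMl ?divr_gt0//.
by rewrite (_ : (Delta / 16)^-1 = 16 / Delta)//; field; rewrite subr_eq0 gt_eqF.
Qed.

End tails.

(** * Edge boundaries and the pseudoinverse of the incidence matrix *)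

Definition joined (m p : nat) (o : 'I_p -> 'I_m * 'I_m) : rel 'I_m :=
  [rel u v | [exists k, (o k == (u, v)) || (o k == (v, u))]].

Lemma joined_connect (m : nat) (E : {set {set 'I_m}})
    (o : 'I_#|E| -> 'I_m * 'I_m) : orientation o -> connected_graph E ->
  forall i j, connect (joined o) i j.
Proof.
move=> ho hc i j; apply: connect_sub (hc i j) => u v /= uv.
apply: connect1; apply/existsP; exists (enum_rank_in uv [set u; v]%SET).
have := ho (enum_rank_in uv [set u; v]%SET); rewrite enum_rankK_in//.
case: (o _) => a b /= /setP ab.
have := ab a; have := ab b; have := ab u; have := ab v.
rewrite !inE !eqxx /= !orbT !xpair_eqE.
move=> /esym/orP[/eqP va|/eqP vb] /esym/orP[/eqP ua|/eqP ub] /orP[/eqP bu|/eqP bv]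
  /orP[/eqP au|/eqP av]; subst; by rewrite ?eqxx ?orbT.
Qed.

Section graph.
Context {R : realType} (m p : nat) (o : 'I_p -> 'I_m * 'I_m).
Hypothesis hconn : forall i j, connect (joined o) i j.
Hypothesis m0 : (0 < m)%N.
Local Notation D := (incidence R o).

Lemma edge_const (U : Type) (x : 'I_m -> U) :
  (forall k, x (o k).1 = x (o k).2) -> forall i j, x i = x j.
Proof.
move=> hx i j; have /connectP[s + ->] := hconn i j.
elim: s i => //= v s IH i /andP[/existsP[k /orP[]/eqP ok] sp].
  by rewrite -(IH v sp); have := hx k; rewrite ok.
by rewrite -(IH v sp); have := hx k; rewrite ok.
Qed.

Lemma incidenceE n (x : 'M[R]_(m, n)) k j :
  (D *m x) k j = x (o k).1 j - x (o k).2 j.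
Proof.
rewrite mxE; transitivity (\sum_i ((i == (o k).1)%:R * x i j - (i == (o k).2)%:R * x i j)).
  by apply: eq_bigr => i _; rewrite mxE mulrBl.
rewrite sumrB (bigD1 (o k).1)//= eqxx mul1r big1 ?addr0; last first.
  by move=> i /negbTE ->; rewrite mul0r.
rewrite (bigD1 (o k).2)//= eqxx mul1r big1 ?addr0//.
by move=> i /negbTE ->; rewrite mul0r.
Qed.

Variable P : 'M[R]_(m, p).
Hypothesis hpinv : is_pinv D P.

(* [1 - P D] is a symmetric projector onto the kernel of D, the constants. *)
Lemma pinv_residual i j : (1%:M - P *m D) i j = m%:R^-1.
Proof.
have [h1 h2 h3 h4] := hpinv.
set Q := 1%:M - P *m D.
have DQ : D *m Q = 0 by rewrite mulmxBr mulmx1 mulmxA h1 subrr.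
have Qs : Q^T = Q by rewrite linearB /= h4 trmx1.
have Qrow a b c : Q a c = Q b c.
  apply: (edge_const (x := fun i => Q i c)) => k; apply/eqP.
  by rewrite -subr_eq0 -incidenceE DQ mxE.
have Qc a b c e : Q a c = Q b e.
  by rewrite (Qrow a e c) -[in LHS]Qs mxE (Qrow c b e).
have Q1 : \sum_l Q i l = 1.
  have : (Q *m const_mx 1) i (0 : 'I_1) = 1.
    rewrite mulmxBl mul1mx -mulmxA (_ : D *m const_mx 1 = 0).
      by rewrite mulmx0 subr0 mxE.
    by apply/matrixP => k l; rewrite incidenceE !mxE subrr.
  by rewrite mxE => <-; apply: eq_bigr => l _; rewrite [const_mx _ _ _]mxE mulr1.
have : m%:R * Q i j = 1.
  rewrite -[RHS]Q1 (eq_bigr (fun=> Q i j)) => [|l _]; last exact: Qc.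
  by rewrite sumr_const card_ord -[RHS]mulr_natl.
have mn0 : m%:R != 0 :> R by rewrite pnatr_eq0 -lt0n.
by move=> h; apply: (mulfI mn0); rewrite h mulfV.
Qed.

Lemma pinv_decomp (x : 'I_m -> R) l : x l = m%:R^-1 * (\sum_i x i) +
  \sum_k P l k * (x (o k).1 - x (o k).2).
Proof.
pose X : 'cV[R]_m := \col_i x i.
have -> : x l = (1%:M *m X) l 0 by rewrite mul1mx mxE.
rewrite (_ : 1%:M = (1%:M - P *m D) + P *m D); last by rewrite subrK.
rewrite mulmxDl mxE; congr (_ + _).
  rewrite mxE mulr_sumr; apply: eq_bigr => i _; by rewrite pinv_residual !mxE.
rewrite -mulmxA mxE; apply: eq_bigr => k _; by rewrite incidenceE !mxE.
Qed.

Lemma max_row_norm_ge0 : 0 <= max_row_norm P.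
Proof.
rewrite /max_row_norm; elim/big_ind: _ => // [x y x0 y0|i _]; last exact: l2norm_ge0.
by rewrite le_max x0.
Qed.

Lemma row_norm_le l : \sum_k P l k ^+ 2 <= max_row_norm P ^+ 2.
Proof.
have -> : \sum_k P l k ^+ 2 = l2norm (row l P)^T ^+ 2.
  by rewrite l2norm_sqr; apply: eq_bigr => k _; rewrite !mxE.
rewrite lerXn2r ?nnegrE ?l2norm_ge0 ?max_row_norm_ge0//.
by rewrite /max_row_norm (bigD1 l)//= le_max lexx.
Qed.

(** From [P = P (D P)^T = P P^T D^T], an entry is a difference of two inner products of rows of [P].
    The bound is quadratic in [mu'], which gives the isoperimetric inequality and the normalization
    of the atoms. *)
Lemma pinv_entry_le l k : `|P l k| <= 2 * max_row_norm P ^+ 2.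
Proof.
have [h1 h2 h3 h4] := hpinv.
have dot i : `|\sum_j P l j * P i j| <= max_row_norm P ^+ 2.
  apply: ler_abs_of_sqr; first by rewrite sqr_ge0.
  rewrite (le_trans (cauchy_schwarz_sum _ _))// expr2 ler_pM ?row_norm_le//;
    by apply: sumr_ge0 => j _; exact: sqr_ge0.
have -> : P l k = \sum_j P l j * P (o k).1 j - \sum_j P l j * P (o k).2 j.
  have -> : P l k = (P *m (D *m P)^T) l k by rewrite h3 mulmxA h2.
  rewrite mxE -sumrB; apply: eq_bigr => j _.
  by rewrite mxE incidenceE mulrBr.
by rewrite (le_trans (ler_normB _ _))// mulr2n mulrDl mul1r lerD.
Qed.

Definition edge_cut (L : {set 'I_m}) : {set 'I_p} :=
  [set k | ((o k).1 \in L) != ((o k).2 \in L)]%SET.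

(** The indicator of [L] is decomposed by [pinv_decomp] at a vertex inside and at one outside. The
    difference 1 is a sum over the cut edges, each contributing at most [4 mu'^2]. *)
Lemma cut_isoperimetry L : edge_cut L != finset.set0 ->
  1 <= 4 * max_row_norm P ^+ 2 * #|edge_cut L|%:R.
Proof.
case/set0Pn => k; rewrite inE => kc.
have [l lL [l' lL']] : exists2 l, l \in L & exists l', l' \notin L.
  move: kc; case: (boolP ((o k).1 \in L)) => a1; case: (boolP ((o k).2 \in L)) => a2 // _.
    by exists (o k).1 => //; exists (o k).2.
  by exists (o k).2 => //; exists (o k).1.
pose x i : R := (i \in L)%:R.
have : x l - x l' = \sum_k (P l k - P l' k) * (x (o k).1 - x (o k).2).
  rewrite (pinv_decomp x l) (pinv_decomp x l') opprD addrACA subrr add0r -sumrB.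
  by apply: eq_bigr => j _; rewrite mulrBl.
rewrite /x lL (negbTE lL') subr0 => h.
rewrite [X in X <= _]h (bigID (fun j => j \in edge_cut L)) /= [X in _ + X]big1 ?addr0;
  last first.
  by move=> j; rewrite inE negbK => /eqP ->; rewrite subrr mulr0.
rewrite -[#|edge_cut L|%:R]mulr1 -sum1_card natr_sum mulr1 mulr_sumr.
apply: ler_sum => j jc; rewrite mulr1 (le_trans (ler_norm _))// normrM.
have b1 : `|P l j - P l' j| <= 4 * max_row_norm P ^+ 2.
  rewrite (le_trans (ler_normB _ _))//.
  have := pinv_entry_le l j; have := pinv_entry_le l' j; lra.
rewrite (le_trans _ b1)// ler_piMr//.
by case: (_ \in L); case: (_ \in L); rewrite ?subrr ?subr0 ?sub0r ?normrN ?normr1 ?normr0.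
Qed.

Lemma cutU_inj L L' : edge_cut L = edge_cut L' ->
  (Ordinal m0 \in L) = (Ordinal m0 \in L') -> L = L'.
Proof.
move=> cc v0; apply/setP => i; apply/eqP.
have : ((i \in L) == (i \in L')) = ((Ordinal m0 \in L) == (Ordinal m0 \in L')).
  apply: (edge_const (x := fun i => (i \in L) == (i \in L'))) => k.
  move/setP/(_ k): cc; rewrite !inE.
  by do 4! case: (_ \in _).
by move=> ->; apply/eqP.
Qed.

(** In a connected graph a vertex set is determined by its cut and by whether it contains vertex 0.
    The sum is therefore at most twice the sum over all sets of edges, given by the binomial
    formula. *)
Lemma sum_exp_cut_le (x : R) : 0 <= x ->
  \sum_(L : {set 'I_m}) x ^+ #|edge_cut L| <= 2 * (1 + x) ^+ p.
Proof.
move=> x0; pose h (L : {set 'I_m}) := (Ordinal m0 \in L, edge_cut L).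
have hi : injective h by move=> L L' [a b]; apply: cutU_inj.
have -> : 2 * (1 + x) ^+ p = \sum_(bS : bool * {set 'I_p}) x ^+ #|bS.2|.
  rewrite -(pair_bigA _ (fun (b : bool) (S : {set 'I_p}) => x ^+ #|S|)) /=.
  rewrite sumr_const card_bool -[RHS]mulr_natl; congr (_ * _).
  rewrite -[p in LHS]card_ord -prodr_const addrC bigA_distr /=.
  by apply: eq_bigr => S _; rewrite -big_mkcond prodr_const.
rewrite -(big_imset (fun bS : bool * {set 'I_p} => x ^+ #|bS.2|) (in2W hi)) /=.
rewrite [leRHS](bigID (fun bS => bS \in [set h L | L in {set 'I_m}]%SET)) /=.
by rewrite lerDl sumr_ge0// => i _; rewrite exprn_ge0.
Qed.

(* Induction on the number of vertices below the ceiling w: between the largest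
   value s below w and w itself, the superlevel sets do not change. *)
Lemma coarea_aux N (y : 'I_m -> R) (w c : R) : (#|[set v | (y v < w)%R]%SET| <= N)%N ->
  0 <= w -> (forall v, 0 <= y v <= w) ->
  (forall s, 0 <= s < w -> c <= #|edge_cut [set v | (s < y v)%R]%SET|%:R) ->
  c * w <= \sum_k `|y (o k).1 - y (o k).2|.
Proof.
elim: N y w => [|N IH] y w hN w0 yw hc.
  have [->|wn0] := eqVneq w 0; first by rewrite mulr0 sumr_ge0.
  have wp : 0 < w by rewrite lt0r wn0.
  have yE v : y v = w.
    apply/eqP; rewrite eq_le; have /andP[_ ->] := yw v => /=.
    move: hN; rewrite leqn0 => /eqP/cards0_eq/setP/(_ v).
    by rewrite !inE leNgt => ->.
  have := hc 0; rewrite lexx wp => /(_ isT).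
  have -> : edge_cut [set v | (0 < y v)%R]%SET = finset.set0.
    by apply/setP => k; rewrite !inE !yE eqxx.
  rewrite cards0 => c0; rewrite (le_trans (y := 0)) ?sumr_ge0//.
  by rewrite mulr_le0_ge0.
have [A0|/set0Pn[v0 v0A]] := eqVneq [set v | (y v < w)%R]%SET finset.set0.
  by apply: IH => //; rewrite A0 cards0.
rewrite inE in v0A.
have [v vw vmax] := @Order.TotalTheory.arg_maxP _ _ _ v0 (fun v => y v < w) y v0A.
set s := y v in vw vmax.
have s0 : 0 <= s by have /andP[] := yw v.
have yP u : y u <= s \/ y u = w.
  have [yu|yu] := ltP (y u) w; first by left; apply: vmax.
  by right; apply/eqP; rewrite eq_le yu andbT; have /andP[] := yw u.
pose y' u := Num.min (y u) s.
have h1 : c * s <= \sum_k `|y' (o k).1 - y' (o k).2|.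
  apply: IH => //.
  - rewrite -ltnS; apply: leq_trans hN; apply: proper_card; apply/properP; split.
      apply/fintype.subsetP => u; rewrite !inE /y' gt_min ltxx orbF => us;
        exact: lt_trans vw.
    by exists v; rewrite inE ?vw// /y' -/s minxx ltxx.
  - by move=> u; rewrite /y' ge_min lexx orbT le_min s0 !andbT; have /andP[] := yw u.
  - move=> z /andP[z0 zs]; have -> : [set u | z < y' u]%SET = [set u | z < y u]%SET.
      by apply/setP => u; rewrite !inE /y' lt_min zs andbT.
    by apply: hc; rewrite z0 (lt_trans zs).
have h2 : c * (w - s) <= #|edge_cut [set u | (s < y u)%R]%SET|%:R * (w - s).
  by rewrite ler_wpM2r ?subr_ge0 ?(ltW vw)// hc// s0.
have -> : c * w = c * s + c * (w - s) by ring.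
apply: (le_trans (lerD h1 h2)).
have -> : #|edge_cut [set u | (s < y u)%R]%SET|%:R * (w - s) =
    \sum_k (if (s < y (o k).1) != (s < y (o k).2) then w - s else 0).
  rewrite -big_mkcond sumr_const -[RHS]mulr_natl; congr (_%:R * _).
  by apply: eq_card => k; rewrite !inE.
rewrite -big_split /=; apply: ler_sum => k _; rewrite /y' !minEle.
have := yP (o k).1; have := yP (o k).2.
move: (y (o k).1) (y (o k).2) => a b.
have sw := ltW vw.
case=> [bs|->] [as_|->]; rewrite ?as_ ?bs ?(leNgt w) ?vw /= ?(ltNge s) ?as_ ?bs /= ?addr0//.
- by rewrite !ger0_norm ?subr_ge0// ?(le_trans bs)//; lra.
- by rewrite !(distrC a) !ger0_norm ?subr_ge0// ?(le_trans as_)//; lra.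
- by rewrite !subrr.
Qed.

Lemma coarea (y : 'I_m -> R) (w : R) : 0 < w -> (forall v, 0 <= y v <= w) ->
  exists2 s, 0 <= s < w & #|edge_cut [set v | (s < y v)%R]%SET|%:R * w <=
    \sum_k `|y (o k).1 - y (o k).2|.
Proof.
move=> w0 yw; apply: contrapT => hn.
set r := \sum_k _ in hn.
have h s : 0 <= s < w -> r < #|edge_cut [set v | (s < y v)%R]%SET|%:R * w.
  move=> sw; rewrite ltNge; apply/negP => h; apply: hn; by exists s.
have r0 : 0 <= r by apply: sumr_ge0.
(* If every level failed, each cut size, being an integer above [r / w], would be at least [n]. This
   bound is uniform in the level, as [coarea_aux] requires. *)
pose n := (Num.truncn (r / w)).+1.
have rn : r < n%:R * w.
  by rewrite -ltr_pdivrMr// truncnS_gt.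
have : n%:R * w <= r.
  apply: (@coarea_aux _ y w n%:R (leqnn _)) => //; first exact: ltW.
  move=> s sw; rewrite ler_nat /n.
  rewrite truncn_lt_nat ?divr_ge0 ?(ltW w0)// ltr_pdivrMr//.
  exact: h.
by rewrite leNgt rn.
Qed.

Lemma cut_diff (L L' : {set 'I_m}) : (#|edge_cut (L :\: L')| <=
  #|edge_cut L| + #|edge_cut L'|)%N.
Proof.
rewrite -cardsUI; apply: leq_trans (leq_addr _ _); apply: subset_leq_card.
apply/fintype.subsetP => k; rewrite !inE.
by do 4! case: (_ \in _).
Qed.

(** The residual projector has trace 1, so [tr (D P) = m - 1]; but [D P] is an orthogonal projector
    of size [p], whose diagonal entries are at most 1. *)
Lemma edge_count_ge : (m <= p.+1)%N.
Proof.
have [h1 h2 h3 h4] := hpinv.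
have tr1 : m%:R - \tr (P *m D) = 1 :> R.
  rewrite -[m%:R](@mxtrace1 R) -raddfB /=.
  rewrite /mxtrace (eq_bigr (fun=> m%:R^-1)) => [|i _]; last exact: pinv_residual.
  by rewrite sumr_const card_ord -[LHS]mulr_natl mulfV// pnatr_eq0 -lt0n.
have tr2 : \tr (P *m D) <= p%:R.
  rewrite mxtrace_mulC -[p in p%:R]card_ord -sum1_card natr_sum.
  apply: ler_sum => k _.
  have sq : (D *m P) k k = \sum_i (D *m P) k i ^+ 2.
    have -> : (D *m P) k k = ((D *m P) *m (D *m P)^T) k k by rewrite h3 mulmxA h1.
    by rewrite mxE; apply: eq_bigr => i _; rewrite [_^T _ _]mxE.
  have : (D *m P) k k ^+ 2 <= (D *m P) k k.
    rewrite [leRHS]sq (bigD1 k)//= lerDl sumr_ge0// => i _; exact: sqr_ge0.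
  nra.
by rewrite -(ler_nat R) -natr1; lra.
Qed.

End graph.

Lemma edge_count_le (m : nat) (E : {set {set 'I_m}}) : simple_graph E ->
  (#|E| <= m ^ 2)%N.
Proof.
move=> hE; apply: (@leq_trans #|[set [set i.1;
  i.2]%SET | i in [set: 'I_m * 'I_m]%SET]%SET|).
  apply: subset_leq_card; apply/fintype.subsetP => e /hE/eqP/cards2P[a [b [_ ->]]].
  by apply/imsetP; exists (a, b); rewrite ?inE.
by rewrite (leq_trans (leq_imset_card _ _))// cardsT card_prod card_ord mulnn.
Qed.

(** * Maurey sampling and the dyadic decomposition *)

Section sampling.
Context {R : realType} (At : finType) (c : At -> R).

(** The expectation over [k] independent draws from the law [c], as nested finite sums rather than
    on a probability space. *)
Fixpoint avg (k : nat) (F : seq At -> R) : R :=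
  if k is k'.+1 then \sum_x c x * avg k' (fun s => F (x :: s)) else F [::].

Hypothesis c0 : forall x, 0 <= c x.
Hypothesis c1 : \sum_x c x = 1.

Lemma le_avg k (F G : seq At -> R) :
  (forall s, size s = k -> F s <= G s) -> avg k F <= avg k G.
Proof.
elim: k F G => [|k IH] F G FG /=; first exact: FG.
apply: ler_sum => x _; rewrite ler_wpM2l//; apply: IH => s sk.
by apply: FG; rewrite /= sk.
Qed.

Lemma eq_avg k (F G : seq At -> R) :
  (forall s, size s = k -> F s = G s) -> avg k F = avg k G.
Proof.
by move=> FG; apply/le_anti; rewrite !le_avg// => s /FG ->.
Qed.

Lemma avg_cst k (a : R) : avg k (fun=> a) = a.
Proof. by elim: k => //= k ->; rewrite -mulr_suml c1 mul1r. Qed.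

Lemma avgD k (F G : seq At -> R) :
  avg k (fun s => F s + G s) = avg k F + avg k G.
Proof.
elim: k F G => //= k IH F G; rewrite -big_split; apply: eq_bigr => x _.
by rewrite IH mulrDr.
Qed.

Lemma avgZ k (a : R) (F : seq At -> R) : avg k (fun s => a * F s) = a * avg k F.
Proof.
elim: k F => //= k IH F; rewrite mulr_sumr; apply: eq_bigr => x _.
by rewrite IH mulrCA.
Qed.

Lemma avg_sum k (I : Type) (r : seq I) (Q : pred I) (F : I -> seq At -> R) :
  avg k (fun s => \sum_(i <- r | Q i) F i s) = \sum_(i <- r | Q i) avg k (F i).
Proof.
elim: r => [|i r IH].
  by rewrite big_nil (eq_avg (G := fun=> 0)) ?avg_cst// => s _; rewrite big_nil.
rewrite big_cons -IH; case: ifP => Qi.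
  by rewrite -avgD; apply: eq_avg => s _; rewrite big_cons Qi.
by apply: eq_avg => s _; rewrite big_cons Qi.
Qed.

Lemma avg_sum_sq k (z : At -> R) (a : R) : let mu := \sum_x c x * z x in
  avg k (fun s => (a + \sum_(x <- s) z x) ^+ 2) =
  (a + k%:R * mu) ^+ 2 + k%:R * (\sum_x c x * z x ^+ 2 - mu ^+ 2).
Proof.
move=> mu; elim: k a => [|k IH] a /=; first by rewrite big_nil; ring.
transitivity (\sum_x c x * ((a + z x + k%:R * mu) ^+ 2 +
   k%:R * (\sum_x c x * z x ^+ 2 - mu ^+ 2))).
  apply: eq_bigr => x _; rewrite -IH; congr (_ * _); apply: eq_avg => s _.
  by rewrite big_cons addrA.
set V := k%:R * (_ - _).
transitivity (\sum_x (((a + k%:R * mu) ^+ 2 + V) * c x +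
    (2 * (a + k%:R * mu) * (c x * z x) + c x * z x ^+ 2))).
  by apply: eq_bigr => x _; ring.
rewrite !big_split /= -!mulr_sumr c1 -/mu /V -natr1; ring.
Qed.

Definition smean k (s : seq At) (z : At -> R) : R := k%:R^-1 * \sum_(x <- s) z x.

Lemma avg_smean_sq k (z : At -> R) (a : R) : (0 < k)%N ->
  avg k (fun s => (a + smean k s z) ^+ 2) <=
  (a + \sum_x c x * z x) ^+ 2 + k%:R^-1 * \sum_x c x * z x ^+ 2.
Proof.
move=> k0; have kn0 : k%:R != 0 :> R by rewrite pnatr_eq0 -lt0n.
set mu := \sum_x c x * z x; set V := \sum_x _.
rewrite (eq_avg (G := fun s => k%:R ^- 2 * (k%:R * a + \sum_(x <- s) z x) ^+ 2)).
  rewrite avgZ avg_sum_sq -/mu -/V.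
  rewrite [X in X <= _](_ : _ = (a + mu) ^+ 2 + k%:R^-1 * V - k%:R^-1 * mu ^+ 2).
    by rewrite gerBl mulr_ge0 ?invr_ge0 ?sqr_ge0.
  by field.
by move=> s _; rewrite /smean; field.
Qed.

End sampling.

(** * Lower bound for the energy on one shell *)

Section shell.
Context {R : realType} (m d T : nat) (At : finType) (X : 'I_m -> 'I_T -> 'I_d -> R).

Definition qform l (v : 'I_d -> R) : R := \sum_t (\sum_a v a * X l t a) ^+ 2.

Lemma qform_ge0 l v : 0 <= qform l v.
Proof. by apply: sumr_ge0 => t _; exact: sqr_ge0. Qed.

Lemma qformZ l (k : R) v : qform l (fun a => k * v a) = k ^+ 2 * qform l v.
Proof.
rewrite /qform mulr_sumr; apply: eq_bigr => t _; rewrite -exprMn mulr_sumr.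
by congr (_ ^+ 2); apply: eq_bigr => a _; rewrite mulrA.
Qed.

Variables (phi : At -> 'I_m -> 'I_d -> R) (c : At -> R).
Hypothesis c0 : forall x, 0 <= c x.
Hypothesis c1 : \sum_x c x = 1.
Hypothesis phi1 : forall x l, \sum_a phi x l a ^+ 2 <= 1.

Definition amean k s l (a : 'I_d) : R := smean k s (fun x => phi x l a).

(* Maurey's empirical method: u is replaced by the mean of k atoms drawn from c,
   for which the lower bound is assumed. *)
Lemma shell_energy (L : {set 'I_m}) (k : nat) (sg eps e1 SB : R)
    (u : 'I_m -> 'I_d -> R) :
  (forall l a, u l a = \sum_x c x * phi x l a) ->
  (0 < k)%N -> 0 <= sg -> sg / k%:R <= eps -> eps <= 64^-1 ->
  (forall l, l \in L -> 16^-1 <= sg * \sum_a u l a ^+ 2) ->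
  (forall s, size s = k ->
    T%:R / 4 * (\sum_(l in L) Num.min (sg * \sum_a amean k s l a ^+ 2) 1) - e1 <=
    \sum_(l in L) sg * qform l (amean k s l)) ->
  (forall x, \sum_(l in L) qform l (phi x l) <= SB) ->
  T%:R / 256 * #|L|%:R - e1 - eps * SB <= \sum_(l in L) sg * qform l (u l).
Proof.
move=> uE k0 sg0 ske e64 uL hs hSB.
have SB0 : 0 <= SB.
  have [x _|no] := pickP (fun x : At => true).
    by apply: le_trans (hSB x); apply: sumr_ge0 => l _; exact: qform_ge0.
  by exfalso; move: c1; rewrite big1 => [/eqP|x]; [rewrite eq_sym oner_eq0|have := no x].
have kp : 0 < k%:R :> R by rewrite ltr0n.
have ki : 0 <= k%:R^-1 :> R by rewrite invr_ge0 ltW.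
(* The energy is quadratic, so its mean over the draws exceeds the energy of [u] by at most the mean
   energy of one atom divided by [k]. *)
have up : avg c k (fun s => \sum_(l in L) sg * qform l (amean k s l)) <=
    \sum_(l in L) sg * qform l (u l) + eps * SB.
  rewrite avg_sum//.
  have h l : avg c k (fun s => sg * qform l (amean k s l)) <=
      sg * qform l (u l) + sg / k%:R * \sum_x c x * qform l (phi x l).
    rewrite avgZ// -mulrA -mulrDr ler_wpM2l// avg_sum//.
    have -> : qform l (u l) + k%:R^-1 * (\sum_x c x * qform l (phi x l)) =
      \sum_t ((\sum_a u l a * X l t a) ^+ 2 + k%:R^-1 *
         \sum_x c x * (\sum_a phi x l a * X l t a) ^+ 2).
      rewrite big_split /= -mulr_sumr; congr (_ + _ * _).
      by rewrite exchange_big; apply: eq_bigr => x _; rewrite mulr_sumr.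
    apply: ler_sum => t _.
    rewrite (eq_avg c0 (G := fun s => (0 +
      smean k s (fun x => \sum_a phi x l a * X l t a)) ^+ 2)).
      rewrite (le_trans (avg_smean_sq c0 c1 _ _ k0))// lerD2r add0r.
      rewrite [X in X ^+ 2 <= _](_ : _ = \sum_a u l a * X l t a)//.
      under eq_bigr do rewrite mulr_sumr.
      rewrite exchange_big; apply: eq_bigr => a _; rewrite uE mulr_suml.
      by apply: eq_bigr => x _; rewrite mulrA.
    move=> s _; rewrite add0r; congr (_ ^+ 2).
    rewrite /amean /smean.
    under eq_bigr do rewrite -mulrA mulr_suml.
    by rewrite -mulr_sumr exchange_big.
  rewrite (le_trans (ler_sum _ (fun l _ => h l)))// big_split /= lerD2l.
  rewrite -mulr_sumr; apply: ler_pM => //; first by rewrite mulr_ge0.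
    by apply: sumr_ge0 => l _; apply: sumr_ge0 => x _; rewrite mulr_ge0// qform_ge0.
  rewrite exchange_big /=.
  rewrite (le_trans (y := \sum_x c x * SB))//; last by rewrite -mulr_suml c1 mul1r.
  by apply: ler_sum => x _; rewrite -mulr_sumr ler_wpM2l.
have low : T%:R / 256 * #|L|%:R - e1 <= avg c k (fun s => T%:R / 4 *
    (\sum_(l in L) Num.min (sg * \sum_a amean k s l a ^+ 2) 1) - e1).
  rewrite avgD// avg_cst// lerD2r avgZ// avg_sum//.
  have -> : T%:R / 256 * #|L|%:R = T%:R / 4 * \sum_(l in L) 64^-1 :> R.
    by rewrite sumr_const -[_ *+ #|L|]mulr_natl; field.
  rewrite ler_wpM2l ?divr_ge0//; apply: ler_sum => l lL.
  (* From [|u|^2 <= 2 |u - a|^2 + 2 |a|^2] for the empirical mean [a], and [sg |u|^2 >= 1/16], the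
     truncated term is at least [1/32 - sg |u - a|^2]. On average this is at least
     [1/32 - eps >= 1/64]. *)
  apply: (@le_trans _ _ (avg c k (fun s => 32^-1 +
     \sum_a (- sg) * (- u l a + amean k s l a) ^+ 2))).
    rewrite avgD// avg_cst// avg_sum//.
    have : \sum_a sg * avg c k (fun s => (- u l a + amean k s l a) ^+ 2) <= eps.
      apply: le_trans ske.
      rewrite -mulr_sumr ler_wpM2l//.
      apply: (@le_trans _ _ (\sum_a k%:R^-1 * \sum_x c x * phi x l a ^+ 2)).
        apply: ler_sum => a _.
        rewrite (le_trans (avg_smean_sq c0 c1 _ _ k0))//.
        by rewrite -uE addNr expr0n add0r.
      rewrite -mulr_sumr ler_piMr// exchange_big /= -c1.
      by apply: ler_sum => x _; rewrite -mulr_sumr ler_piMr.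
    under [X in _ -> _ <= _ + X]eq_bigr do rewrite avgZ//.
    rewrite -!mulr_sumr mulNr; lra.
  apply: le_avg => // s _.
  have := uL l lL.
  have : \sum_a u l a ^+ 2 <= \sum_a (2 * (- u l a + amean k s l a) ^+ 2 +
    2 * amean k s l a ^+ 2).
    apply: ler_sum => a _; have := sqr_ge0 (u l a - 2 * amean k s l a); nra.
  rewrite big_split /= -!mulr_sumr.
  set U := \sum_a u l a ^+ 2; set G := \sum_a amean k s l a ^+ 2;
    set V := \sum_a (_ + _) ^+ 2.
  have V0 : 0 <= V by apply: sumr_ge0 => a _; exact: sqr_ge0.
  move=> h1 h2; have h3 := ler_wpM2l sg0 h1.
  have h4 := mulr_ge0 sg0 V0.
  rewrite le_min; apply/andP; split; lra.
have := le_avg c0 hs; lra.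
Qed.

End shell.

(** The reverse triangle inequality followed by the comparison of the Euclidean norm with the sum of
    absolute values: the vertex norms vary along edges no more than the jumps. *)
Lemma euclid_sub_le (R : realType) d (x y : 'I_d -> R) :
  `|Num.sqrt (\sum_a x a ^+ 2) - Num.sqrt (\sum_a y a ^+ 2)| <= \sum_a `|x a - y a|.
Proof.
suff h (u v : 'I_d -> R) : Num.sqrt (\sum_a u a ^+ 2) - Num.sqrt (\sum_a v a ^+ 2) <=
    \sum_a `|u a - v a|.
  rewrite ler_norml h andbT lerNl opprB (le_trans (h y x))//.
  by apply: ler_sum => a _; rewrite distrC.
rewrite lerBlDl; set S := \sum_a `|_|; set n := Num.sqrt (\sum_a v a ^+ 2).
have S0 : 0 <= S by apply: sumr_ge0.
have n0 : 0 <= n by exact: sqrtr_ge0.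
have v0 : 0 <= \sum_a v a ^+ 2 by apply: sumr_ge0 => a _; exact: sqr_ge0.
rewrite -[leRHS]ger0_norm ?addr_ge0// -sqrtr_sqr ler_sqrt ?sqr_ge0//.
have z1 a : `|u a - v a| <= S by rewrite /S (bigD1 a)//= lerDl sumr_ge0.
have vn a : `|v a| <= n.
  apply: ler_abs_of_sqr => //; rewrite sqr_sqrtr// (bigD1 a)//= lerDl sumr_ge0// => i _.
  exact: sqr_ge0.
have -> : (n + S) ^+ 2 = \sum_a v a ^+ 2 + \sum_a (2 * n * `|u a - v a| + S * `|u a - v a|).
  rewrite sqrrD sqr_sqrtr// big_split /= -!mulr_sumr -/S; ring.
rewrite -big_split; apply: ler_sum => a _ /=.
have h1 := ler_wpM2l (normr_ge0 (u a - v a)) (z1 a).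
have h2 := ler_wpM2l (normr_ge0 (u a - v a)) (vn a).
have h3 : (u a - v a) * v a <= `|u a - v a| * `|v a| by rewrite -normrM ler_norm.
have h4 := real_normK (num_real (u a - v a)).
nra.
Qed.

(** * Summation over the dyadic shells *)

Section multiscale.
Context {R : realType} (m p d T : nat) (At : finType)
  (X : 'I_m -> 'I_T -> 'I_d -> R) (o : 'I_p -> 'I_m * 'I_m)
  (phi : At -> 'I_m -> 'I_d -> R) (w : At -> R) (x0 : At)
  (f : 'I_m -> 'I_d -> R) (W eps lam mu : R) (J : nat).
Hypothesis phi1 : forall x l, \sum_a phi x l a ^+ 2 <= 1.
Hypothesis phi0 : forall l a, phi x0 l a = 0.
Hypothesis w0 : forall x, 0 <= w x.
Hypothesis wW : \sum_x w x <= W.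
Hypothesis W0 : 0 < W.
Hypothesis fE : forall l a, f l a = \sum_x w x * phi x l a.
Hypothesis eps0 : 0 < eps.
Hypothesis eps1 : eps <= 64^-1.
Hypothesis lam0 : 0 <= lam.

(* On the j-th shell the squared norms have order [4 ^- j], and the mean of this
   many atoms has variance at most [eps / 4 ^ j]. *)
Definition sample_size (j : nat) : nat := (Num.truncn (4 ^+ j / eps)).+1.

Hypothesis iso : forall L, edge_cut o L != finset.set0 ->
  1 <= 4 * mu ^+ 2 * #|edge_cut o L|%:R.
Hypothesis lower : forall j (L : {set 'I_m}) s, (j <= J)%N -> size s = sample_size j ->
  T%:R / 4 * (\sum_(l in L) Num.min (4 ^+ j * \sum_a amean phi (sample_size j) s l a ^+
    2) 1) -
    ((sample_size j)%:R + #|edge_cut o L|%:R + 4) * lam <=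
  \sum_(l in L) 4 ^+ j * qform X l (amean phi (sample_size j) s l).
Hypothesis upper : forall (L : {set 'I_m}) x, \sum_(l in L) qform X l (phi x l) <=
  (1024 * eps)^-1 * (T%:R / 2 * #|L|%:R + (#|edge_cut o L|%:R + 4) * lam).

(** Since [t 1 = W] bounds all vertex norms, no vertex lies above a threshold taken in [[t 1, t 0)],
    and the shells start at the top. *)
Let t (j : nat) : R := 2 * W / 2 ^+ j.

Let t_gt0 j : 0 < t j. Proof. by rewrite /t divr_gt0 ?exprn_gt0// mulr_gt0. Qed.

Let tS j : t j = 2 * t j.+1.
Proof. by rewrite /t exprS; field; rewrite expf_neq0// pnatr_eq0. Qed.

Let t_sqr j : t j ^+ 2 * 4 ^+ j = 4 * W ^+ 2.
Proof.
rewrite /t (_ : 4 = 2 * 2 :> R) ?exprMn; last by rewrite -natrM.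
have : 2 ^+ j != 0 :> R by rewrite expf_neq0// pnatr_eq0.
by move: (2 ^+ j) => z z0; field.
Qed.

Let shell_bound j (L : {set 'I_m}) : (j <= J)%N ->
  (forall l, l \in L -> t j ^+ 2 / 16 <= \sum_a f l a ^+ 2) ->
  t j ^+ 2 * (T%:R / 512 * #|L|%:R -
    ((sample_size j)%:R + 2 * #|edge_cut o L|%:R + 8) * lam) <=
      \sum_(l in L) qform X l (f l).
Proof.
move=> jJ hL.
have Wn0 : W != 0 by rewrite gt_eqF.
(* The vector [f / (2 W)] becomes a convex combination once the missing mass is put on the null
   atom. As [4 ^ j (2 W)^-2 = t_j^-2], the scale [4 ^+ j] for it is the scale [t_j^-2] for [f]. *)
pose c x := w x / (2 * W) + (if x == x0 then 1 - (\sum_x w x) / (2 * W) else 0).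
have W20 : 0 < 2 * W by rewrite mulr_gt0.
have c0 x : 0 <= c x.
  rewrite addr_ge0 ?divr_ge0 ?(ltW W20)//; case: ifP => // _.
  by rewrite subr_ge0 ler_pdivrMr// mul1r (le_trans wW)//; move: W0 => W1; lra.
have c1 : \sum_x c x = 1.
  rewrite big_split /= -mulr_suml -big_mkcond big_pred1_eq; lra.
pose u l a := (2 * W)^-1 * f l a.
have uE l a : u l a = \sum_x c x * phi x l a.
  rewrite /u fE mulr_sumr; apply: eq_bigr => x _; rewrite /c [RHS]mulrDl.
  case: eqP => [->|_]; last by rewrite mul0r addr0; ring.
  by rewrite phi0 !mulr0 addr0.
have t2 : t j != 0 by rewrite gt_eqF.
have h4 : 4 ^+ j = 4 * W ^+ 2 / t j ^+ 2 by rewrite -(t_sqr j) mulrAC mulfV ?mul1r//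
  expf_neq0.
have s4 : 0 < 4 ^+ j :> R by rewrite exprn_gt0.
have k0 : 0 < (sample_size j)%:R :> R by rewrite ltr0n.
have := @shell_energy _ _ _ T _ X phi c c0 c1 phi1 L (sample_size j) (4 ^+ j) eps
  (((sample_size j)%:R + #|edge_cut o L|%:R + 4) * lam)
  ((1024 * eps)^-1 * (T%:R / 2 * #|L|%:R + (#|edge_cut o L|%:R +
    4) * lam)) u uE isT (ltW s4) _ eps1 _ _ (upper L).
have -> : \sum_(l in L) 4 ^+ j * qform X l (u l) =
    (t j ^+ 2)^-1 * \sum_(l in L) qform X l (f l).
  rewrite mulr_sumr; apply: eq_bigr => l _; rewrite qformZ h4.
  by move: (qform _ _ _) (t j) t2 => z y y0; field; rewrite Wn0 y0.
move=> H; rewrite -ler_pdivlMl ?exprn_gt0//; apply: le_trans (H _ _ _).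
(* The sampling error costs [T / 2048] per vertex, which leaves [T / 512] out of [T / 256]. *)
- rewrite mulrA (_ : eps * (1024 * eps)^-1 = 1024^-1); last by field; rewrite gt_eqF.
  have : 0 <= T%:R * #|L|%:R :> R by rewrite mulr_ge0.
  have : 0 <= #|edge_cut o L|%:R * lam by rewrite mulr_ge0.
  move: lam0 => lam1; lra.
- by rewrite ler_pdivrMr// mulrC -ler_pdivrMr// ltW// truncnS_gt.
- move=> l /hL; rewrite /u; under [X in _ -> _ <= _ * X]eq_bigr do rewrite exprMn.
  rewrite -mulr_sumr h4; move: (\sum_a _) => z hz.
  rewrite [leRHS](_ : _ = z / t j ^+ 2); first by rewrite ler_pdivlMr ?exprn_gt0//; lra.
  by move: (t j) t2 => y y0; field; rewrite Wn0 y0.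
- by move=> s; exact: lower.
Qed.

Let n l : R := Num.sqrt (\sum_a f l a ^+ 2).

Let n_ge0 l : 0 <= n l. Proof. exact: sqrtr_ge0. Qed.

Let n_sqr l : n l ^+ 2 = \sum_a f l a ^+ 2.
Proof. by rewrite sqr_sqrtr//; apply: sumr_ge0 => a _; exact: sqr_ge0. Qed.

Let n_le l : n l <= W.
Proof.
apply: le_trans wW; rewrite -[leRHS]ger0_norm ?sumr_ge0// -sqrtr_sqr ler_sqrt ?sqr_ge0//.
set S := \sum_x w x.
have S0 : 0 <= S by rewrite sumr_ge0.
apply: (@le_trans _ _ (\sum_a S * \sum_x w x * phi x l a ^+ 2)).
  apply: ler_sum => a _; rewrite fE.
  (* The variance of the atoms under the weights [w], up to a factor: its sign is the Cauchy-Schwarz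
     inequality. *)
  have : 0 <= \sum_x \sum_y w x * w y * (phi x l a - phi y l a) ^+ 2.
    by apply: sumr_ge0 => x _; apply: sumr_ge0 => y _; rewrite mulr_ge0 ?sqr_ge0// mulr_ge0.
  have -> : \sum_x \sum_y w x * w y * (phi x l a - phi y l a) ^+ 2 =
      2 * (S * \sum_x w x * phi x l a ^+ 2 - (\sum_x w x * phi x l a) ^+ 2).
    set Q := \sum_x w x * phi x l a ^+ 2; set M := \sum_x w x * phi x l a.
    transitivity (\sum_x (S * (w x * phi x l a ^+ 2) + (- (2 * M) * (w x * phi x l a) +
      Q * w x))).
      apply: eq_bigr => x _.
      transitivity (\sum_y (w x * phi x l a ^+ 2 * w y +
        (- (2 * (w x * phi x l a)) * (w y * phi y l a) + w x * (w y * phi y l a ^+ 2)))).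
        by apply: eq_bigr => y _; ring.
      by rewrite !big_split /= -!mulr_sumr -/S -/M -/Q; ring.
    by rewrite !big_split /= -!mulr_sumr -/S -/M -/Q; ring.
  lra.
rewrite -mulr_sumr exchange_big expr2 ler_wpM2l//=.
by apply: ler_sum => x _; rewrite -mulr_sumr ler_piMr.
Qed.

Let r := \sum_k \sum_a `|f (o k).1 a - f (o k).2 a|.
(** The length of the part of [[0, x]] lying in [[t (j+1), t j]]. Slices of different shells do not
    overlap, so their variations along the edges add up to at most the total jump [r]. *)
Let slice j (x : R) := Num.min x (t j) - Num.min x (t j.+1).
Let slope j := \sum_k `|slice j (n (o k).1) - slice j (n (o k).2)|.
Let above (s : R) : {set 'I_m} := [set l | s < n l]%SET.

Let sum_slope N : \sum_(j < N) slope j <= r.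
Proof.
rewrite exchange_big; apply: ler_sum => k _ /=.
apply: le_trans (euclid_sub_le _ _); rewrite -/(n _) -/(n _).
move: (n (o k).1) (n (o k).2) => a b.
wlog ba : a b / b <= a.
  move=> h; have [ba|/ltW ab] := leP b a; first exact: h.
  by rewrite distrC; under eq_bigr do rewrite distrC; exact: h.
rewrite [leRHS]ger0_norm ?subr_ge0//.
have min_mono z : Num.min b z <= Num.min a z by rewrite le_min !ge_min ba lexx orbT.
have min_lip z : Num.min a z - Num.min b z <= a - b.
  by rewrite !minEle; case: (leP a z); case: (leP b z) => h1 h2; lra.
have -> : \sum_(j < N) `|slice j a - slice j b| =
    (Num.min a (t 0) - Num.min a (t N)) - (Num.min b (t 0) - Num.min b (t N)).
  elim: N => [|N IH]; first by rewrite big_ord0 !subrr.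
  rewrite big_ord_recr /= IH ger0_norm /slice; first by ring.
  have := t_gt0 N.+1; have := tS N => h1 h2.
  by rewrite !minEle; case: (leP a (t N)); case: (leP a (t N.+1)); case: (leP b (t N));
    case: (leP b (t N.+1)) => *; lra.
have := min_mono (t N); have := min_lip (t 0); lra.
Qed.

(** Coarea inequality applied to each slice, whose width is [t j - t (j+1) = t (j+1)]: each shell
    boundary is paid for by the variation inside its own slice. *)
Let thresholds : exists s : nat -> R, forall j,
  (t j.+1 <= s j < t j) /\ #|edge_cut o (above (s j))|%:R * t j.+1 <= slope j.
Proof.
suff /boolp.choice[s hs] : forall j, exists s, (t j.+1 <= s < t j) /\
    #|edge_cut o (above s)|%:R * t j.+1 <= slope j by exists s.
move=> j.
have [v|s /andP[s0 s1] hs] := @coarea R m p o (slice j \o n) (t j.+1) (t_gt0 _).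
  have := t_gt0 j.+1; have := tS j; have nv := n_ge0 v; rewrite /slice /= => h1 h2.
  by rewrite !minEle; case: (leP (n v) (t j)); case: (leP (n v) (t j.+1)) => *;
    apply/andP; split; lra.
exists (s + t j.+1); split; first by rewrite (tS j); apply/andP; split; lra.
apply: le_trans hs; rewrite ler_wpM2r ?(ltW (t_gt0 _))// ler_nat.
rewrite (_ : [set v | _]%SET = above (s + t j.+1))//.
apply/setP => v; rewrite !inE /slice /=.
have := t_gt0 j.+1; have := tS j => h1 h2.
by rewrite !minEle; case: (leP (n v) (t j)); case: (leP (n v) (t j.+1)) => *;
  apply/idP/idP; lra.
Qed.

Let sum_slope_sq N : \sum_(j < N) slope j ^+ 2 <= r ^+ 2.
Proof.
have sl0 j : 0 <= slope j by apply: sumr_ge0.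
have S0 : 0 <= \sum_(j < N) slope j by apply: sumr_ge0.
apply: (@le_trans _ _ ((\sum_(j < N) slope j) ^+ 2)); last first.
  by rewrite lerXn2r ?nnegrE// ?(le_trans S0)// sum_slope.
rewrite expr2 mulr_suml; apply: ler_sum => j _.
by rewrite expr2 ler_wpM2l// (bigD1 j)//= lerDl sumr_ge0.
Qed.

(** The three losses are, in this order: the vertices below the last threshold, of squared norm at
    most [t (J+1) ^ 2]; the draws, whose cost [t_j^2 4^j / eps] is the same on every shell; and the
    cuts. *)
Lemma multiscale_energy :
  T%:R / 512 * (\sum_l \sum_a f l a ^+ 2 - m%:R * (4 * W ^+ 2 / 4 ^+ J.+1)) -
    8 * J.+1%:R * W ^+ 2 * lam / eps - 160 * mu ^+ 2 * r ^+ 2 * lam <=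
  \sum_l qform X l (f l).
Proof.
have T0 : 0 <= T%:R / 512 :> R := divr_ge0 (ler0n R T) (ler0n R 512).
have [s hs] := thresholds.
have st j : s j.+1 < s j.
  have [/andP[h1 _] _] := hs j; have [/andP[_ h2] _] := hs j.+1; exact: lt_le_trans h2 h1.
pose L j : {set 'I_m} := (above (s j.+1) :\: above (s j))%SET.
have inL j l : (l \in L j)%:R = (l \in above (s j.+1))%:R - (l \in above (s j))%:R :> R.
  rewrite !inE; case: (ltP (s j) (n l)) => h1; first by rewrite (lt_trans (st j))// subrr.
  by rewrite subr0.
have tel N l : \sum_(j < N) (l \in L j)%:R = (l \in above (s N))%:R :> R.
  elim: N => [|N IH].
    rewrite big_ord0 inE ltNge (_ : n l <= s 0%N)//.
    have [/andP[h1 _] _] := hs 0%N; apply: le_trans h1; rewrite (le_trans (n_le l))//.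
    by rewrite /t expr1; lra.
  by rewrite big_ord_recr /= IH inL addrC subrK.
have sumL (F : 'I_m -> R) N : \sum_(j < N) \sum_(l in L j) F l =
  \sum_(l in above (s N)) F l.
  rewrite [RHS]big_mkcond /=.
  under eq_bigr do rewrite big_mkcond.
  rewrite exchange_big; apply: eq_bigr => l _ /=.
  rewrite -mulrb -mulr_natr -tel mulr_sumr.
  by apply: eq_bigr => j _; rewrite -mulrb mulr_natr.
have e1 : \sum_(j < J.+1) \sum_(l in L j) qform X l (f l) <= \sum_l qform X l (f l).
  rewrite sumL [leRHS](bigID (fun l => l \in above (s J.+1))) /= lerDl sumr_ge0// => l _.
  exact: qform_ge0.
apply: le_trans e1.
have nL j l : l \in L j -> s j.+1 < n l <= s j.
  by rewrite !inE -leNgt andbC.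
have e2 (j : 'I_J.+1) : t j ^+ 2 * (T%:R / 512 * #|L j|%:R -
    ((sample_size j)%:R + 2 * #|edge_cut o (L j)|%:R + 8) * lam) <=
      \sum_(l in L j) qform X l (f l).
  apply: shell_bound; first by rewrite -ltnS.
  move=> l /nL/andP[h1 _]; rewrite -n_sqr.
  have [/andP[h2 _] _] := hs j.+1.
  have h3 : t j = 4 * t j.+2 by rewrite tS tS; ring.
  have := t_gt0 j.+2; rewrite h3 => h4; nra.
apply: le_trans (ler_sum _ (fun j _ => e2 j)).
have e3 : \sum_l \sum_a f l a ^+ 2 - m%:R * (4 * W ^+ 2 / 4 ^+ J.+1) <=
    \sum_(j < J.+1) t j ^+ 2 * #|L j|%:R.
  apply: (@le_trans _ _ (\sum_(j < J.+1) \sum_(l in L j) n l ^+ 2)); last first.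
    apply: ler_sum => j _; rewrite -sum1_card natr_sum mulr_sumr.
    apply: ler_sum => l /nL/andP[_ h1]; rewrite mulr1.
    have [/andP[_ h2] _] := hs j.
    by rewrite lerXn2r ?nnegrE// ?(ltW (t_gt0 _))// (le_trans h1)// ltW.
  rewrite sumL lerBlDr (eq_bigr (fun l => n l ^+ 2)) => [|l _]; last by rewrite n_sqr.
  rewrite [leLHS](bigID (fun l => l \in above (s J.+1))) /= lerD2l.
  apply: (@le_trans _ _ (\sum_(l | l \notin above (s J.+1)) t J.+1 ^+ 2)).
    apply: ler_sum => l; rewrite inE -leNgt => h1.
    have [/andP[_ h2] _] := hs J.+1.
    by rewrite lerXn2r ?nnegrE// ?(ltW (t_gt0 _))// (le_trans h1)// ltW.
  have -> : 4 * W ^+ 2 / 4 ^+ J.+1 = t J.+1 ^+ 2.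
    by rewrite -(t_sqr J.+1) mulfK// expf_neq0// pnatr_eq0.
  rewrite sumr_const -[X in X <= _]mulr_natl ler_wpM2r ?sqr_ge0// ler_nat.
  by rewrite (leq_trans (max_card _))// card_ord.
(* Isoperimetry gives [N <= 4 mu^2 N^2] for the size [N] of the cut, and [t_j^2 = 4 t_(j+1)^2]; this
   is where the linear cost of a cut becomes quadratic in the slope. *)
have cutb j : t j ^+ 2 * #|edge_cut o (above (s j))|%:R <= 16 * mu ^+ 2 * slope j ^+ 2.
  have [_ h1] := hs j; have := t_gt0 j.+1; rewrite (tS j); move: h1.
  have sl0 : 0 <= slope j by apply: sumr_ge0.
  have [c0|c0] := eqVneq (edge_cut o (above (s j))) finset.set0.
    move=> _ _; rewrite c0 cards0 mulr0; apply: mulr_ge0; last exact: sqr_ge0.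
    by rewrite mulr_ge0// sqr_ge0.
  have := iso c0; move: (#|_|%:R : R) (ler0n R #|edge_cut o (above (s j))|)
    (t j.+1) => N N0 z h2 h3 z0.
  have Nz : 0 <= N * z by rewrite mulr_ge0// ltW.
  have h4 : (N * z) ^+ 2 <= slope j ^+ 2 by rewrite lerXn2r ?nnegrE.
  apply: (@le_trans _ _ (16 * mu ^+ 2 * (N * z) ^+ 2)); last first.
    by rewrite ler_wpM2l// mulr_ge0// sqr_ge0.
  have := ler_wpM2r (mulr_ge0 N0 (sqr_ge0 z)) h2; nra.
(* A shell is bounded by the cuts at both its thresholds. The lower one is controlled at scale
   [t (j+1)], which costs a further factor 4: [32 = 2 . 16] and [128 = 4 . 32], with sum 160. *)
have e4 (j : 'I_J.+1) : t j ^+ 2 * (((sample_size j)%:R + 2 * #|edge_cut o (L j)|%:R +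
  8) * lam) <=
    8 * W ^+ 2 * lam / eps + lam * (32 * mu ^+ 2 * slope j ^+ 2 +
      128 * mu ^+ 2 * slope j.+1 ^+ 2).
  have h1 := cutb j; have := cutb j.+1; rewrite -(ler_pM2l (ltr0n R 4)).
  rewrite [X in X <= _](_ : _ = t j ^+ 2 * #|edge_cut o (above (s j.+1))|%:R) => [h2|];
    last first.
    by rewrite (tS j); ring.
  have h3 : #|edge_cut o (L j)|%:R <=
    #|edge_cut o (above (s j.+1))|%:R + #|edge_cut o (above (s j))|%:R :> R.
    by rewrite -natrD ler_nat cut_diff.
  have h4 : t j ^+ 2 * ((sample_size j)%:R + 8) <= 8 * W ^+ 2 / eps.
    have b1 : (sample_size j)%:R <= 4 ^+ j / eps + 1 :> R.
      by rewrite /sample_size -natr1 lerD2r truncn_le divr_ge0// ltW.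
    have b2 : 9 <= 4 ^+ j / eps.
      have : 64 <= eps^-1 by rewrite -[64]invrK lef_pV2// posrE.
      have : 1 <= 4 ^+ j :> R by rewrite exprn_ege1// ler1n.
      nra.
    apply: (@le_trans _ _ (t j ^+ 2 * (2 * (4 ^+ j / eps)))).
      by rewrite ler_wpM2l ?sqr_ge0//; lra.
    rewrite [leLHS](_ : _ = 2 * (t j ^+ 2 * 4 ^+ j) / eps); last by ring.
    by rewrite t_sqr mulrA -natrM.
  have h5 := ler_wpM2l (sqr_ge0 (t j)) h3.
  rewrite mulrA [leRHS](_ : _ = (8 * W ^+ 2 / eps + (32 * mu ^+ 2 * slope j ^+ 2 +
    128 * mu ^+ 2 * slope j.+1 ^+ 2)) * lam).
    rewrite ler_wpM2r//; lra.
  by ring.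
rewrite (eq_bigr (fun j : 'I_J.+1 => T%:R / 512 * (t j ^+ 2 * #|L j|%:R) - t j ^+ 2 *
  (((sample_size j)%:R + 2 * #|edge_cut o (L j)|%:R + 8) * lam))) => [|j _]; last by ring.
rewrite sumrB -mulr_sumr.
have e6 : \sum_(j < J.+1) (8 * W ^+ 2 * lam / eps + lam * (32 * mu ^+ 2 * slope j ^+ 2 +
  128 * mu ^+ 2 * slope j.+1 ^+ 2)) <=
    8 * J.+1%:R * W ^+ 2 * lam / eps + 160 * mu ^+ 2 * r ^+ 2 * lam.
  rewrite big_split /= sumr_const card_ord -mulr_sumr big_split /= -!mulr_sumr.
  have g1 := sum_slope_sq J.+1.
  have g2 : \sum_(j < J.+1) slope j.+1 ^+ 2 <= r ^+ 2.
    apply: le_trans (sum_slope_sq J.+2); rewrite [leRHS]big_ord_recl /= lerDr sqr_ge0//.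
  have ml : 0 <= lam * mu ^+ 2 by rewrite mulr_ge0// sqr_ge0.
  have := ler_wpM2l ml g1; have := ler_wpM2l ml g2; rewrite -[_ *+ J.+1]mulr_natl; nra.
have e7 := ler_wpM2l T0 e3.
have e8 : \sum_(j < J.+1) t j ^+ 2 * (((sample_size j)%:R + 2 * #|edge_cut o (L j)|%:R +
  8) * lam) <=
    8 * J.+1%:R * W ^+ 2 * lam / eps + 160 * mu ^+ 2 * r ^+ 2 * lam.
  by apply: le_trans e6; apply: ler_sum => j _; exact: e4.
lra.
Qed.

End multiscale.

(** * The restricted eigenvalue inequality *)

Section signed_part.
Context {R : realType}.

(** The negative part for [s = true], the positive part for [s = false]. The sign goes into the
    atom, so that the weights are nonnegative. *)
Definition signed_part (s : bool) (x : R) : R := if s == (x < 0) then `|x| else 0.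

Lemma signed_part_ge0 s x : 0 <= signed_part s x.
Proof. by rewrite /signed_part; case: ifP. Qed.

Lemma signed_part_sum x : \sum_s signed_part s x = `|x|.
Proof.
by rewrite big_bool /signed_part; case: (x < 0); rewrite /= ?add0r ?addr0.
Qed.

Lemma signed_part_sign x : \sum_(s : bool) signed_part s x * (-1) ^+ s = x.
Proof.
rewrite big_bool /signed_part; case: ltP => x0 /=; rewrite mul0r ?addr0 ?add0r.
  by rewrite ltr0_norm// expr1 mulrN1 opprK.
by rewrite ger0_norm// expr0 mulr1.
Qed.

End signed_part.

Lemma expR1_le4 (R : realType) : expR 1 <= 4 :> R.
Proof.
have h : 2^-1 <= expR (- 2^-1) :> R.
  by apply: le_trans (expR_ge1Dx _); lra.
have e : expR (- 2^-1) * expR (- 2^-1) * expR 1 = 1 :> R.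
  by rewrite -!expRD -[RHS]expR0; congr expR; field.
have h2 : 0 <= expR (- 2^-1) * expR (- 2^-1) - 4^-1 :> R by nra.
have := mulr_ge0 h2 (expR_ge0 (1 : R)); rewrite mulrBl e; lra.
Qed.

(** * Atoms from the columns of the pseudoinverse *)

Section atoms.
Context {R : realType} (m p d : nat) (o : 'I_p -> 'I_m * 'I_m)
  (P : 'M[R]_(m, p)).
Hypothesis hconn : forall i j, connect (joined o) i j.
Hypothesis m0 : (0 < m)%N.
Hypothesis hpinv : is_pinv (incidence R o) P.
Local Notation mu := (max_row_norm P).
Local Notation M := (2 * mu ^+ 2).

(* [None] is a null atom, and [Some (s, e, b)] is the column e of P divided by
   its largest possible entry (or a constant, when e is [None]), placed in the
   coordinate b with sign s. *)
Definition atom : finType := option (bool * option 'I_p * 'I_d).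

Definition atom_profile (e : option 'I_p) (l : 'I_m) : R :=
  if e is Some k then P l k / M else 1.

Definition atom_val (x : atom) (l : 'I_m) (a : 'I_d) : R :=
  if x is Some (s, e, b) then
    if a == b then (-1) ^+ (s : bool) * atom_profile e l else 0
  else 0.

Lemma atom_profile_sqr e l : atom_profile e l ^+ 2 <= 1.
Proof.
case: e => [k|] /=; last by rewrite expr1n.
have h := pinv_entry_le hpinv l k.
have [M0|Mn0] := eqVneq M 0; first by rewrite M0 invr0 mulr0 expr0n.
have Mp : 0 < M by rewrite lt0r Mn0 mulr_ge0// sqr_ge0.
rewrite -real_normK ?num_real// expr_le1// normrM normfV (gtr0_norm Mp).
by rewrite ler_pdivrMr// mul1r.
Qed.

Lemma atom_val_le1 x l : \sum_a atom_val x l a ^+ 2 <= 1.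
Proof.
case: x => [[[s e] b]|] /=; last by rewrite big1// => a _; rewrite expr0n.
rewrite (bigD1 b)//= eqxx big1 ?addr0; last by move=> a /negbTE ->; rewrite expr0n.
by rewrite exprMn sqrr_sign mul1r atom_profile_sqr.
Qed.

(** An atom lives on one coordinate with profile at most 1, so upper bounds for the [d] coordinate
    energies control all atoms at once. *)
Lemma qform_atom T (X : 'I_m -> 'I_T -> 'I_d -> R) s e b l :
  qform X l (atom_val (Some (s, e, b)) l) <= \sum_t X l t b ^+ 2.
Proof.
apply: ler_sum => t _.
rewrite (bigD1 b)//= eqxx big1 ?addr0; last by move=> a /negbTE ->; rewrite mul0r.
rewrite !exprMn sqrr_sign mul1r ler_piMl ?sqr_ge0//; exact: atom_profile_sqr.
Qed.

Variable f : 'I_m -> 'I_d -> R.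

Let jump k b := f (o k).1 b - f (o k).2 b.
Let mean b := m%:R^-1 * \sum_l f l b.

Definition atom_weight (x : atom) : R :=
  if x is Some (s, e, b) then
    if e is Some k then M * signed_part s (jump k b) else signed_part s (mean b)
  else 0.

Lemma atom_weight_ge0 x : 0 <= atom_weight x.
Proof.
case: x => [[[s [k|]] b]|] //=; last exact: signed_part_ge0.
by rewrite mulr_ge0 ?signed_part_ge0// mulr_ge0// sqr_ge0.
Qed.

Lemma sum_atom (F : atom -> R) : \sum_x F x = F None +
  (\sum_b \sum_s F (Some (s, None, b)) +
   \sum_b \sum_k \sum_s F (Some (s, Some k, b))).
Proof.
have opt (U : finType) (G : option U -> R) : \sum_x G x = G None + \sum_u G (Some u).
  rewrite (bigD1 None)//=; congr (_ + _).
  rewrite (reindex_omap (fun u : U => Some u) id)/=; last by case.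
  by apply: eq_bigl => u; rewrite eqxx.
rewrite opt; congr (_ + _).
transitivity (\sum_(u : (bool * option 'I_p) * 'I_d) F (Some (u.1, u.2))).
  by apply: eq_bigr => -[].
rewrite -(pair_bigA _ (fun se b => F (Some (se, b)))) /=.
transitivity (\sum_(u : bool * option 'I_p) \sum_b F (Some (u.1, u.2, b))).
  by apply: eq_bigr => -[].
rewrite -(pair_bigA _ (fun s e => \sum_b F (Some (s, e, b)))) /=.
under eq_bigr do rewrite opt.
rewrite big_split /=; congr (_ + _); first by rewrite exchange_big.
rewrite exchange_big /=; under eq_bigr do rewrite exchange_big.
rewrite exchange_big /=; apply: eq_bigr => b _; apply: eq_bigr => k _.
by [].
Qed.

Lemma atom_decomp l a : f l a = \sum_x atom_weight x * atom_val x l a.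
Proof.
rewrite sum_atom /= mulr0 add0r.
rewrite (bigD1 a)//= [X in _ + X + _]big1 ?addr0; last first.
  by move=> b ba; rewrite big1// => s _; rewrite eq_sym (negbTE ba) mulr0.
rewrite (bigD1 (F := fun b => \sum_k _) a)//= [X in _ + (_ + X)]big1 ?addr0; last first.
  by move=> b ba; rewrite big1// => k _; rewrite big1// => s _;
    rewrite eq_sym (negbTE ba) mulr0.
rewrite eqxx [LHS](pinv_decomp hconn m0 hpinv (fun l => f l a)); congr (_ + _).
  by under [RHS]eq_bigr do rewrite mulr1; rewrite signed_part_sign.
apply: eq_bigr => k _; rewrite -/(jump k a).
transitivity (M * (P l k / M) * \sum_(s : bool) signed_part s (jump k a) * (-1) ^+ s).
  rewrite signed_part_sign; congr (_ * _).
  (* If [M = 0] the division returns 0, and [P] vanishes as well by the entry bound. *)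
  have [M0|Mn0] := eqVneq M 0; last by rewrite mulrC divfK.
  have := pinv_entry_le hpinv l k; rewrite M0 normr_le0 => /eqP ->.
  by rewrite !mul0r.
by rewrite mulr_sumr; apply: eq_bigr => s _; ring.
Qed.

(** Each jump has weight [M] times its absolute value, since the atoms are divided by [M]. The mean
    is measured in the sum of absolute values over [d] coordinates, and two uses of Cauchy-Schwarz
    give [sqrt (d / m) |f|]. *)
Lemma atom_weight_sum : \sum_x atom_weight x <=
  M * (\sum_k \sum_b `|jump k b|) + Num.sqrt (d%:R / m%:R * \sum_l \sum_a f l a ^+ 2).
Proof.
have mp : 0 < m%:R :> R by rewrite ltr0n.
rewrite sum_atom /= add0r addrC; apply: lerD.
  rewrite exchange_big /= mulr_sumr; apply: ler_sum => k _.
  rewrite mulr_sumr; apply: ler_sum => b _.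
  by rewrite -mulr_sumr signed_part_sum.
under eq_bigr do rewrite signed_part_sum.
rewrite -[leLHS]ger0_norm ?sumr_ge0// -sqrtr_sqr ler_sqrt; last first.
  rewrite mulr_ge0 ?divr_ge0//; apply: sumr_ge0 => l _; apply: sumr_ge0 => a _.
  exact: sqr_ge0.
have h1 : (\sum_b `|mean b|) ^+ 2 <= d%:R * \sum_b mean b ^+ 2.
  have := cauchy_schwarz_sum (fun b => `|mean b|) (fun=> 1 : R).
  under eq_bigr do rewrite mulr1.
  under [X in _ <= X * _ -> _]eq_bigr do rewrite real_normK ?num_real//.
  under [X in _ <= _ * X -> _]eq_bigr do rewrite expr1n.
  by rewrite sumr_const card_ord mulrC.
apply: (le_trans h1); rewrite -mulrA ler_wpM2l//.
rewrite exchange_big /= mulr_sumr; apply: ler_sum => b _.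
have := cauchy_schwarz_sum (fun l => f l b) (fun=> 1 : R).
under [X in X ^+ 2 <= _ -> _]eq_bigr do rewrite mulr1.
under [X in _ <= _ * X -> _]eq_bigr do rewrite expr1n.
rewrite sumr_const card_ord /mean exprMn => h2.
by rewrite expr2 -mulrA ler_pM2l ?invr_gt0// ler_pdivrMl// mulrC.
Qed.

End atoms.

Definition jumps (R : realType) m p d (o : 'I_p -> 'I_m * 'I_m)
    (f : 'I_m -> 'I_d -> R) : R :=
  \sum_k \sum_a `|f (o k).1 a - f (o k).2 a|.

Lemma qform_homogeneous (R : realType) m p d T (o : 'I_p -> 'I_m * 'I_m)
    (X : 'I_m -> 'I_T -> 'I_d -> R) (c0 c1 : R) : 0 <= c0 -> 0 <= c1 ->
  (forall f, \sum_l \sum_a f l a ^+ 2 = 1 -> c1 * jumps o f ^+ 2 <= 1 ->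
     c0 <= \sum_l qform X l (f l)) ->
  forall f, c0 * (\sum_l \sum_a f l a ^+ 2 - c1 * jumps o f ^+ 2) <=
     \sum_l qform X l (f l).
Proof.
move=> c00 c10 unit_case f.
set N := \sum_l _; set r := jumps o f.
have q0 : 0 <= \sum_l qform X l (f l) by apply: sumr_ge0 => l _; exact: qform_ge0.
have [h|h] := leP N (c1 * r ^+ 2).
  by apply: le_trans q0; rewrite mulr_ge0_le0// subr_le0.
have h0 : 0 <= c1 * r ^+ 2 by rewrite mulr_ge0// sqr_ge0.
have N0 : 0 < N by exact: le_lt_trans h.
pose n := Num.sqrt N.
have n0 : 0 < n by rewrite sqrtr_gt0.
have n2 : n ^+ 2 = N by rewrite sqr_sqrtr// ltW.
pose g l a := n^-1 * f l a.
have g1 : \sum_l \sum_a g l a ^+ 2 = 1.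
  rewrite /g; under eq_bigr do under eq_bigr do rewrite exprMn.
  under eq_bigr do rewrite -mulr_sumr.
  by rewrite -mulr_sumr -/N -n2 exprVn mulVf// gt_eqF// exprn_gt0.
have gr : jumps o g = n^-1 * r.
  rewrite /r mulr_sumr; apply: eq_bigr => k _; rewrite mulr_sumr.
  by apply: eq_bigr => a _; rewrite /g -mulrBr normrM gtr0_norm ?invr_gt0.
have gq : \sum_l qform X l (g l) = N^-1 * \sum_l qform X l (f l).
  rewrite mulr_sumr; apply: eq_bigr => l _.
  by rewrite (qformZ X l n^-1 (f l)) exprVn n2.
have := unit_case g g1; rewrite gr gq exprMn exprVn n2.
have -> : c1 * (N^-1 * r ^+ 2) = (c1 * r ^+ 2) / N by ring.
rewrite ler_pdivrMr// mul1r => /(_ (ltW h)).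
rewrite mulrC ler_pdivlMr// => h2; apply: le_trans h2.
by rewrite ler_wpM2l// gerBl.
Qed.

Section restricted_eigenvalue.
Context {R : realType} (m p d T : nat) (o : 'I_p -> 'I_m * 'I_m)
  (P : 'M[R]_(m, p)) (X : 'I_m -> 'I_T -> 'I_d -> R) (Delta lam ell : R).
Hypothesis hconn : forall i j, connect (joined o) i j.
Hypothesis m0 : (0 < m)%N.
Hypothesis d0 : (0 < d)%N.
Hypothesis hpinv : is_pinv (incidence R o) P.
Local Notation mu := (max_row_norm P).
(** Chosen so that [(1024 * eps)^-1 = 16 / Delta], the constant in the tail bound for coordinate
    energies. *)
Local Notation eps := (Delta / 16 / 1024).
Hypothesis D0 : 0 < Delta.
Hypothesis D1 : Delta <= 1.
Hypothesis lam1 : 1 <= lam.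
Hypothesis ell1 : 1 <= ell.
Hypothesis mulam : mu ^+ 2 * lam <= 1.
Hypothesis hT : 1024 * 1024 * 1024 * 16 * ell ^+ 2 / Delta <= T%:R.
Hypothesis dm : d%:R <= m%:R :> R.
Hypothesis dlam : d%:R * lam ^+ 2 <= m%:R * ell ^+ 2.
Hypothesis mlam : 80 * m%:R <= expR lam.
Hypothesis lower : forall j (L : {set 'I_m}) (s : seq (atom p d)),
  (j <= Num.truncn lam)%N -> size s = sample_size eps j ->
  T%:R / 4 * (\sum_(l in L)
      Num.min (4 ^+ j * \sum_a amean (atom_val P) (sample_size eps j) s l a ^+ 2) 1) -
    ((sample_size eps j)%:R + #|edge_cut o L|%:R + 4) * lam <=
  \sum_(l in L) 4 ^+ j * qform X l (amean (atom_val P) (sample_size eps j) s l).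
Hypothesis upper : forall (L : {set 'I_m}) b, \sum_(l in L) \sum_t X l t b ^+ 2 <=
  (1024 * eps)^-1 * (T%:R / 2 * #|L|%:R + (#|edge_cut o L|%:R + 4) * lam).

(** About [lam] shells are used, so the draws cost a multiple of [lam^2 W^2 / eps]. With [r] the
    jumps of [f], the hypotheses make both parts of [W^2] affordable: [(mu^2 r)^2 lam^2 <= 1] and
    [(d / m) lam^2 <= ell^2]. *)
Let unit_case (f : 'I_m -> 'I_d -> R) : \sum_l \sum_a f l a ^+ 2 = 1 ->
  mu ^+ 2 * lam * jumps o f ^+ 2 <= 1 -> T%:R / 1024 / 2 <= \sum_l qform X l (f l).
Proof.
move=> f1 hr; set r := jumps o f in hr.
have mp : 0 < m%:R :> R by rewrite ltr0n.
have r0 : 0 <= r by apply: sumr_ge0 => k _; apply: sumr_ge0.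
have l0 : 0 <= lam by rewrite (le_trans _ lam1).
pose J := Num.truncn lam.
have J1 : lam <= J.+1%:R by rewrite ltW// truncnS_gt.
have J2 : J.+1%:R <= 2 * lam.
  have : J%:R <= lam by rewrite truncn_le.
  by rewrite -natr1; move: lam1 => ?; lra.
set dm' := d%:R / m%:R : R.
have dm0 : 0 < dm' by rewrite divr_gt0// ltr0n.
pose W := 2 * mu ^+ 2 * r + Num.sqrt dm'.
have W0 : 0 < W.
  by rewrite ltr_wpDl ?sqrtr_gt0// mulr_ge0// mulr_ge0// sqr_ge0.
have W2 : W ^+ 2 <= 2 * (4 * (mu ^+ 2 * r) ^+ 2 + dm').
  have := sqr_sqrtr (ltW dm0); rewrite /W; rewrite -mulrA;
    move: (Num.sqrt dm') (mu ^+ 2 * r) => a b ab.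
  have := sqr_ge0 (2 * b - a); nra.
have b1 : (mu ^+ 2 * r) ^+ 2 * lam ^+ 2 <= 1.
  have h1 : 0 <= mu ^+ 2 * lam by rewrite mulr_ge0// sqr_ge0.
  have h2 : 0 <= mu ^+ 2 * lam * r ^+ 2 by rewrite mulr_ge0// sqr_ge0.
  have := ler_pM h1 h2 mulam hr; rewrite mulr1.
  by rewrite (_ : mu ^+ 2 * lam * (mu ^+ 2 * lam * r ^+ 2) =
    (mu ^+ 2 * r) ^+ 2 * lam ^+ 2)//; ring.
have b2 : dm' * lam ^+ 2 <= ell ^+ 2.
  by rewrite /dm' mulrAC ler_pdivrMr// [leRHS]mulrC.
have b3 : dm' <= 1 by rewrite ler_pdivrMr// mul1r.
have e1 : 1 <= ell ^+ 2 by rewrite exprn_ege1.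
have l2 : 1 <= lam ^+ 2 by rewrite exprn_ege1.
have c1 : W ^+ 2 <= 10.
  have := sqr_ge0 (mu ^+ 2 * r); nra.
have c2 : J.+1%:R * W ^+ 2 * lam <= 20 * ell ^+ 2.
  have : J.+1%:R * W ^+ 2 * lam <= 2 * lam * W ^+ 2 * lam.
    by rewrite ler_wpM2r// ler_wpM2r// sqr_ge0.
  have := ler_wpM2r (sqr_ge0 lam) W2; nra.
(* The number of shells is just enough for [4 ^ (J+1) >= exp lam >= 80 m], so that with [W^2 <= 10]
   the vertices below the last threshold carry at most half of the squared norm. *)
have c3 : 4 * W ^+ 2 / 4 ^+ J.+1 * m%:R <= 2^-1.
  have h1 : expR lam <= 4 ^+ J.+1.
    apply: (@le_trans _ _ (expR J.+1%:R)); first by rewrite ler_expR.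
    rewrite -[J.+1%:R]mulr1 mulrC expRM_natr lerXn2r ?nnegrE ?expR_ge0//.
    exact: expR1_le4.
  have h2 : 0 < 4 ^+ J.+1 :> R by rewrite exprn_gt0.
  rewrite mulrAC ler_pdivrMr//.
  have := le_trans mlam h1; nra.
have ee0 : 0 < eps by apply: divr_gt0 (ltr0n R 1024); exact: divr_gt0 D0 (ltr0n R 16).
have ee1 : eps <= 64^-1 by move: D1 => D1'; lra.
have wW : \sum_x atom_weight o P f x <= W.
  by have := atom_weight_sum o P m0 f; rewrite f1 mulr1.
have := @multiscale_energy R m p d T _ X o (atom_val P)
  (atom_weight o P f) None f W eps lam mu J
  (atom_val_le1 hpinv) (fun _ _ => erefl) (atom_weight_ge0 _ _ _) wW W0
  (atom_decomp hconn m0 hpinv f) ee0 ee1 l0 (cut_isoperimetry hconn m0 hpinv) lower.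
rewrite -/(jumps o f) -/r f1 => H.
apply: le_trans (H _); last first.
  move=> L [[[s e] b]|] /=.
    by apply: le_trans (upper L b); apply: ler_sum => l _; exact: (qform_atom hpinv).
  rewrite big1; last first.
    move=> l _; rewrite /qform big1// => t _; rewrite big1 ?expr0n// => a _.
    by rewrite mul0r.
  have b0 : 0 <= (1024 * eps)^-1.
    by rewrite invr_ge0; exact: mulr_ge0 (ler0n R 1024) (ltW ee0).
  apply: mulr_ge0 b0 _; apply: addr_ge0.
    exact: mulr_ge0 (divr_ge0 (ler0n R T) (ler0n R 2)) (ler0n R _).
  exact: mulr_ge0 (addr_ge0 (ler0n R _) (ler0n R 4)) l0.
(* The left side is at most [160 ell^2 / eps = 160 . 2^14 ell^2 / Delta]; requiring it to be at most
   [T / 2^12] is the origin of the constant [2^34] in [hT]. *)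
have T1 : 8 * J.+1%:R * W ^+ 2 * lam / eps <= T%:R / 1024 / 4.
  rewrite (ler_pdivrMr _ _ ee0); move: hT; rewrite (ler_pdivrMr _ _ D0) => hT'; lra.
have T2 : 160 * mu ^+ 2 * r ^+ 2 * lam <= T%:R / 1024 / 4.
  have := ler_piMr (ler0n R T) D1.
  move: hT; rewrite (ler_pdivrMr _ _ D0); lra.
have T0 : 0 <= T%:R :> R := ler0n R T.
have : T%:R / 512 * (1 - m%:R * (4 * W ^+ 2 / 4 ^+ J.+1)) >= T%:R / 1024.
  nra.
lra.
Qed.

Lemma restricted_eigenvalue (f : 'I_m -> 'I_d -> R) :
  T%:R / 1024 / 2 * (\sum_l \sum_a f l a ^+ 2 - mu ^+ 2 * lam * jumps o f ^+ 2) <=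
  \sum_l qform X l (f l).
Proof.
apply: qform_homogeneous unit_case f.
  exact: (divr_ge0 (divr_ge0 (ler0n R T) (ler0n R 1024)) (ler0n R 2)).
by rewrite mulr_ge0 ?sqr_ge0// (le_trans _ lam1).
Qed.

End restricted_eigenvalue.

(** * The good event *)

Section with_probability.
Context {R : realType} (disp : measure_display) (Omega : measurableType disp)
  (P : probability Omega R).
Implicit Types (A B : set Omega) (e : R).

Lemma with_prob_mono (e e' : R) A B : e' <= e -> A `<=` B ->
  with_prob_at_least P e A -> with_prob_at_least P e' B.
Proof.
move=> ee AB [E [mE EA PE]]; exists E; split => //; first exact: subset_trans EA AB.
by apply: le_trans PE; rewrite lee_fin.
Qed.

Lemma with_prob_setC (e : R) A : measurable A -> (P A <= e%:E)%E ->
  with_prob_at_least P (1 - e) (~` A).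
Proof.
move=> mA PA; exists (~` A); split => //; first exact: measurableC.
rewrite probability_setC// EFinB; exact: leeB.
Qed.

Lemma with_prob_lt (Y : Omega -> R) (a e : R) : measurable_fun setT Y ->
  (P [set w | (a <= Y w)%R] <= e%:E)%E ->
  with_prob_at_least P (1 - e) [set w | Y w < a].
Proof.
move=> mY h; have mA : measurable [set w | (a <= Y w)%R].
  rewrite -[X in measurable X]setTI (_ : [set w | _] = Y @^-1` `[a, +oo[).
    exact: mY.
  by apply/seteqP; split => w /=; rewrite in_itv /= andbT.
apply: with_prob_mono (with_prob_setC mA h) => // w /=.
by move/negP; rewrite -ltNge.
Qed.

Lemma with_probI (a b : R) A B : with_prob_at_least P (1 - a) A ->
  with_prob_at_least P (1 - b) B -> with_prob_at_least P (1 - (a + b)) (A `&` B).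
Proof.
move=> [E [mE EA PE]] [F [mF FB PF]]; exists (E `&` F); split.
- exact: measurableI.
- by move=> w [/EA ? /FB ?].
have mU : measurable (~` E `|` ~` F) by apply: measurableU; exact: measurableC.
have -> : E `&` F = ~` (~` E `|` ~` F) by rewrite setCU !setCK.
rewrite probability_setC//.
have hc X r : measurable X -> ((1 - r)%:E <= P X -> P (~` X) <= r%:E)%E.
  move=> mX; rewrite probability_setC//.
  by rewrite -(fineK (fin_num_measure P X mX)) -EFinB !lee_fin; lra.
have h : (P (~` E `|` ~` F) <= (a + b)%:E)%E.
  apply: le_trans (measureU2 _ _ _) _; try exact: measurableC.
  by rewrite EFinD; apply: leeD; apply: hc.
by rewrite EFinB; apply: leeB.
Qed.

Lemma with_prob_forall (I : finType) (e : I -> R) (A : I -> set Omega) :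
  (forall i, with_prob_at_least P (1 - e i) (A i)) ->
  with_prob_at_least P (1 - \sum_i e i) [set w | forall i, A i w].
Proof.
move=> h.
have H (s : seq I) : with_prob_at_least P (1 - \sum_(i <- s) e i)
    [set w | forall i, i \in s -> A i w].
  elim: s => [|i s IH].
    rewrite big_nil subr0; exists setT; split => //.
    by rewrite probability_setT.
  rewrite big_cons; apply: with_prob_mono (with_probI (h i) IH) => // w [/= Ai As] j.
  by rewrite inE => /orP[/eqP ->//|]; exact: As.
apply: with_prob_mono (H (index_enum I)) => // w /= Aw i.
by apply: Aw; rewrite mem_index_enum.
Qed.

End with_probability.

Section good_event.
Context {R : realType} (m p d T : nat) (o : 'I_p -> 'I_m * 'I_m)
  (D : 'M[R]_(m, p)).
Context (disp : measure_display) (Omega : measurableType disp)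
  (P : probability Omega R).
Variable eta : 'I_m -> nat -> {RV P >-> d.-tuple R}.
Hypothesis hgauss : forall (l : 'I_m) (t : 'I_T.+1),
  std_gaussian_vector (eta l t.+1).
Hypothesis hindep : mutually_independent
  (fun lt : 'I_m * 'I_T.+1 => eta lt.1 lt.2.+1).
Variable A : 'I_m -> 'M[R]_d.
Variables (rho lam delta : R).
Hypothesis hA : forall l, spectral_norm (A l) <= rho.
Hypothesis hrho : rho < 1.
Hypothesis hrho0 : 0 <= rho.
Hypothesis hconn : forall i j, connect (joined o) i j.
Hypothesis m0 : (0 < m)%N.
Hypothesis p0 : (0 < p)%N.
Hypothesis d0 : (0 < d)%N.
Hypothesis T0 : (0 < T)%N.
Hypothesis lam1 : 1 <= lam.
Hypothesis hlam : p%:R * d%:R * expR (- lam) = delta.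
Hypothesis delta0 : 0 < delta.
Hypothesis delta1 : delta <= 160^-1.
Local Notation Delta := ((1 - rho) ^+ 2).
Local Notation eps := (Delta / 16 / 1024).
Local Notation nz w := ((noise (T := T) eta)^~ w).
Local Notation J := (Num.truncn lam).

Let x := expR (- lam).

Let x_gt0 : 0 < x. Proof. exact: expR_gt0. Qed.

Let p1 : 1 <= p%:R :> R. Proof. by rewrite ler1n. Qed.

Let d1 : 1 <= d%:R :> R. Proof. by rewrite ler1n. Qed.

Let x_le : x <= delta.
Proof.
rewrite -hlam -/x ler_peMl ?(ltW x_gt0)//.
by move: p1 d1; move: (p%:R : R) (d%:R : R) => a b a1 b1; nra.
Qed.

Let dx_le : d%:R * x <= delta.
Proof.
rewrite -hlam -/x -mulrA ler_peMl// mulr_ge0//; exact: ltW.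
Qed.

Let cube : 8 * delta ^+ 3 <= delta / 6.
Proof.
have h : delta ^+ 2 <= 160^-1 * 160^-1.
  by rewrite expr2 ler_pM// ?ltW.
rewrite exprS; move: delta0 => h0; nra.
Qed.

(** As [p x <= delta], the factor [(1 + x)^p] is bounded. The extra 4 in the exponent leaves [x^4],
    which pays for the remaining unions: [J + 1 <= 1 / x] shells in one event, [d] coordinates in
    the other. *)
Let sum_cut_le : \sum_(L : {set 'I_m}) expR (- ((#|edge_cut o L|%:R + 4) * lam)) <=
  8 * x ^+ 4.
Proof.
rewrite (eq_bigr (fun L => x ^+ 4 * x ^+ #|edge_cut o L|)) => [|L _]; last first.
  rewrite -exprD addnC /x -expRM_natr; congr expR; rewrite natrD; ring.
rewrite -mulr_sumr mulrC ler_wpM2r ?exprn_ge0 ?(ltW x_gt0)//.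
apply: le_trans (sum_exp_cut_le hconn m0 (ltW x_gt0)) _.
have -> : 8 = 2 * 4 :> R by rewrite -natrM.
rewrite ler_wpM2l//; apply: le_trans (expR1_le4 R).
apply: (@le_trans _ _ (expR x ^+ p)).
  by rewrite lerXn2r ?nnegrE ?expR_ge0 ?addr_ge0 ?(ltW x_gt0)// expR_ge1Dx.
rewrite -expRM_natr ler_expR.
have : x * p%:R <= delta.
  by rewrite -hlam -/x [leRHS]mulrC mulrA ler_peMr// mulr_ge0// ltW.
move: delta1; lra.
Qed.

(** Each draw of an atom is charged [lam] in the deviation, and this pays for the choice of the
    atom: the union over tuples then costs nothing. *)
Let card_atom_le : #|atom p d|%:R * x <= 1.
Proof.
have -> : #|atom p d| = (2 * p.+1 * d).+1.
  by rewrite card_option !card_prod card_bool card_option !card_ord.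
apply: (@le_trans _ _ (5 * delta)); last by move: delta1; lra.
rewrite -hlam -/x mulrA ler_wpM2r ?(ltW x_gt0)//.
rewrite -natr1 !natrM -[p.+1%:R]natr1; move: p1 d1 => h1 h2; nra.
Qed.

Lemma lower_event : with_prob_at_least P (1 - delta / 6)
  [set w | forall (j : 'I_J.+1) (L : {set 'I_m})
    (s : (sample_size eps j).-tuple (atom p d)),
    T%:R / 4 * (\sum_(l in L)
      Num.min (4 ^+ j * \sum_a amean (atom_val D) (sample_size eps j) s l a ^+ 2) 1) -
    ((sample_size eps j)%:R + #|edge_cut o L|%:R + 4) * lam <=
    \sum_(l in L) 4 ^+ j * energy A (nz w) l (amean (atom_val D) (sample_size eps j) s l)].
Proof.
pose e (j : 'I_J.+1) (L : {set 'I_m}) (s : (sample_size eps j).-tuple (atom p d)) :=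
  expR (- (((sample_size eps j)%:R + #|edge_cut o L|%:R + 4) * lam)).
pose S (j : 'I_J.+1) (L : {set 'I_m})
  (s : (sample_size eps j).-tuple (atom p d)) : set Omega :=
  [set w | T%:R / 4 * (\sum_(l in L)
      Num.min (4 ^+ j * \sum_a amean (atom_val D) (sample_size eps j) s l a ^+ 2) 1) -
    ((sample_size eps j)%:R + #|edge_cut o L|%:R + 4) * lam <=
    \sum_(l in L) 4 ^+ j * energy A (nz w) l (amean (atom_val D) (sample_size eps j) s l)].
suff H : with_prob_at_least P (1 - \sum_j \sum_L \sum_s e j L s)
    [set w | forall j L s, S j L s w].
  apply: with_prob_mono H => //.
  rewrite lerD2l lerN2.
  have h j : \sum_L \sum_s e j L s <= 8 * x ^+ 4.
    apply: le_trans sum_cut_le; apply: ler_sum => L _.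
    rewrite sumr_const card_tuple -[leLHS]mulr_natl.
    have -> : expR (- (((sample_size eps j)%:R + #|edge_cut o L|%:R + 4) * lam)) =
        x ^+ sample_size eps j * expR (- ((#|edge_cut o L|%:R + 4) * lam)).
      by rewrite /x -expRM_natr -expRD; congr expR; ring.
    rewrite mulrA ler_piMl ?expR_ge0// natrX -exprMn exprn_ile1//.
    by rewrite mulr_ge0// ltW.
  apply: le_trans (ler_sum _ (fun j _ => h j)) _.
  rewrite sumr_const card_ord -[leLHS]mulr_natl.
  have h1 : J.+1%:R <= x^-1.
    rewrite /x -expRN opprK; apply: le_trans (expR_ge1Dx lam).
    by rewrite -natr1 addrC lerD2l truncn_le (le_trans _ lam1).
  apply: (@le_trans _ _ (x^-1 * (8 * x ^+ 4))).
    by rewrite ler_wpM2r// mulr_ge0// exprn_ge0// ltW.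
  rewrite (_ : x^-1 * (8 * x ^+ 4) = 8 * x ^+ 3); last first.
    by move: x_gt0 => h2; field; rewrite gt_eqF.
  apply: le_trans cube; rewrite ler_wpM2l// lerXn2r ?nnegrE ?(ltW x_gt0)//.
  exact: ltW.
apply: (with_prob_forall (A := fun j => [set w | forall L s, S j L s w])) => j.
apply: (with_prob_forall (A := fun L => [set w | forall s, S j L s w])) => L.
apply: with_prob_forall => s; rewrite /S /e.
set c := (_ + _ + 4) * lam; pose v l := amean (atom_val D) (sample_size eps j) s l.
have h := energy_tail hgauss hindep A L c v (exprn_ge0 j (ler0n R 4)).
pose Y o0 := - \sum_(l in L) 4 ^+ j * energy A (nz o0) l (v l).
have mY : measurable_fun setT Y.
  apply: measurableT_comp => //.
  under eq_fun do rewrite big_mkcond /=.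
  apply: measurable_sum => l; case: (l \in L) => //.
  apply: measurable_funM => //; apply: measurable_energy => i.
  exact: measurable_noise.
pose B := T%:R / 4 * \sum_(l in L) Num.min (4 ^+ j * \sum_a v l a ^+ 2) 1.
apply: (@with_prob_mono _ _ _ _ (1 - expR (- c)) _ [set w | Y w < - (B - c)]) => //.
  by move=> w /=; rewrite ltrN2 => /ltW.
apply: with_prob_lt => //.
rewrite (_ : [set w | _] = [set o0 | (\sum_(l in L) 4 ^+ j * energy A (nz o0) l (v l) <=
  B - c)%R])//.
by apply/seteqP; split => w /=; rewrite lerN2.
Qed.

Lemma upper_event : with_prob_at_least P (1 - delta / 6)
  [set w | forall (b : 'I_d) (L : {set 'I_m}), \sum_(l in L) coord_energy A (nz w) l b <=
    16 / Delta * (T%:R / 2 * #|L|%:R + (#|edge_cut o L|%:R + 4) * lam)].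
Proof.
pose e (b : 'I_d) (L : {set 'I_m}) := expR (- ((#|edge_cut o L|%:R + 4) * lam)).
pose S b (L : {set 'I_m}) : set Omega := [set w | \sum_(l in L) coord_energy A (nz w) l b <=
    16 / Delta * (T%:R / 2 * #|L|%:R + (#|edge_cut o L|%:R + 4) * lam)].
suff H : with_prob_at_least P (1 - \sum_b \sum_L e b L) [set w | forall b L, S b L w].
  apply: with_prob_mono H => //.
  rewrite lerD2l lerN2.
  apply: le_trans (ler_sum _ (fun b _ => sum_cut_le)) _.
  rewrite sumr_const card_ord -[leLHS]mulr_natl.
  rewrite (_ : d%:R * (8 * x ^+ 4) = 8 * ((d%:R * x) * x ^+ 3)); last by ring.
  apply: le_trans cube; rewrite ler_wpM2l//.
  apply: (@le_trans _ _ (delta * delta ^+ 3)).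
    apply: ler_pM => //; rewrite ?mulr_ge0 ?exprn_ge0 ?(ltW x_gt0)//.
    by rewrite lerXn2r ?nnegrE ?(ltW x_gt0)// ltW.
  rewrite ler_piMl ?exprn_ge0 ?(ltW delta0)//; move: delta1; lra.
apply: (with_prob_forall (A := fun b => [set w | forall L, S b L w])) => b.
apply: with_prob_forall => L; rewrite /S /e.
have h := coord_energy_tail hgauss hindep hA hrho hrho0 L ((#|edge_cut o L|%:R +
  4) * lam) b.
apply: (with_prob_mono (lexx _) _ (with_prob_lt _ h)) => [w /= /ltW //|].
under eq_fun do rewrite big_mkcond /=.
apply: measurable_sum => l; case: (l \in L) => //.
by apply: measurable_coord_energy => i; exact: measurable_noise.
Qed.

(** The tail bound is taken at [s = 2 K - 1], and 8 is twice [4 >= exp 1]. The exponent [2 K]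
    provides two factors [exp (- K)], needed for the union over pairs of coordinates and, where
    applicable, edges: the total is of order [delta^2]. *)
Lemma crossterm_event (w : 'I_m -> R) (K : R) (b a : 'I_d) : 1 <= K ->
  \sum_l w l ^+ 2 <= 1 ->
  with_prob_at_least P (1 - 8 * expR (- (2 * K)))
   [set z | `|\sum_l w l * crossterm A (nz z) l b a| <= 16 * K * Num.sqrt (T%:R / Delta)].
Proof.
move=> K1 w1.
have s0 : 0 <= 2 * K - 1 by lra.
have side (v : 'I_m -> R) : \sum_l v l ^+ 2 <= 1 ->
    with_prob_at_least P (1 - 4 * expR (- (2 * K)))
    [set z | \sum_l v l * crossterm A (nz z) l b a < 16 * K * Num.sqrt (T%:R / Delta)].
  move=> v1.
  have h := crossterm_tail hgauss hindep hA hrho hrho0 b a T0 s0 v1.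
  rewrite (_ : 8 * (2 * K - 1 + 1) = 16 * K) in h; last by ring.
  apply: (with_prob_mono _ (@subset_refl _ _) (with_prob_lt _ h)).
    rewrite lerD2l lerN2 opprB expRD ler_wpM2r ?expR_ge0//; exact: expR1_le4.
  apply: measurable_sum => l.
  apply: measurable_funM => //; apply: measurable_crossterm => i.
  exact: measurable_noise.
have hw := side w w1.
have hN := side (fun l => - w l) _.
apply: with_prob_mono (with_probI hw (hN _)).
- by rewrite -mulrDl -natrD.
- move=> z [/= h1 h2]; rewrite ler_norml (ltW h1) andbT lerNl.
  rewrite -sumrN (le_trans _ (ltW h2))//.
  by apply: ler_sum => l _; rewrite mulNr.
- by apply: le_trans w1; apply: ler_sum => l _; rewrite sqrrN.
Qed.

Lemma noise_events (L1 : R) : 1 <= L1 -> d%:R * expR (- L1) <= delta ->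
  with_prob_at_least P (1 - delta / 3)
  [set z | (forall b a, `|\sum_l crossterm A (nz z) l b a| <=
      16 * L1 * Num.sqrt m%:R * Num.sqrt (T%:R / Delta)) /\
    (forall k b a, `|\sum_l D l k * crossterm A (nz z) l b a| <=
      16 * lam * max_col_norm D * Num.sqrt (T%:R / Delta))].
Proof.
move=> L11 hL1; set c := Num.sqrt (T%:R / Delta).
have c0 : 0 <= c by exact: sqrtr_ge0.
have mp : 0 < m%:R :> R by rewrite ltr0n.
have sm : 0 < Num.sqrt m%:R :> R by rewrite sqrtr_gt0.
have sm2 : Num.sqrt m%:R ^+ 2 = m%:R :> R by rewrite sqr_sqrtr// ltW.
have dd : 8 * delta ^+ 2 <= delta / 6.
  rewrite expr2; move: delta0 delta1 => h0 h1; nra.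
have E1 : with_prob_at_least P (1 - delta / 6) [set z | forall b a,
    `|\sum_l crossterm A (nz z) l b a| <= 16 * L1 * Num.sqrt m%:R * c].
  pose S b a : set Omega := [set z |
    `|\sum_l (Num.sqrt m%:R)^-1 * crossterm A (nz z) l b a| <= 16 * L1 * c].
  have H : with_prob_at_least P (1 - \sum_(b < d) \sum_(a < d) 8 * expR (- (2 * L1)))
      [set z | forall b a, S b a z].
    apply: (with_prob_forall (A := fun b => [set z | forall a, S b a z])) => b.
    apply: with_prob_forall => a; apply: crossterm_event => //.
    by rewrite sumr_const card_ord exprVn sm2 -[leLHS]mulr_natl mulfV ?gt_eqF.
  apply: with_prob_mono H => [|z /= H b a].
    rewrite lerD2l lerN2; apply: le_trans dd.
    rewrite !sumr_const !card_ord -[leLHS]mulr_natl -[X in _ * X <= _]mulr_natl.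
    have -> : - (2 * L1) = - L1 * 2%:R by ring.
    rewrite expRM_natr.
    have h1 : (d%:R * expR (- L1)) ^+ 2 <= delta ^+ 2.
      by rewrite lerXn2r ?nnegrE ?(ltW delta0)// mulr_ge0// expR_ge0.
    by move: h1; rewrite exprMn; lra.
  have := H b a; rewrite /S /= -mulr_sumr normrM gtr0_norm ?invr_gt0//.
  by rewrite ler_pdivrMl// => h; apply: (le_trans h); rewrite le_eqVlt; apply/orP; left;
    apply/eqP; ring.
have E2 : with_prob_at_least P (1 - delta / 6) [set z | forall k b a,
    `|\sum_l D l k * crossterm A (nz z) l b a| <= 16 * lam * max_col_norm D * c].
  have mc0 : 0 <= max_col_norm D.
    rewrite /max_col_norm; elim/big_ind: _ => // [y z y0 z0|i _]; last exact: l2norm_ge0.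
    by rewrite le_max y0.
  have colb k : \sum_l D l k ^+ 2 <= max_col_norm D ^+ 2.
    have -> : \sum_l D l k ^+ 2 = l2norm (col k D) ^+ 2.
      by rewrite l2norm_sqr; apply: eq_bigr => l _; rewrite !mxE.
    rewrite lerXn2r ?nnegrE ?l2norm_ge0//.
    by rewrite /max_col_norm (bigD1 k)//= le_max lexx.
  (* The columns cannot be normalized when all of them vanish; both sides are then 0. *)
  have [mcz|mcn] := eqVneq (max_col_norm D) 0.
    have Dz l k : D l k = 0.
      apply/eqP; rewrite -sqrf_eq0 eq_le sqr_ge0 andbT.
      apply: le_trans (le_trans (colb k) _); last by rewrite mcz expr0n.
      by rewrite (bigD1 l)//= lerDl sumr_ge0// => i _; exact: sqr_ge0.
    exists setT; split => //.
      move=> z _ k b a /=; rewrite big1 ?normr0 ?mcz ?mulr0 ?mul0r// => l _.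
      by rewrite Dz mul0r.
    rewrite probability_setT lee_fin gerBl divr_ge0// ltW//.
  have mcp : 0 < max_col_norm D by rewrite lt0r mcn.
  pose S k b a : set Omega := [set z |
    `|\sum_l (D l k / max_col_norm D) * crossterm A (nz z) l b a| <= 16 * lam * c].
  have H : with_prob_at_least P (1 - \sum_(k < p) \sum_(b < d) \sum_(a < d) 8 * expR (-
    (2 * lam)))
      [set z | forall k b a, S k b a z].
    apply: (with_prob_forall (A := fun k => [set z | forall b a, S k b a z])) => k.
    apply: (with_prob_forall (A := fun b => [set z | forall a, S k b a z])) => b.
    apply: with_prob_forall => a; apply: crossterm_event => //.
    under eq_bigr do rewrite exprMn.
    by rewrite -mulr_suml exprVn ler_pdivrMr ?exprn_gt0// mul1r.
  apply: with_prob_mono H => [|z /= H k b a].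
    rewrite lerD2l lerN2; apply: le_trans dd.
    rewrite !sumr_const !card_ord -[leLHS]mulr_natl -[X in _ * X <= _]mulr_natl
      -[X in _ * (_ * X) <= _]mulr_natl.
    have -> : - (2 * lam) = - lam * 2%:R by ring.
    rewrite expRM_natr -/x.
    have h1 : delta * (d%:R * x) <= delta * delta.
      by rewrite ler_wpM2l// ltW.
    rewrite (_ : p%:R * (d%:R * (d%:R * (8 * x ^+ 2))) =
      8 * ((p%:R * d%:R * x) * (d%:R * x))); last by ring.
    by rewrite /x hlam -/x; lra.
  have := H k b a; rewrite /S /=.
  have -> : \sum_l D l k / max_col_norm D * crossterm A (nz z) l b a =
      (max_col_norm D)^-1 * \sum_l D l k * crossterm A (nz z) l b a.
    by rewrite mulr_sumr; apply: eq_bigr => l _; ring.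
  rewrite normrM gtr0_norm ?invr_gt0// ler_pdivrMl// => h; apply: (le_trans h).
  by rewrite le_eqVlt; apply/orP; left; apply/eqP; ring.
have := with_probI E1 E2.
rewrite (_ : delta / 6 + delta / 6 = delta / 3)//; by field.
Qed.

Lemma good_event (L1 ell : R) : 1 <= L1 -> d%:R * expR (- L1) <= delta ->
  is_pinv (incidence R o) D -> 1 <= ell ->
  max_row_norm D ^+ 2 * lam <= 1 ->
  1024 * 1024 * 1024 * 16 * ell ^+ 2 / Delta <= T%:R ->
  d%:R <= m%:R :> R -> d%:R * lam ^+ 2 <= m%:R * ell ^+ 2 ->
  with_prob_at_least P (1 - delta)
  [set z | [/\ forall f : 'I_m -> 'I_d -> R,
      T%:R / 1024 / 2 * (\sum_l \sum_a f l a ^+ 2 -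
        max_row_norm D ^+ 2 * lam * jumps o f ^+ 2) <=
      \sum_l energy A (nz z) l (f l),
    forall b a, `|\sum_l crossterm A (nz z) l b a| <=
      16 * L1 * Num.sqrt m%:R * Num.sqrt (T%:R / Delta) &
    forall k b a, `|\sum_l D l k * crossterm A (nz z) l b a| <=
      16 * lam * max_col_norm D * Num.sqrt (T%:R / Delta)]].
Proof.
move=> L11 hL1 hpinv ell1 mulam hT dm dlam.
have D0 : 0 < Delta by rewrite exprn_gt0// subr_gt0.
have D1 : Delta <= 1 by rewrite exprn_ile1// ?subr_ge0 ?(ltW hrho)// gerBl.
(* From [m <= p + 1 <= 2 p] and [exp lam = p d / delta >= 160 p]. *)
have mlam : 80 * m%:R <= expR lam.
  have h1 : m%:R <= 2 * p%:R :> R.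
    apply: (@le_trans _ _ p.+1%:R); first by rewrite ler_nat (edge_count_ge hconn m0 hpinv).
    by rewrite -natr1; move: p1; lra.
  have h2 : 1 = x * expR lam by rewrite /x -expRD addNr expR0.
  have h3 : p%:R * d%:R * 160 <= expR lam.
    rewrite -[expR lam]mul1r.
    have : 160 * delta <= 1 by move: delta1; lra.
    have := expR_gt0 lam => e0 h4.
    have := ler_wpM2r (ltW e0) h4.
    rewrite -hlam -/x -!mulrA -h2 mulr1; lra.
  have : p%:R <= p%:R * d%:R :> R by rewrite ler_peMr// ler0n.
  lra.
have := with_probI (with_probI lower_event upper_event) (noise_events L11 hL1).
rewrite (_ : delta / 6 + delta / 6 + delta / 3 = 2 / 3 * delta); last by field.
apply: with_prob_mono; first by rewrite lerD2l lerN2; move: delta0; lra.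
move=> z [[low up] [N1 N2]]; split => // f.
apply: (@restricted_eigenvalue R m p d T o D (fun l t a => traj A (nz z) l t.+1 a 0)
  Delta lam ell hconn m0 d0 hpinv D0 D1 lam1 ell1 mulam hT dm dlam mlam).
  move=> j L s jJ sk.
  have jJ1 : (j < J.+1)%N by rewrite ltnS.
  have st : size s == sample_size eps j by rewrite sk.
  exact: (low (Ordinal jJ1) L (Tuple st)).
move=> L b; have -> : (1024 * eps)^-1 = 16 / Delta.
  by field; rewrite subr_eq0 gt_eqF.
exact: up.
Qed.

End good_event.

(** * Deterministic analysis of the estimator *)

Section vectorized.
Context {R : realType}.

Lemma sum_mxtens m n (F : 'I_(m * n) -> R) :
  \sum_k F k = \sum_i \sum_j F (mxtens_index (i, j)).
Proof.
rewrite (reindex (@mxtens_index m n)) /=.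
  by rewrite [RHS]pair_bigA; apply: eq_bigr => -[].
exists (@mxtens_unindex m n) => k _; [exact: mxtens_indexK|exact: mxtens_unindexK].
Qed.

(** Column [a] and row [b] of the matrix at vertex [l], as [vec] stacks columns. For fixed [b] this
    is a row, and the design acts on each row separately through the same regressors. *)
Definition entry m d (h : 'cV[R]_(m * (d * d))) l a b : R :=
  h (mxtens_index (l, mxtens_index (a, b))) 0.

Lemma design_entry m d T (x : 'I_m -> nat ->
  'cV[R]_d) (h : 'cV[R]_(m * (d * d))) l (t : 'I_T) b :
  (design T x *m h) (mxtens_index (l, mxtens_index (t, b))) 0 =
  \sum_a entry h l a b * x l t.+1 a 0.
Proof.
rewrite mxE sum_mxtens (bigD1 l)//= [X in _ + X]big1 ?addr0; last first.
  move=> l' ll'; rewrite big1// => j _.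
  by rewrite mxE !mxtens_indexK /= eq_sym (negbTE ll') mul0r.
rewrite sum_mxtens; apply: eq_bigr => a _.
rewrite (bigD1 b)//= big1 ?addr0; last first.
  move=> b' bb'; rewrite mxE !mxtens_indexK /= eqxx tensmxE [1%:M _ _]mxE.
  by rewrite eq_sym (negbTE bb') mulr0 mul0r.
by rewrite mxE !mxtens_indexK /= eqxx tensmxE !mxE eqxx mulr1 mulrC.
Qed.

Lemma diff_entry m p n (o : 'I_p -> 'I_m * 'I_m) (h : 'cV[R]_(m * n)) k j :
  (tensmx (incidence R o) (1%:M : 'M[R]_n) *m h) (mxtens_index (k, j)) 0 =
  h (mxtens_index ((o k).1, j)) 0 - h (mxtens_index ((o k).2, j)) 0.
Proof.
pose M : 'M[R]_(m, n) := \matrix_(i, j) h (mxtens_index (i, j)) 0.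
transitivity ((incidence R o *m M) k j); last by rewrite incidenceE !mxE.
rewrite mxE [RHS]mxE sum_mxtens; apply: eq_bigr => i _.
rewrite (bigD1 j)//= big1 ?addr0; last first.
  by move=> j' jj'; rewrite tensmxE [1%:M _ _]mxE eq_sym (negbTE jj') mulr0 mul0r.
by rewrite tensmxE [1%:M _ _]mxE eqxx mulr1 [M _ _]mxE.
Qed.

Lemma l1norm_diff m p d (o : 'I_p -> 'I_m * 'I_m) (h : 'cV[R]_(m * (d * d))) :
  l1norm (tensmx (incidence R o) (1%:M : 'M[R]_(d * d)) *m h) =
  \sum_b jumps o (fun l a => entry h l a b).
Proof.
rewrite /l1norm sum_mxtens /jumps [RHS]exchange_big; apply: eq_bigr => k _.
rewrite sum_mxtens [RHS]exchange_big; apply: eq_bigr => a _; apply: eq_bigr => b _.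
by rewrite diff_entry.
Qed.

Lemma l2norm_entry m d (h : 'cV[R]_(m * (d * d))) :
  l2norm h ^+ 2 = \sum_b \sum_l \sum_a entry h l a b ^+ 2.
Proof.
rewrite l2norm_sqr sum_mxtens [RHS]exchange_big; apply: eq_bigr => l _.
by rewrite sum_mxtens [RHS]exchange_big.
Qed.

Lemma minimizer_basic n q r (y e : 'cV[R]_n) (Q : 'M[R]_(n, q)) (Dt : 'M[R]_(r, q))
    (a ahat : 'cV[R]_q) (lambda : R) (m : nat) :
  y = Q *m a + e -> (0 < m)%N ->
  minimizer (tv_objective m y Q Dt lambda) ahat ->
  l2norm (Q *m (ahat - a)) ^+ 2 <= 2 * \sum_i (Q *m (ahat - a)) i 0 * e i 0 +
    2 * m%:R * lambda * (l1norm (Dt *m a) - l1norm (Dt *m ahat)).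
Proof.
move=> ye m0 /(_ a); rewrite /tv_objective.
have mp : 0 < m%:R :> R by rewrite ltr0n.
have -> : y - Q *m a = e by rewrite ye addrAC subrr add0r.
have -> : y - Q *m ahat = e - Q *m (ahat - a) by rewrite ye mulmxBr opprB addrAC addrA
  addrC addrA.
set g := Q *m _.
have -> : l2norm (e - g) ^+ 2 = l2norm e ^+ 2 - 2 * (\sum_i g i 0 * e i 0) + l2norm g ^+ 2.
  rewrite !l2norm_sqr mulr_sumr -sumrN -!big_split; apply: eq_bigr => i _ /=.
  by rewrite !mxE; ring.
move: (l2norm e ^+ 2) (\sum_i _) (l2norm g ^+ 2) (l1norm _) (l1norm _) => E S G u v.
rewrite -(ler_pM2l (mulr_gt0 (ltr0n R 2) mp)).
rewrite !mulrDr !mulrA mulfV ?gt_eqF ?mulr_gt0// !mul1r; lra.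
Qed.

Lemma l1normD_ge n (x y : 'cV[R]_n) : l1norm x - l1norm y <= l1norm (y + x).
Proof.
rewrite lerBlDr -big_split; apply: ler_sum => i _ /=.
rewrite mxE -[x i 0 in leLHS](addKr (y i 0)) addrC.
by rewrite (le_trans (ler_normD _ _))// normrN.
Qed.

(** On the support of [x] the norm drops by at most [|y|]; off the support it increases by exactly
    [|y|]. The left side is thus at most three times the norm of [y] on the support minus its norm
    off it. *)
Lemma l1norm_supp n (x y : 'cV[R]_n) :
  l1norm y + 2 * (l1norm x - l1norm (x + y)) <=
  4 * l1norm_on (supp x) y - l1norm y.
Proof.
rewrite /l1norm_on big_mkcond /= mulr_sumr /l1norm.
rewrite -sumrB -[leRHS]sumrB mulr_sumr -big_split; apply: ler_sum => i _ /=.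
rewrite mxE !inE; case: ifPn => [_|].
  have : `|x i 0| <= `|x i 0 + y i 0| + `|y i 0|.
    by rewrite -[x i 0 in leLHS](addrK (y i 0)) (le_trans (ler_normB _ _)).
  lra.
by rewrite negbK => /eqP ->; rewrite add0r normr0; lra.
Qed.

(** A crude operator bound, there to keep the infimum defining the compatibility factor away from
    0. *)
Lemma l1norm_mulmx_le p n (M : 'M[R]_(p, n)) : exists2 K, 0 < K &
  forall v : 'cV[R]_n, l1norm (M *m v) <= K * l2norm v.
Proof.
exists (1 + \sum_i \sum_j `|M i j|).
  by rewrite ltr_pwDl// sumr_ge0// => i _; apply: sumr_ge0.
move=> v; rewrite mulrDl mul1r; apply: ler_wpDl; first exact: l2norm_ge0.
rewrite mulr_suml; apply: ler_sum => i _.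
rewrite mxE (le_trans (ler_norm_sum _ _ _))// mulr_suml; apply: ler_sum => j _.
rewrite normrM ler_wpM2l//; apply: ler_abs_of_sqr; first exact: l2norm_ge0.
by rewrite l2norm_sqr (bigD1 j)//= lerDl sumr_ge0// => k _; exact: sqr_ge0.
Qed.

(* When the set of the infimum is empty, the infimum is 0 and so is the
   quotient by it, but then every restricted norm vanishes. *)
Lemma compat_factor_bound p n (M : 'M[R]_(p, n)) (S : {set 'I_p}) :
  0 <= Num.sqrt #|S|%:R / compat_factor M S /\
  forall v, l1norm_on S (M *m v) <= Num.sqrt #|S|%:R / compat_factor M S * l2norm v.
Proof.
have on0 (v : 'cV[R]_n) : 0 <= l1norm_on S (M *m v) by apply: sumr_ge0.
rewrite /compat_factor; case: eqVneq => [->|S0].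
  by rewrite cards0 sqrtr0 mul0r; split=> // v; rewrite /l1norm_on big_set0 mul0r.
set F := [set _ | _ in _].
have s0 : 0 < Num.sqrt #|S|%:R :> R by rewrite sqrtr_gt0 ltr0n card_gt0.
have [K K0 hK] := l1norm_mulmx_le M.
have onK v : l1norm_on S (M *m v) <= K * l2norm v.
  apply: le_trans (hK v); rewrite /l1norm [leRHS](bigID (fun i => i \in S)) /=.
  by rewrite lerDl sumr_ge0.
have lbF : lbound F (Num.sqrt #|S|%:R / K).
  move=> _ [v /= v0 <-]; have vp : 0 < l1norm_on S (M *m v) by rewrite lt0r v0 on0.
  rewrite -mulrA ler_wpM2l ?(ltW s0)// ler_pdivlMr// mulrC ler_pdivrMr// mulrC.
  exact: onK.
have iF : 0 <= inf F.
  have [->|/set0P F0] := eqVneq F set0; first by rewrite inf0.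
  apply: lb_le_inf => // _ [v _ <-].
  by rewrite divr_ge0// mulr_ge0 ?(ltW s0) ?l2norm_ge0.
split; first by rewrite divr_ge0// ltW.
move=> v; have [->|v0] := eqVneq (l1norm_on S (M *m v)) 0.
  by rewrite mulr_ge0 ?l2norm_ge0// divr_ge0// ltW.
have vp : 0 < l1norm_on S (M *m v) by rewrite lt0r v0 on0.
have Fv : F (Num.sqrt #|S|%:R * l2norm v / l1norm_on S (M *m v)) by exists v.
have k0 : 0 < inf F.
  apply: (@lt_le_trans _ _ (Num.sqrt #|S|%:R / K)); first by rewrite divr_gt0.
  by apply: lb_le_inf => //; eexists; exact: Fv.
rewrite mulrAC ler_pdivlMr// mulrC -ler_pdivlMr//.
apply: ge_inf => //; by exists (Num.sqrt #|S|%:R / K).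
Qed.

End vectorized.

Lemma sum_sqr_le (R : realType) n (u : 'I_n -> R) :
  (\sum_i u i) ^+ 2 <= n%:R * \sum_i u i ^+ 2.
Proof.
have := cauchy_schwarz_sum u (fun=> 1).
under [X in X ^+ 2 <= _ -> _]eq_bigr do rewrite mulr1.
under [X in _ <= _ * X -> _]eq_bigr do rewrite expr1n.
by rewrite sumr_const card_ord mulrC.
Qed.

Section model.
Context {R : realType} (m p d T : nat) (o : 'I_p -> 'I_m * 'I_m)
  (D : 'M[R]_(m, p)).
Context (disp : measure_display) (Omega : measurableType disp)
  (P : probability Omega R).
Variable eta : 'I_m -> nat -> {RV P >-> d.-tuple R}.
Variable A : 'I_m -> 'M[R]_d.
Variable z : Omega.
Hypothesis hconn : forall i j, connect (joined o) i j.
Hypothesis m0 : (0 < m)%N.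
Hypothesis hpinv : is_pinv (incidence R o) D.
Local Notation nz := ((noise (T := T) eta)^~ z).
Local Notation x := (fun l => state (A l) (noise_path (eta l) z)).
Local Notation Q := (design T x).
Local Notation astar := (stack (fun l => vec (A l))).
Local Notation Dt := (tensmx (incidence R o) (1%:M : 'M[R]_(d * d))).
Local Notation resid := (targets T x - Q *m astar).

Lemma design_energy (h : 'cV[R]_(m * (d * d))) :
  l2norm (Q *m h) ^+ 2 = \sum_b \sum_l energy A nz l (fun a => entry h l a b).
Proof.
rewrite l2norm_sqr sum_mxtens [RHS]exchange_big; apply: eq_bigr => l _.
rewrite sum_mxtens [LHS]exchange_big; apply: eq_bigr => b _; apply: eq_bigr => t _.
rewrite design_entry; congr (_ ^+ 2); apply: eq_bigr => a _.
by rewrite traj_noise// ltnS ltnW.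
Qed.

Lemma resid_entry l (t : 'I_T) b :
  resid (mxtens_index (l, mxtens_index (t, b))) 0 = tnth (eta l t.+2 z) b.
Proof.
rewrite [LHS]mxE [X in _ + X]mxE design_entry [targets _ _ _ _]mxE !mxtens_indexK /=.
rewrite [vec _ _ _]mxE !mxtens_indexK /= [responses _ _ _ _]mxE /=.
rewrite [X in X - _]mxE [X in X + _ - _]mxE [X in _ + X - _]mxE.
rewrite addrAC [X in X + _](_ : _ = 0) ?add0r//.
apply/eqP; rewrite subr_eq0; apply/eqP; apply: eq_bigr => a _.
by congr (_ * _); rewrite /entry [RHS]mxE !mxtens_indexK /= [RHS]mxE !mxtens_indexK.
Qed.

Lemma noise_pairing (h : 'cV[R]_(m * (d * d))) :
  \sum_i (Q *m h) i 0 * resid i 0 =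
  \sum_a \sum_b \sum_l entry h l a b * crossterm A nz l b a.
Proof.
rewrite sum_mxtens.
under [RHS]eq_bigr do rewrite exchange_big.
rewrite [RHS]exchange_big; apply: eq_bigr => l _.
rewrite sum_mxtens [LHS]exchange_big [RHS]exchange_big; apply: eq_bigr => b _.
under eq_bigr do rewrite design_entry resid_entry mulr_suml.
rewrite exchange_big; apply: eq_bigr => a _ /=.
(* The term at time 0 vanishes with [x_0]; the others match the residuals, whose noise is one step
   later than the regressor. *)
rewrite /crossterm big_ord_recl /= [traj _ _ _ 0]/traj /= [X in _ * (_ * X +
  _)]mxE mulr0 add0r mulr_sumr.
apply: eq_bigr => t _; rewrite traj_noise; last by rewrite /bump leq0n add1n ltnS ltnW.
by rewrite /noise /= /bump leq0n add1n -mulrA; congr (_ * _); rewrite mulrC.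
Qed.

(** The factor [d] comes from Cauchy-Schwarz over the [d^2] pairs of coordinates; Cauchy-Schwarz
    over the vertices gives a [sqrt m] that cancels the normalization of the mean. *)
Lemma noise_pairing_le (b1 b2 : R) (h : 'cV[R]_(m * (d * d))) : 0 <= b1 ->
  (forall b a, `|\sum_l crossterm A nz l b a| <= b1 * Num.sqrt m%:R) ->
  (forall k b a, `|\sum_l D l k * crossterm A nz l b a| <= b2) ->
  \sum_i (Q *m h) i 0 * resid i 0 <= d%:R * b1 * l2norm h + b2 * l1norm (Dt *m h).
Proof.
move=> b10 h1 h2; rewrite noise_pairing.
have mp : 0 < m%:R :> R by rewrite ltr0n.
pose s a b := \sum_l entry h l a b.
pose jmp k a b := entry h (o k).1 a b - entry h (o k).2 a b.
have step a b : \sum_l entry h l a b * crossterm A nz l b a <=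
    b1 / Num.sqrt m%:R * `|s a b| + b2 * \sum_k `|jmp k a b|.
  have -> : \sum_l entry h l a b * crossterm A nz l b a =
      m%:R^-1 * s a b * (\sum_l crossterm A nz l b a) +
      \sum_k jmp k a b * \sum_l D l k * crossterm A nz l b a.
    rewrite mulr_sumr; under [X in _ + X]eq_bigr do rewrite mulr_sumr.
    rewrite exchange_big -big_split; apply: eq_bigr => l _ /=.
    rewrite {1}(pinv_decomp hconn m0 hpinv (fun l => entry h l a b) l) mulrDl.
    by congr (_ + _); rewrite mulr_suml; apply: eq_bigr => k _; rewrite /jmp; ring.
  apply: lerD.
    apply: (le_trans (ler_norm _)); rewrite normrM normrM gtr0_norm ?invr_gt0//.
    have sm : 0 < Num.sqrt m%:R :> R by rewrite sqrtr_gt0.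
    have sm2 : m%:R = Num.sqrt m%:R ^+ 2 :> R by rewrite sqr_sqrtr// ltW.
    have -> : b1 / Num.sqrt m%:R * `|s a b| = m%:R^-1 * `|s a b| * (b1 * Num.sqrt m%:R).
      by rewrite [in m%:R^-1]sm2; move: (Num.sqrt _) sm => y y0; field; rewrite gt_eqF.
    by rewrite ler_wpM2l// mulr_ge0// invr_ge0 ltW.
  rewrite mulr_sumr; apply: ler_sum => k _.
  by rewrite (le_trans (ler_norm _))// normrM mulrC ler_wpM2r.
apply: (@le_trans _ _ (\sum_a \sum_b (b1 / Num.sqrt m%:R * `|s a b| +
  b2 * \sum_k `|jmp k a b|))).
  by apply: ler_sum => a _; apply: ler_sum => b _; exact: step.
under eq_bigr do rewrite big_split -!mulr_sumr /=.
rewrite big_split -!mulr_sumr /=; apply: lerD; last first.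
  rewrite le_eqVlt; apply/orP; left; apply/eqP; congr (_ * _).
  rewrite l1norm_diff exchange_big; apply: eq_bigr => b _.
  by rewrite exchange_big.
have sm : 0 < Num.sqrt m%:R :> R by rewrite sqrtr_gt0.
have sm2 : Num.sqrt m%:R ^+ 2 = m%:R :> R by rewrite sqr_sqrtr// ltW.
rewrite mulrAC ler_pdivrMr// [d%:R * b1]mulrC -!mulrA ler_wpM2l//.
rewrite -[leLHS]ger0_norm; last by apply: sumr_ge0 => a _; apply: sumr_ge0.
apply: ler_abs_of_sqr; first by rewrite !mulr_ge0 ?l2norm_ge0// ltW.
apply: (le_trans (sum_sqr_le _)).
rewrite !exprMn sm2 expr2 -mulrA ler_wpM2l//.
apply: (@le_trans _ _ (\sum_a d%:R * \sum_b `|s a b| ^+ 2)).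
  by apply: ler_sum => a _; exact: sum_sqr_le.
rewrite -mulr_sumr ler_wpM2l// l2norm_entry mulrC mulr_sumr exchange_big /=.
apply: ler_sum => b _; rewrite [X in _ * X]exchange_big mulr_sumr /=.
apply: ler_sum => a _; rewrite real_normK ?num_real//.
exact: sum_sqr_le.
Qed.

(** The penalty enters the basic inequality with weight [2 m lambda = 64 c2 M0], twice the weight
    [2 . 16 c2 M0] of the noise term. The second conclusion, due to [|Q h|^2 >= 0], yields the cone
    condition on the jumps. *)
Lemma oracle_inequality (c c2 M0 b1 b2 lam : R) (ahat : 'cV[R]_(m * (d * d))) :
  0 <= c -> 0 <= lam -> 0 <= b1 -> 0 <= c2 ->
  (forall f : 'I_m -> 'I_d -> R,
      c * (\sum_l \sum_a f l a ^+ 2 - max_row_norm D ^+ 2 * lam * jumps o f ^+ 2) <=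
      \sum_l energy A nz l (f l)) ->
  (forall b a, `|\sum_l crossterm A nz l b a| <= b1 * Num.sqrt m%:R) ->
  (forall k b a, `|\sum_l D l k * crossterm A nz l b a| <= b2) ->
  d%:R * b1 <= 16 * c2 * M0 -> b2 <= 16 * c2 * M0 ->
  minimizer (tv_objective m (targets T x) Q Dt (32 / m%:R * c2 * M0)) ahat ->
  c * (l2norm (ahat - astar) ^+ 2 -
       max_row_norm D ^+ 2 * lam * l1norm (Dt *m (ahat - astar)) ^+ 2) <=
  32 * c2 * M0 * (l2norm (ahat - astar) + l1norm (Dt *m (ahat - astar)) +
    2 * (l1norm (Dt *m astar) - l1norm (Dt *m ahat))) /\
  0 <= 32 * c2 * M0 * (l2norm (ahat - astar) + l1norm (Dt *m (ahat - astar)) +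
    2 * (l1norm (Dt *m astar) - l1norm (Dt *m ahat))).
Proof.
move=> c0 lam0 b10 c20 hre n1 n2 hb1 hb2 hmin.
set h := ahat - astar.
have mp : 0 < m%:R :> R by rewrite ltr0n.
have ye : targets T x = Q *m astar + resid by rewrite addrC subrK.
have := minimizer_basic ye m0 hmin; rewrite -/h.
have := noise_pairing_le h b10 n1 n2.
set G := \sum_i _; set u := l1norm (Dt *m h).
have u0 : 0 <= u by apply: sumr_ge0.
have g1 := ler_wpM2r (l2norm_ge0 h) hb1; have g2 := ler_wpM2r u0 hb2.
move=> hG.
have -> : 2 * m%:R * (32 / m%:R * c2 * M0) = 64 * (c2 * M0).
  by field; rewrite gt_eqF.
move=> hQ.
have up : l2norm (Q *m h) ^+ 2 <= 32 * c2 * M0 * (l2norm h + u +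
    2 * (l1norm (Dt *m astar) - l1norm (Dt *m ahat))).
  lra.
split; last exact: le_trans (sqr_ge0 _) up.
apply: le_trans up; rewrite design_energy.
apply: (@le_trans _ _ (\sum_b c * (\sum_l \sum_a entry h l a b ^+ 2 -
    max_row_norm D ^+ 2 * lam * jumps o (fun l a => entry h l a b) ^+ 2))).
  rewrite -mulr_sumr ler_wpM2l// sumrB l2norm_entry lerD2l lerN2 -mulr_sumr.
  apply: ler_wpM2l; first by rewrite mulr_ge0 ?sqr_ge0.
  rewrite /u l1norm_diff.
  have j0 b : 0 <= jumps o (fun l a => entry h l a b).
    by apply: sumr_ge0 => k _; apply: sumr_ge0.
  rewrite expr2 mulr_suml; apply: ler_sum => b _.
  by rewrite expr2 ler_wpM2l// (bigD1 b)//= lerDl sumr_ge0.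
by apply: ler_sum => b _; exact: hre.
Qed.

End model.

(** * Solving the quadratic inequalities for the error; comparison of logarithms *)

Section rates.
Context {R : realType}.

(** [X] is the error, [Y] its jumps and [S] the jumps on the support. Nonnegativity of the right
    side gives [Y <= X + 4 S <= 4 (1 + r) X], so the subtracted term is at most half of [X^2]. *)
Lemma few_changes_rate (X Y S r c B ml q : R) : 0 <= X -> 0 <= Y -> 0 <= r ->
  S <= r * X -> 0 < c -> 0 < B -> ml * (1 + r) ^+ 2 <= 32^-1 ->
  Y + q <= 4 * S - Y ->
  c * (X ^+ 2 - ml * Y ^+ 2) <= B * (X + Y + q) -> 0 <= B * (X + Y + q) ->
  0 <= ml -> X <= 8 * (B / c) * (1 + r).
Proof.
move=> X0 Y0 r0 SX c0 B0 mlr hq h1 h2 ml0.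
rewrite (pmulr_rge0 _ B0) in h2.
have YX : Y <= 4 * (1 + r) * X by lra.
have Y2 : Y ^+ 2 <= (4 * (1 + r) * X) ^+ 2.
  by rewrite lerXn2r ?nnegrE// !mulr_ge0// addr_ge0.
have h3 : ml * Y ^+ 2 <= X ^+ 2 / 2.
  apply: (le_trans (ler_wpM2l ml0 Y2)).
  have := ler_wpM2r (sqr_ge0 X) mlr; lra.
have h4 : X + Y + q <= 4 * (1 + r) * X by lra.
have h5 := le_trans h1 (ler_wpM2l (ltW B0) h4).
have h6 : c * (X ^+ 2 / 2) <= B * (4 * (1 + r) * X).
  by apply: le_trans h5; rewrite ler_wpM2l ?(ltW c0)//; lra.
have [Xz|Xn] := eqVneq X 0.
  rewrite Xz; apply: mulr_ge0; last exact: addr_ge0.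
  by rewrite mulr_ge0// divr_ge0// ltW.
have Xp : 0 < X by rewrite lt0r Xn.
have h7 : c * X <= 8 * B * (1 + r).
  rewrite -(ler_pM2r Xp); lra.
have -> : 8 * (B / c) * (1 + r) = 8 * B * (1 + r) / c by ring.
by rewrite ler_pdivlMr// mulrC.
Qed.

(** Here [Y <= X + 4 tv], and [ml * tv <= B / c] turns the quadratic term in [tv] into a linear one.
    What remains is [X^2 <= 2 g X + 72 g tv] with [g = B / c], solved with [9^2 > 72]. *)
Lemma smooth_rate (X Y tv c B ml q : R) : 0 <= X -> 0 <= Y -> 0 <= tv ->
  0 < c -> 0 < B -> 0 <= ml -> ml <= 8^-1 -> ml * tv <= B / c ->
  Y + q <= 4 * tv - Y ->
  c * (X ^+ 2 - ml * Y ^+ 2) <= B * (X + Y + q) -> 0 <= B * (X + Y + q) ->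
  X <= 2 * (B / c) + 9 * Num.sqrt (B / c * tv).
Proof.
move=> X0 Y0 tv0 c0 B0 ml0 ml1 mltv hq h1 h2.
rewrite (pmulr_rge0 _ B0) in h2.
set g := B / c in mltv *.
have g0 : 0 < g by rewrite divr_gt0.
have YX : Y <= X + 4 * tv by lra.
have Y2 : Y ^+ 2 <= (X + 4 * tv) ^+ 2.
  by rewrite lerXn2r ?nnegrE// addr_ge0// mulr_ge0.
have Y3 : Y ^+ 2 <= 2 * X ^+ 2 + 32 * tv ^+ 2.
  by apply: (le_trans Y2); have := sqr_ge0 (X - 4 * tv); lra.
have h3 : ml * Y ^+ 2 <= X ^+ 2 / 4 + 32 * g * tv.
  apply: (le_trans (ler_wpM2l ml0 Y3)).
  have := ler_wpM2r tv0 mltv; have := ler_wpM2r (sqr_ge0 X) ml1; lra.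
have h4 : X + Y + q <= X + 4 * tv by lra.
have h5 : X ^+ 2 - ml * Y ^+ 2 <= g * (X + 4 * tv).
  have := le_trans h1 (ler_wpM2l (ltW B0) h4).
  by rewrite /g mulrAC ler_pdivlMr// mulrC.
have h6 : X ^+ 2 <= 2 * g * X + 72 * (g * tv).
  have := mulr_ge0 (ltW g0) X0; have := mulr_ge0 (ltW g0) tv0; lra.
set s := Num.sqrt (g * tv).
have s0 : 0 <= s by exact: sqrtr_ge0.
have s2 : s ^+ 2 = g * tv by rewrite sqr_sqrtr// mulr_ge0// ltW.
rewrite leNgt; apply/negP => hX.
rewrite -s2 in h6.
have e1 : 9 * s <= X - 2 * g by lra.
have e2 : 9 * s <= X by lra.
have := ler_pM (mulr_ge0 (ler0n R 9) s0) (mulr_ge0 (ler0n R 9) s0) e1 e2.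
have := sqr_ge0 s => e3 e4.
have e5 : s = 0.
  by apply/eqP; rewrite -sqrf_eq0 eq_le e3 andbT; lra.
rewrite e5 expr0n /= in h6 hX *.
have Xp : 0 < X by lra.
have : X * (X - 2 * g) > 0 by rewrite mulr_gt0//; lra.
lra.
Qed.

Lemma ln_le_sub1 (y : R) : 0 < y -> ln y <= y - 1.
Proof. by move=> y0; have := expR_ge1Dx (ln y); rewrite lnK ?posrE//; lra. Qed.

(** Apply [ln b <= b] to the fourth root [b] of [y]. *)
Lemma ln_sqr_le (y : R) : 1 <= y -> ln y ^+ 2 <= 16 * Num.sqrt y.
Proof.
move=> y1; have y0 : 0 < y by lra.
set a := Num.sqrt y; have a0 : 0 < a by rewrite sqrtr_gt0.
set b := Num.sqrt a; have b0 : 0 < b by rewrite sqrtr_gt0.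
have b2 : b ^+ 2 = a by rewrite sqr_sqrtr// ltW.
have a2 : a ^+ 2 = y by rewrite sqr_sqrtr// ltW.
have -> : ln y = 4 * ln b.
  by rewrite -a2 -b2 -exprM lnXn// -[LHS]mulr_natl.
have lb : ln b <= b by have := ln_le_sub1 b0; lra.
have l0 : 0 <= ln b.
  have : 0 <= ln y by exact: ln_ge0.
  by rewrite -a2 -b2 -exprM lnXn// -[leRHS]mulr_natl pmulr_rge0.
rewrite exprMn -natrX ler_wpM2l// -b2.
by rewrite lerXn2r ?nnegrE// ltW.
Qed.

Lemma ge1_ln (y : R) : 4 <= y -> 1 <= ln y.
Proof.
move=> y4; have y0 : 0 < y by lra.
by rewrite -ler_expR lnK ?posrE// (le_trans (expR1_le4 R)).
Qed.

(** As [p <= m^2], the logarithms are at most [3 ln m], with square at most [144 sqrt m]. The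
    hypothesis gives [d / ell <= sqrt m / 1024], so [d] times [288 sqrt m] is at most half of
    [m ell^2]; its other consequence, [2^21 d <= m], handles the term in [ell^2]. *)
Lemma dim_log_le (d p m : nat) (ell : R) : (0 < d)%N -> (0 < p)%N -> (0 < m)%N ->
  (p <= m ^ 2)%N -> 1 <= ell ->
  32 * 32 * 32 * 32 * (d%:R ^+ 2 / ell ^+ 2 + ell ^+ 2) <= m%:R ->
  d%:R <= m%:R :> R /\
  d%:R * (ln d%:R + ln p%:R + ell) ^+ 2 <= m%:R * ell ^+ 2.
Proof.
move=> d0 p0 m0 pm ell1 hm.
have e0 : 0 < ell by lra.
have d1 : 1 <= d%:R :> R by rewrite ler1n.
have m1 : 1 <= m%:R :> R by rewrite ler1n.
set x := d%:R / ell; have x0 : 0 < x by rewrite divr_gt0// ltr0n.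
have dx : d%:R = x * ell by rewrite /x divfK// gt_eqF.
have x2 : d%:R ^+ 2 / ell ^+ 2 = x ^+ 2 by rewrite /x exprMn exprVn.
rewrite x2 in hm.
have h1 : 32 * 32 * 32 * 32 * (2 * (x * ell)) <= m%:R.
  by apply: le_trans hm; have := sqr_ge0 (x - ell); lra.
have dm : d%:R <= m%:R :> R.
  by rewrite dx; apply: le_trans h1; have := mulr_gt0 x0 e0; lra.
split => //.
set s := Num.sqrt (m%:R : R).
have s0 : 0 < s by rewrite sqrtr_gt0; lra.
have s2 : s ^+ 2 = m%:R by rewrite sqr_sqrtr//; lra.
have xs : 32 * 32 * x <= s.
  rewrite -[leLHS]ger0_norm; last by rewrite mulr_ge0 ?(ltW x0)//; lra.
  apply: ler_abs_of_sqr; first exact: ltW.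
  rewrite s2; apply: le_trans hm; have := sqr_ge0 ell; lra.
have lm0 : 0 <= ln m%:R :> R by exact: ln_ge0.
have ld : ln d%:R <= ln m%:R :> R by rewrite ler_ln ?posrE ?ltr0n.
have lp : ln p%:R <= 2 * ln m%:R :> R.
  have -> : 2 * ln m%:R = ln (m%:R ^+ 2) :> R.
    by rewrite lnXn ?ltr0n// -[RHS]mulr_natl.
  by rewrite ler_ln ?posrE ?exprn_gt0 ?ltr0n// -natrX ler_nat.
have ld0 : 0 <= ln d%:R :> R by exact: ln_ge0.
have lp0 : 0 <= ln p%:R :> R by apply: ln_ge0; rewrite ler1n.
have lm2 : ln m%:R ^+ 2 <= 16 * s := ln_sqr_le m1.
have h2 : (ln d%:R + ln p%:R + ell) ^+ 2 <= 288 * s + 2 * ell ^+ 2.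
  apply: (@le_trans _ _ ((3 * ln m%:R + ell) ^+ 2)).
    rewrite lerXn2r ?nnegrE//; lra.
  have := sqr_ge0 (3 * ln m%:R - ell); lra.
apply: (le_trans (ler_wpM2l (ler0n R d) h2)).
have ee : ell <= ell ^+ 2 by rewrite expr2 ler_peMl// ltW.
have h3 : d%:R * (288 * s) <= m%:R * ell ^+ 2 / 2.
  rewrite dx -s2.
  have a1 := ler_wpM2r (ltW (mulr_gt0 s0 e0)) xs.
  have a2 := ler_wpM2l (sqr_ge0 s) ee.
  have a3 := mulr_ge0 (sqr_ge0 s) (ltW e0).
  lra.
have h4 : d%:R * (2 * ell ^+ 2) <= m%:R * ell ^+ 2 / 2.
  have := ler_wpM2r (sqr_ge0 ell) h1; rewrite -dx.
  have := mulr_ge0 (ler0n R d) (sqr_ge0 ell); lra.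
lra.
Qed.

End rates.

Theorem corollary3 (R : realType) :
  exists c1 c0 clambda C C1 C2 C3 C4 : R,
  [/\ 0 < c1 < 1, 0 < c0, 0 < clambda, 0 < C & 0 < C1] /\
  [/\ 0 < C2, C2 < C3 & 0 < C4] /\
  forall (d T m : nat) (hd : (1 <= d)%N) (hT : (1 <= T)%N) (hm : (2 <= m)%N)
    (E : {set {set 'I_m}}) (hE : simple_graph E) (hconn : connected_graph E)
    (o : 'I_#|E| -> 'I_m * 'I_m) (ho : orientation o)
    (Dpinv : 'M[R]_(m, #|E|)) (hpinv : is_pinv (incidence R o) Dpinv)
    (A : 'I_m -> 'M[R]_d)
    (disp : measure_display) (Omega : measurableType disp)
    (P : probability Omega R)
    (eta : 'I_m -> nat -> {RV P >-> d.-tuple R})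
    (hgauss : forall (l : 'I_m) (t : 'I_T.+1), std_gaussian_vector (eta l t.+1))
    (hindep : mutually_independent
                (fun lt : 'I_m * 'I_T.+1 => eta lt.1 lt.2.+1))
    (rho_max delta : R)
    (hA : forall l, spectral_norm (A l) <= rho_max) (hrho : rho_max < 1)
    (hdelta : 0 < delta < c1),
  let Delta := (1 - rho_max) ^+ 2 in
  let logd := ln (1 / delta) in
  let v := C1 * logd ^+ 2 in
  forall (hTv : C2 * v / Delta ^+ 2 <= T%:R <= C3 * v / Delta ^+ 2)
    (hmC : C4 * (d%:R ^+ 2 / logd ^+ 2 + logd ^+ 2) <= m%:R),
  let nE : R := #|E|%:R in
  let mu := max_col_norm Dpinv in
  let mu' := max_row_norm Dpinv in
  let Dt := tensmx (incidence R o) (1%:M : 'M[R]_(d * d)) in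
  let L1 := ln (d%:R * T%:R / (delta * Delta)) in
  let L2 := ln (d%:R * nE / delta) in
  let M0 := Num.max (d%:R `^ (3 / 2) * L1) (mu * L2) in
  let M := Delta `^ (- (1 / 2)) * M0 in
  let lambda := clambda / m%:R * Num.sqrt (T%:R / Delta) * M0 in
  let astar := stack (fun l => vec (A l)) in
  let tv := l1norm (Dt *m astar) in
  let supp_star := supp (Dt *m astar) in
  let s : R := #|supp_star|%:R in
  let DeltaG := Gramian_spread T A in
  let bound_row := c0 / Num.sqrt (ln (nE * d%:R / delta)) in
  let bound_col : \bar R :=
    (c0%:E *
     mine (if DeltaG == 0%R then +oo
           else (Num.sqrt m%:R * logd ^+ 2 / (d%:R * DeltaG * Delta ^+ 2))%:E)
          (Num.sqrt m%:R * logd / (d%:R * ln (d%:R * nE / delta)))%:E)%E in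
  let x := fun (w : Omega) (l : 'I_m) => state (A l) (noise_path (eta l) w) in
  let estimate := fun (w : Omega) (ahat : 'cV[R]_(m * (d * d))) =>
    minimizer (tv_objective m (targets T (x w)) (design T (x w)) Dt lambda)
      ahat in
  (mu' * (1 + logd / Delta * tv) <= bound_row ->
   ((mu * (1 + logd / Delta * tv))%:E <= bound_col)%E ->
   with_prob_at_least P (1 - delta)
     [set w | forall ahat, estimate w ahat ->
        1 / Num.sqrt m%:R * l2norm (ahat - astar) <=
        C * (M / Num.sqrt (m%:R * T%:R) +
             Num.sqrt (M / (m%:R * Num.sqrt T%:R) * tv))])
  /\
  (mu' * (1 + Num.sqrt s / compat_factor Dt supp_star) <= bound_row ->
   ((mu * (1 + Num.sqrt s / compat_factor Dt supp_star))%:E <= bound_col)%E ->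
   with_prob_at_least P (1 - delta)
     [set w | forall ahat, estimate w ahat ->
        1 / Num.sqrt m%:R * l2norm (ahat - astar) <=
        C * (M / Num.sqrt (m%:R * T%:R)) *
        (1 + Num.sqrt s / compat_factor Dt supp_star)]).
Proof.
have k0 : 0 <= 1024 * 1024 * 1024 * 16 :> R by lra.
have k1 : 0 <= 512 * 512 :> R by lra.
(* The value [1/160] serves the union bounds, [1/32] makes [mu'^2 L2 (1 + y)^2 <= 2^-10], 32 is
   twice the noise level 16, and [2^34] is the length of trajectory needed for the restricted
   eigenvalue. The constant [C = 2^20] covers [8 B / c = 2^19 g] with [g = M / sqrt T]. *)
exists 160^-1, 32^-1, 32, (1024 * 1024), 1, (1024 * 1024 * 1024 * 16),
  ((512 * 512) ^+ 2), (32 * 32 * 32 * 32).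
split; first by split; rewrite ?andbT; lra.
split; first by split; lra.
move=> d T m hd hT hm E hE hconn o ho Dpinv hpinv A disp Omega P eta hgauss hindep
  rho delta hA hrho /andP[delta0 delta1] Delta logd v /andP[hT1 hT2] hmC nE mu mu' Dt L1
    L2 M0 M
  lambda astar tv supp_star s DeltaG bound_row bound_col x estimate.
have m0 : (0 < m)%N by exact: leq_trans hm.
have hc := joined_connect ho hconn.
have p0 : (0 < #|E|)%N by rewrite -ltnS (leq_trans hm)// (edge_count_ge hc m0 hpinv).
have rho0 : 0 <= rho by apply: le_trans (hA (Ordinal m0)); exact: spectral_norm_ge0.
have D0 : 0 < Delta by rewrite exprn_gt0// subr_gt0.
have D1 : Delta <= 1 by rewrite exprn_ile1// ?subr_ge0 ?(ltW hrho)// gerBl.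
have d1 : 1 <= d%:R :> R by rewrite ler1n.
have T1 : 1 <= T%:R :> R by rewrite ler1n.
have p1 : 1 <= nE by rewrite ler1n.
have mp : 0 < m%:R :> R by rewrite ltr0n.
have Tp : 0 < T%:R :> R := lt_le_trans ltr01 T1.
have dp : 0 < d%:R :> R := lt_le_trans ltr01 d1.
have pp : 0 < nE := lt_le_trans ltr01 p1.
have di : 160 <= 1 / delta by rewrite div1r -[leLHS]invrK lef_pV2 ?posrE ?invr_gt0// ltW.
have ell1 : 1 <= logd by apply: ge1_ln; apply: le_trans di; rewrite ler_nat.
have ell0 : 0 < logd := lt_le_trans ltr01 ell1.
have sT : 0 < Num.sqrt T%:R :> R by rewrite sqrtr_gt0.
have sT2 : Num.sqrt T%:R ^+ 2 = T%:R :> R by rewrite sqr_sqrtr// ltW.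
have [dm dlam] := dim_log_le hd p0 m0 (edge_count_le hE) ell1 hmC.
have hTell : 1024 * 1024 * 1024 * 16 * logd ^+ 2 / Delta <= T%:R.
  apply: le_trans hT1; rewrite /v mul1r; apply: ler_wpM2l.
    exact: mulr_ge0 k0 (sqr_ge0 _).
  have DD : Delta ^+ 2 <= Delta by rewrite [leLHS]expr2 ler_piMl// ltW.
  by rewrite lef_pV2 ?posrE// exprn_gt0.
(* Square root of the upper bound on [T]; it is used in the smooth regime to compare the total
   variation with the noise level. *)
have sTD : Num.sqrt T%:R * Delta <= 512 * 512 * logd.
  have r0 : 0 <= 512 * 512 * logd := mulr_ge0 k1 (ltW ell0).
  rewrite -[leLHS]ger0_norm; last exact: mulr_ge0 (ltW sT) (ltW D0).
  apply: ler_abs_of_sqr => //.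
  rewrite [leLHS]exprMn sT2 [leRHS]exprMn -(ler_pdivlMr _ _ (exprn_gt0 2 D0)).
  by move: hT2; rewrite /v mul1r.
clear hT1 hT2 hmC k0 k1.
have lamE : L2 = ln d%:R + ln nE + logd.
  rewrite /L2 /logd -mulrA lnM ?posrE ?divr_gt0// -addrA; congr (_ + _).
  by rewrite -lnM ?posrE ?divr_gt0// div1r.
have lam1 : 1 <= L2.
  by rewrite lamE; move: (ln_ge0 d1) (ln_ge0 p1) ell1; clear; lra.
have hlam : nE * d%:R * expR (- L2) = delta.
  rewrite expRN /L2 lnK ?posrE ?divr_gt0 ?mulr_gt0//.
  by field; rewrite !gt_eqF.
have L1arg : 4 <= d%:R * T%:R / (delta * Delta).
  rewrite (ler_pdivlMr _ _ (mulr_gt0 delta0 D0)).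
  have := ler_pM ler01 ler01 d1 T1; rewrite mulr1.
  have := ler_pM (ltW delta0) (ltW D0) (ltW delta1) D1; rewrite mulr1.
  by clear; lra.
have L11 : 1 <= L1 by exact: ge1_ln.
have hL1 : d%:R * expR (- L1) <= delta.
  rewrite expRN /L1 lnK ?posrE ?divr_gt0 ?(mulr_gt0 dp Tp) ?(mulr_gt0 delta0 D0)//.
  rewrite invf_div [leLHS](_ : _ = delta * (Delta / T%:R)); last first.
    by field; rewrite !gt_eqF.
  by rewrite ler_piMr ?(ltW delta0)// ler_pdivrMr// mul1r (le_trans D1).
rewrite -/nE -lamE in dlam.
pose c2 := Num.sqrt (T%:R / Delta).
have c20 : 0 < c2 by rewrite sqrtr_gt0 divr_gt0.
have mu0 : 0 <= mu'  := max_row_norm_ge0 Dpinv.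
have dpow : d%:R <= (d%:R : R) `^ (3 / 2).
  by rewrite -[X in X <= _](powRr1 (ltW dp)) ler_powR//; clear; lra.
have dL1 : d%:R * L1 <= M0.
  rewrite /M0 le_max; apply/orP; left; by rewrite ler_wpM2r// (le_trans _ L11).
have M01 : 1 <= M0.
  by apply: le_trans dL1; have := ler_pM ler01 ler01 d1 L11; rewrite mulr1.
have M00 : 0 < M0 := lt_le_trans ltr01 M01.
have lam0 : 0 < L2 := lt_le_trans ltr01 lam1.
have muL2 : mu * L2 <= M0 by rewrite /M0 le_max lexx orbT.
pose c := T%:R / 1024 / 2 : R.
pose B := 32 * c2 * M0.
have c0 : 0 < c by rewrite /c; move: Tp; clear; lra.
have B0 : 0 < B by rewrite /B; apply: mulr_gt0 M00; rewrite mulr_gt0.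
pose ml := mu' ^+ 2 * L2.
have ml0 : 0 <= ml := mulr_ge0 (sqr_ge0 _) (ltW lam0).
(* Common to both regimes, which differ in how the jumps [Y] and the penalty difference [q] are then
   eliminated. *)
have key : ml <= 1 -> with_prob_at_least P (1 - delta)
    [set w | forall ahat, estimate w ahat ->
      let X := l2norm (ahat - astar) in let Y := l1norm (Dt *m (ahat - astar)) in
      let q := 2 * (tv - l1norm (Dt *m ahat)) in
      c * (X ^+ 2 - ml * Y ^+ 2) <= B * (X + Y + q) /\ 0 <= B * (X + Y + q)].
  move=> ml1.
  have := good_event hgauss hindep hA hrho rho0 hc m0 p0 hd hT lam1 hlam delta0 (ltW delta1)
    L11 hL1 hpinv ell1 ml1 hTell dm dlam.
  apply: with_prob_mono => // w [G1 G2 G3] ahat hest X Y q.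
  apply: (oracle_inequality (b1 := 16 * L1 * c2) (b2 := 16 * L2 * mu * c2) hc m0 hpinv
    (ltW c0) _ _ (ltW c20) G1 _ _ _ _ hest).
  - exact: ltW.
  - by apply: mulr_ge0 (ltW c20); rewrite mulr_ge0// (le_trans _ L11).
  - by move=> b a; apply: le_trans (G2 b a) _; rewrite -/c2 mulrAC.
  - by move=> k b a; exact: G3.
  - move: (ler_wpM2l (ltW c20) dL1); move: (L1) (M0) (c2); clear; move=> *; lra.
  - move: (ler_wpM2l (ltW c20) muL2); move: (L2) (mu) (M0) (c2); clear; move=> *; lra.
pose g := M / Num.sqrt T%:R.
have sD : 0 < Num.sqrt Delta by rewrite sqrtr_gt0.
have sm : 0 < Num.sqrt m%:R :> R by rewrite sqrtr_gt0.
have sm2 : Num.sqrt m%:R ^+ 2 = m%:R :> R by rewrite sqr_sqrtr// ltW.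
have ME : M = M0 / Num.sqrt Delta.
  by rewrite /M powRN div1r powR12_sqrt ?(ltW D0)// mulrC.
have gE : B / c = 1024 * 64 * g.
  have c2E : c2 = Num.sqrt T%:R / Num.sqrt Delta.
    by rewrite /c2 sqrtrM ?(ltW Tp)// sqrtrV// ltW.
  have cE : c = Num.sqrt T%:R ^+ 2 / 1024 / 2 by rewrite sT2.
  rewrite /g ME /B c2E cE.
  move: (M0) (Num.sqrt T%:R : R) (Num.sqrt Delta) sT sD; clear.
  by move=> M t D t0 D0; field; rewrite !gt_eqF.
have Mp : 0 < M by rewrite ME divr_gt0.
have g0 : 0 < g by rewrite divr_gt0.
have sqL2 : 0 < Num.sqrt L2 by rewrite sqrtr_gt0.
have rowE y : 0 <= y -> mu' * (1 + y) <= bound_row -> ml * (1 + y) ^+ 2 <= 32^-1 * 32^-1.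
  move=> y0; rewrite /bound_row [nE * d%:R]mulrC -/L2 ler_pdivlMr// => h.
  have h0 : 0 <= mu' * (1 + y) * Num.sqrt L2.
    exact: mulr_ge0 (mulr_ge0 mu0 (addr_ge0 ler01 y0)) (ltW sqL2).
  have := ler_pM h0 h0 h h; rewrite -expr2 exprMn (sqr_sqrtr (ltW lam0)).
  by rewrite /ml; move: (mu') (L2); clear; move=> a b; lra.
split => [hrow _|hrow _].
- have tv0 : 0 <= tv by apply: sumr_ge0.
  have y0 : 0 <= logd / Delta * tv by exact: mulr_ge0 (divr_ge0 (ltW ell0) (ltW D0)) tv0.
  have h1 := rowE _ y0 hrow.
  have ml8 : ml <= 8^-1.
    have : ml <= ml * (1 + logd / Delta * tv) ^+ 2.
      by rewrite ler_peMr// exprn_ege1// lerDl.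
    by move: h1; clear; lra.
  have ml1 : ml <= 1 by move: ml8; clear; lra.
  apply: with_prob_mono (key ml1) => //.
  move=> w /= H ahat /H[H1 H2].
  (* The row condition gives [ml * tv <= 2^-10 Delta / logd]. Since [M >= 1], one has
     [1 <= g sqrt T], and the upper bound on [T] then gives [Delta <= 2^18 logd g]; hence
     [ml * tv <= 2^8 g], below [B / c = 2^16 g]. *)
  have mltv : ml * tv <= B / c.
    have a1 : ml * (logd / Delta * tv) <= 32^-1 * 32^-1.
      apply: le_trans h1; rewrite ler_wpM2l//.
      move: (logd / Delta * tv) y0 => y y0; move: (sqr_ge0 y) y0; clear; lra.
    have a2 : ml * tv * logd <= 32^-1 * 32^-1 * Delta.
      by rewrite -ler_pdivrMr//; move: a1;
        rewrite (_ : ml * (logd / Delta * tv) = ml * tv * logd / Delta)//; ring.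
    have a4 : 1 <= g * Num.sqrt T%:R.
      rewrite /g divfK ?gt_eqF// ME ler_pdivlMr// mul1r; apply: le_trans M01.
      by rewrite -[leRHS]sqrtr1 ler_sqrt.
    rewrite gE.
    have a5 : Delta <= 512 * 512 * logd * g.
      move: (ler_wpM2r (ltW g0) sTD) (ler_wpM2l (ltW D0) a4);
        move: (g) (Delta) (logd) (Num.sqrt T%:R : R); clear; move=> *; lra.
    rewrite -(ler_pM2r ell0); move: a2 a5 (mulr_gt0 ell0 g0);
      move: (ml) (tv) (logd) (Delta) (g); clear; move=> *; lra.
  have ahatE : astar + (ahat - astar) = ahat by rewrite addrC subrK.
  have Yq : l1norm (Dt *m (ahat - astar)) + 2 * (tv - l1norm (Dt *m ahat)) <=
      4 * tv - l1norm (Dt *m (ahat - astar)).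
    have := l1normD_ge (Dt *m (ahat - astar)) (Dt *m astar).
    rewrite -mulmxDr ahatE -/tv; move: (l1norm _) (l1norm _); clear; move=> *; lra.
  have := smooth_rate (l2norm_ge0 _)
    (sumr_ge0 _ (fun _ _ => normr_ge0 _)) tv0 c0 B0 ml0 ml8 mltv Yq H1 H2.
  set X := l2norm _; rewrite gE.
  have -> : Num.sqrt (1024 * 64 * g * tv) = 32 * 8 * Num.sqrt (g * tv).
    rewrite -mulrA sqrtrM; last by clear; lra.
    congr (_ * _); rewrite (_ : 1024 * 64 = (32 * 8) ^+ 2); last by ring.
    by rewrite sqrtr_sqr ger0_norm//; clear; lra.
  have -> : M / Num.sqrt (m%:R * T%:R) = g / Num.sqrt m%:R.
    by rewrite sqrtrM ?(ltW mp)// /g; field; rewrite !gt_eqF.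
  have -> : Num.sqrt (M / (m%:R * Num.sqrt T%:R) * tv) = Num.sqrt (g * tv) / Num.sqrt m%:R.
    rewrite (_ : M / (m%:R * Num.sqrt T%:R) * tv = g * tv / m%:R); last first.
      by rewrite /g; field; rewrite !gt_eqF.
    by rewrite (sqrtrM _ (mulr_ge0 (ltW g0) tv0)) (sqrtrV (ltW mp)).
  have := sqrtr_ge0 (g * tv); move: (Num.sqrt (g * tv)) => u u0 hX.
  rewrite -mulrDl mulrA div1r mulrC ler_pM2r ?invr_gt0//.
  by move: hX u0 g0; move: (X) (g); clear; move=> *; lra.
- have [r0 onS] := compat_factor_bound Dt supp_star.
  rewrite -/s in r0 onS; set r := Num.sqrt s / _ in r0 onS hrow *.
  have h1 := rowE _ r0 hrow.
  have ml1 : ml <= 1.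
    have : ml <= ml * (1 + r) ^+ 2 by rewrite ler_peMr// exprn_ege1// lerDl.
    by move: h1; clear; lra.
  apply: with_prob_mono (key ml1) => //.
  move=> w /= H ahat /H[H1 H2].
  have ahatE : astar + (ahat - astar) = ahat by rewrite addrC subrK.
  have Yq : l1norm (Dt *m (ahat - astar)) + 2 * (tv - l1norm (Dt *m ahat)) <=
      4 * l1norm_on supp_star (Dt *m (ahat - astar)) - l1norm (Dt *m (ahat - astar)).
    have := l1norm_supp (Dt *m astar) (Dt *m (ahat - astar)).
    by rewrite -mulmxDr ahatE.
  have mlr : ml * (1 + r) ^+ 2 <= 32^-1 by move: h1; clear; lra.
  have := few_changes_rate (l2norm_ge0 _)
    (sumr_ge0 _ (fun _ _ => normr_ge0 _)) r0 (onS _) c0 B0 mlr Yq H1 H2 ml0.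
  set X := l2norm _; rewrite gE.
  have -> : M / Num.sqrt (m%:R * T%:R) = g / Num.sqrt m%:R.
    by rewrite sqrtrM ?(ltW mp)// /g; field; rewrite !gt_eqF.
  move=> hX; rewrite div1r mulrC.
  have -> : 1024 * 1024 * (g / Num.sqrt m%:R) * (1 + r) =
    1024 * 1024 * g * (1 + r) / Num.sqrt m%:R by ring.
  rewrite ler_pM2r ?invr_gt0//.
  have : 0 <= g * (1 + r) := mulr_ge0 (ltW g0) (addr_ge0 ler01 r0).
  by move: hX; move: (X) (g) (r); clear; move=> *; lra.
Qed.
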